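(* Let $p\ge 1$, $\sigma>0$, $C_0>0$. Let $f$ be a B--almost periodic function on $\mathbb{R}^p$ which extends to $\mathbb{C}^p$ as an entire function satisfying $$|f(z)|\le C_0 e^{\sigma|z|}\qquad\text{for all } z\in\mathbb{C}^p.$$ Then $\mathrm{sp}\, f\subset \{\lambda\in\mathbb{R}^p: |\lambda|\le\sigma\}$, i.e. $a(\lambda,f)=0$ for every $\lambda\in\mathbb{R}^p$ with $|\lambda|>\sigma$.
   Context: $|z|$ and $|x|$ denote the Euclidean norms on $\mathbb{C}^p$ and $\mathbb{R}^p$; $\langle x,y\rangle$ is the inner product on $\mathbb{R}^p$. The Besicovitch norm of a locally integrable $f$ on $\mathbb{R}^p$ is $\|f\|_B=\limsup_{T\to\infty}(2T)^{-p}\int_{[-T,T]^p}|f(x)|\,dx$. A function $f$ is B--almost periodic on $\mathbb{R}^p$ if for every $\varepsilon>0$ there is a generalized trigonometric polynomial $P(x)=\sum_{n} c_n e^{i\langle x,\lambda^{(n)}\rangle}$ (finite sum, $c_n\in\mathbb{C}$, $\lambda^{(n)}\in\mathbb{R}^p$) with $\|f-P\|_B<\varepsilon$. The Fourier coefficient of such $f$ at $\lambda\in\mathbb{R}^p$ is $a(\lambda,f)=\lim_{T\to\infty}(2T)^{-p}\int_{[-T,T]^p}f(x)e^{-i\langle x,\lambda\rangle}\,dx$ (this limit exists for B--almost periodic $f$), and the spectrum is $\mathrm{sp}\, f=\{\lambda\in\mathbb{R}^p: a(\lambda,f)\ne 0\}$. *)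

(* Defs.v *)
From Stdlib Require Import Reals List.
From Coquelicot Require Import Coquelicot.
Open Scope R_scope.

(* Points of R^p and C^p are represented as functions nat -> R / nat -> C,
   of which only the coordinates 0..p-1 are used. *)

Fixpoint sumn (p : nat) (a : nat -> R) : R :=
  match p with O => 0 | S m => sumn m a + a m end.

Definition rnorm (p : nat) (x : nat -> R) : R := sqrt (sumn p (fun i => x i ^ 2)).
Definition cnorm (p : nat) (z : nat -> C) : R := sqrt (sumn p (fun i => Cmod (z i) ^ 2)).
Definition inner (p : nat) (x y : nat -> R) : R := sumn p (fun i => x i * y i).

Definition cis (t : R) : C := (cos t, sin t).

Definition upd {A : Type} (z : nat -> A) (j : nat) (w : A) : nat -> A :=
  fun i => if Nat.eqb i j then w else z i.

Definition on_Cp (p : nat) (F : (nat -> C) -> C) : Prop :=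
  forall z w : nat -> C, (forall i, (i < p)%nat -> z i = w i) -> F z = F w.

(* F is entire on C^p: continuous and holomorphic in each variable separately
   (Osgood's definition of holomorphy). *)
Definition entire (p : nat) (F : (nat -> C) -> C) : Prop :=
  on_Cp p F /\
  (forall (z : nat -> C) (eps : R), 0 < eps -> exists delta : R, 0 < delta /\
     forall w : nat -> C, cnorm p (fun i => Cminus (w i) (z i)) < delta ->
       Cmod (Cminus (F w) (F z)) < eps) /\
  (forall (z : nat -> C) (j : nat), (j < p)%nat ->
     ex_derive (K := C_AbsRing) (V := C_NormedModule)
       (fun w : C => F (upd z j w)) (z j)).

Fixpoint cube_int (p : nat) (T : R) (g : (nat -> R) -> R) : R :=
  match p with
  | O => g (fun _ => 0)
  | S m => RInt (fun t => cube_int m T (fun x => g (upd x m t))) (- T) T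
  end.

Definition cube_avg (p : nat) (T : R) (g : (nat -> R) -> R) : R :=
  cube_int p T g / (2 * T) ^ p.

Definition trig_poly (p : nat) (P : list (C * (nat -> R))) (x : nat -> R) : C :=
  fold_right (fun cl acc => Cplus (Cmult (fst cl) (cis (inner p x (snd cl)))) acc)
    (RtoC 0) P.

(* B-almost periodicity of f : R^p -> C (f continuous here):
   for every eps > 0 there is a trig polynomial P with ||f - P||_B <= eps,
   where ||g||_B = limsup_{T->oo} (2T)^{-p} \int_{[-T,T]^p} |g|. *)
Definition B_almost_periodic (p : nat) (f : (nat -> R) -> C) : Prop :=
  forall eps : R, 0 < eps -> exists P : list (C * (nat -> R)),
    exists T0 : R, forall T : R, T0 <= T ->
      cube_avg p T (fun x => Cmod (Cminus (f x) (trig_poly p P x))) <= eps.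

Definition fourier_avg (p : nat) (f : (nat -> R) -> C) (lam : nat -> R) (T : R) : C :=
  (cube_avg p T (fun x => fst (Cmult (f x) (cis (- inner p x lam)))),
   cube_avg p T (fun x => snd (Cmult (f x) (cis (- inner p x lam))))).

Definition fourier_coef_zero (p : nat) (f : (nat -> R) -> C) (lam : nat -> R) : Prop :=
  is_lim (fun T => fst (fourier_avg p f lam T)) p_infty 0 /\
  is_lim (fun T => snd (fourier_avg p f lam T)) p_infty 0.

Definition restrR (F : (nat -> C) -> C) : (nat -> R) -> C :=
  fun x => F (fun i => RtoC (x i)).

(* Main.v *)
(** Let [L = |lam| > sigma], [u = lam / L], and let [A] be the mean of
    [f(x) e^{-i<x,lam>}] over the cube [[-T,T]^p].  Approximating [f] by trigonometric
    polynomials, the mean [G(t)] of [f(x+tu) e^{-i<x+tu,lam>}] stays within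
    [O(eps) e^{pt/T}] of [A].  Integrate [G] against the Gamma-type kernel
    [t^n e^{-eta t}] with [n] of order [T], times a factor [e^{-delta e^{i alpha} t^2}] so
    close to 1 that it does not affect the mass: the result is [A] times the mass
    [n!/eta^{n+1}], up to [O(eps)] of that mass.  On the other hand, for each [x] in the cube the Gaussian factor
    allows the ray [t >= 0] to be rotated to [t e^{-i alpha}], where
    [alpha < pi/2] and [beta = L sin alpha - sigma > 0]; there the integrand is at most
    [C0 e^{sigma(|x|+t)} t^n e^{-L t sin alpha}], whose integral is
    [O(e^{sigma p T} n!/beta^{n+1})].  This is exponentially smaller than the mass once
    [eta = beta e^{-(sigma p + 1)}]. *)

Require Import Defs.
From Stdlib Require Import Reals List Factorial Lra Lia Classical ClassicalEpsilon FunctionalExtensionality.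
From Coquelicot Require Import Coquelicot.
Open Scope R_scope.

(** On the real ray [f] is controlled only by [e^{sigma t}], and its means are stable under a shift
    by [t] only up to the factor [e^{pt/T}]. The kernel therefore has to concentrate at [t]
    comparable to [T], where that factor stays bounded. Base points in the cube cost [e^{sigma p T}]
    on the rotated ray, and a power [n] of order [T] is what turns a fixed ratio [eta / beta] into a
    gain exponential in [T]. The price is a rate [eta] that may be far below [sigma], so
    [e^{-eta t}] cannot control the side that closes the contour; this is why a Gaussian factor is
    needed. Its coefficient has argument [alpha] for symmetry: on the sector between the two rays
    [s^2] has arguments from [-2 alpha] to [0], and multiplication by [e^{i alpha}] centres them in
    [[-alpha, alpha]], where the real part is at least [cos alpha] times the modulus. Positivity of
    [cos alpha] is why the rotation stops short of a right angle. *)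

Lemma functional_choice {A B : Type} (P : A -> B -> Prop) :
  (forall a, exists b, P a b) -> exists f, forall a, P a (f a).
Proof.
  intros H. exists (fun a => proj1_sig (constructive_indefinite_description _ (H a))).
  intros a. apply proj2_sig.
Qed.

(** * Continuity of complex-valued maps *)

Definition CC {U : UniformSpace} (f : U -> C) : Prop :=
  (forall u, continuous (fun v => fst (f v)) u) /\
  (forall u, continuous (fun v => snd (f v)) u).

Lemma continuous_eps {U : UniformSpace} (f : U -> R) (u : U) :
  continuous f u <->
  forall eps : R, 0 < eps -> exists delta : posreal,
    forall v, ball u delta v -> Rabs (f v - f u) < eps.
Proof.
  split.
  - intros H eps He.
    destruct (H (fun y => Rabs (y - f u) < eps)) as [d Hd].
    + exists (mkposreal eps He); intros y Hy; exact Hy.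
    + exists d; intros v Hv; apply Hd, Hv.
  - intros H P [eps HP].
    destruct (H eps (cond_pos eps)) as [d Hd].
    exists d; intros v Hv; apply HP; exact (Hd v Hv).
Qed.

Lemma continuous_pair {U V W : UniformSpace} (f : U -> V) (g : U -> W) (u : U) :
  continuous f u -> continuous g u -> continuous (fun v => (f v, g v)) u.
Proof.
  intros Hf Hg P [e He].
  assert (A : locally u (fun v => ball (f u) e (f v))) by exact (Hf _ (locally_ball (f u) e)).
  assert (B : locally u (fun v => ball (g u) e (g v))) by exact (Hg _ (locally_ball (g u) e)).
  generalize (filter_and _ _ A B).
  unfold filtermap; apply filter_imp. intros v [X Y]. apply He. split; assumption.
Qed.

Lemma Cmod_le_abs (z : C) : Cmod z <= Rabs (fst z) + Rabs (snd z).
Proof.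
  unfold Cmod.
  apply Rsqr_incr_0_var.
  2: { generalize (Rabs_pos (fst z)), (Rabs_pos (snd z)); lra. }
  rewrite Rsqr_sqrt by (generalize (pow2_ge_0 (fst z)), (pow2_ge_0 (snd z)); lra).
  unfold Rsqr. rewrite <- (pow2_abs (fst z)), <- (pow2_abs (snd z)).
  generalize (Rabs_pos (fst z)), (Rabs_pos (snd z)); nra.
Qed.

Lemma fst_le_Cmod (z : C) : Rabs (fst z) <= Cmod z.
Proof. eapply Rle_trans; [apply Rmax_l | apply Rmax_Cmod]. Qed.

Lemma snd_le_Cmod (z : C) : Rabs (snd z) <= Cmod z.
Proof. eapply Rle_trans; [apply Rmax_r | apply Rmax_Cmod]. Qed.

(** Passes between continuity of the two components, which integrals taken componentwise require,
    and estimates of the modulus, which complex arguments produce. *)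
Lemma CC_eps {U : UniformSpace} (f : U -> C) :
  CC f <-> forall u (eps : R), 0 < eps -> exists delta : posreal,
    forall v, ball u delta v -> Cmod (f v - f u) < eps.
Proof.
  split.
  - intros [H1 H2] u eps He.
    assert (He2 : 0 < eps / 2) by lra.
    destruct (proj1 (continuous_eps _ u) (H1 u) _ He2) as [d1 Hd1].
    destruct (proj1 (continuous_eps _ u) (H2 u) _ He2) as [d2 Hd2].
    assert (Hd : 0 < Rmin d1 d2) by (apply Rmin_pos; apply cond_pos).
    exists (mkposreal _ Hd); intros v Hv.
    eapply Rle_lt_trans; [apply Cmod_le_abs|].
    assert (A := Hd1 v (ball_le _ _ _ (Rmin_l _ _) _ Hv)).
    assert (B := Hd2 v (ball_le _ _ _ (Rmin_r _ _) _ Hv)).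
    change (Rabs (fst (f v) - fst (f u)) + Rabs (snd (f v) - snd (f u)) < eps). lra.
  - intros H; split; intro u; apply continuous_eps; intros eps He;
      destruct (H u eps He) as [d Hd]; exists d; intros v Hv;
      (eapply Rle_lt_trans; [| apply (Hd v Hv)]).
    + apply (fst_le_Cmod (f v - f u)).
    + apply (snd_le_Cmod (f v - f u)).
Qed.

Section ContinuousComplex.
Context {U : UniformSpace}.
Implicit Types f g : U -> C.

Lemma CC_const (c : C) : CC (fun _ : U => c).
Proof. split; intro u; apply continuous_const. Qed.

Lemma CC_RtoC (f : U -> R) : (forall u, continuous f u) -> CC (fun u => RtoC (f u)).
Proof. intros H; split; intro u; simpl; [apply H | apply continuous_const]. Qed.

Lemma CC_plus f g : CC f -> CC g -> CC (fun u => Cplus (f u) (g u)).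
Proof.
  intros [H1 H2] [H3 H4]; split; intro u; simpl;
    apply (@continuous_plus U R_AbsRing R_NormedModule); auto.
Qed.

Lemma CC_minus f g : CC f -> CC g -> CC (fun u => Cminus (f u) (g u)).
Proof.
  intros [H1 H2] [H3 H4]; split; intro u; simpl;
    apply (@continuous_minus U R_AbsRing R_NormedModule); auto.
Qed.

Lemma CC_mult f g : CC f -> CC g -> CC (fun u => Cmult (f u) (g u)).
Proof.
  intros [H1 H2] [H3 H4]; split; intro u; simpl.
  - apply (@continuous_minus U R_AbsRing R_NormedModule);
      apply (@continuous_mult U R_AbsRing); auto.
  - apply (@continuous_plus U R_AbsRing R_NormedModule);
      apply (@continuous_mult U R_AbsRing); auto.
Qed.

Lemma CC_cis (f : U -> R) : (forall u, continuous f u) -> CC (fun u => cis (f u)).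
Proof.
  intros H; split; intro u; simpl.
  - apply continuous_comp; [apply H | apply continuous_cos].
  - apply continuous_comp; [apply H | apply continuous_sin].
Qed.

Lemma CC_Cmod f : CC f -> forall u, continuous (fun v => Cmod (f v)) u.
Proof.
  intros Hf u. apply continuous_eps; intros eps He.
  destruct (proj1 (CC_eps f) Hf u eps He) as [d Hd].
  exists d; intros v Hv.
  eapply Rle_lt_trans; [| apply (Hd v Hv)].
  apply Rabs_le; split.
  - assert (A := Cmod_triangle (f v) (f u - f v)).
    replace (f v + (f u - f v))%C with (f u) in A by ring.
    replace (f v - f u)%C with (- (f u - f v))%C by ring.
    rewrite Cmod_opp. lra.
  - assert (A := Cmod_triangle (f u) (f v - f u)).
    replace (f u + (f v - f u))%C with (f v) in A by ring. lra.
Qed.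

End ContinuousComplex.

Lemma CC_comp {U V : UniformSpace} (f : V -> C) (g : U -> V) :
  CC f -> (forall u, continuous g u) -> CC (fun u => f (g u)).
Proof.
  intros [H1 H2] Hg; split; intro u.
  - apply (continuous_comp g (fun v => fst (f v))); auto.
  - apply (continuous_comp g (fun v => snd (f v))); auto.
Qed.

(** * Complex-valued integrals over real intervals *)

Definition CInt (f : R -> C) (a b : R) : C :=
  (RInt (fun t => fst (f t)) a b, RInt (fun t => snd (f t)) a b).

Lemma ex_RInt_cont (f : R -> R) a b : (forall t, continuous f t) -> ex_RInt f a b.
Proof. intros H; apply @ex_RInt_continuous; intros; apply H. Qed.

Lemma CInt_ext (f g : R -> C) a b : (forall t, f t = g t) -> CInt f a b = CInt g a b.
Proof.
  intros H; unfold CInt; f_equal; apply RInt_ext; intros; rewrite H; reflexivity.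
Qed.

Lemma CInt_plus (f g : R -> C) a b : CC f -> CC g ->
  CInt (fun t => Cplus (f t) (g t)) a b = Cplus (CInt f a b) (CInt g a b).
Proof.
  intros [H1 H2] [H3 H4]; unfold CInt, Cplus; simpl; f_equal;
    apply @RInt_plus; apply ex_RInt_cont; auto.
Qed.

Lemma CInt_scal (c : C) (f : R -> C) a b : CC f ->
  CInt (fun t => Cmult c (f t)) a b = Cmult c (CInt f a b).
Proof.
  intros [H1 H2]; unfold CInt, Cmult; simpl.
  assert (E1 : ex_RInt (fun t : R => fst (f t)) a b) by exact (ex_RInt_cont _ a b H1).
  assert (E2 : ex_RInt (fun t : R => snd (f t)) a b) by exact (ex_RInt_cont _ a b H2).
  assert (S : forall k (h : R -> R), ex_RInt h a b ->
     ex_RInt (fun t => k * h t) a b /\ RInt (fun t => k * h t) a b = k * RInt h a b).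
  { intros k h Hh; split.
    - exact (@ex_RInt_scal R_NormedModule h a b k Hh).
    - apply (@RInt_scal R_CompleteNormedModule h a b k Hh). }
  f_equal.
  - rewrite <- (proj2 (S (fst c) _ E1)), <- (proj2 (S (snd c) _ E2)).
    apply (@RInt_minus R_CompleteNormedModule); apply S; assumption.
  - rewrite <- (proj2 (S (fst c) _ E2)), <- (proj2 (S (snd c) _ E1)).
    apply (@RInt_plus R_CompleteNormedModule); apply S; assumption.
Qed.

Lemma CInt_minus (f g : R -> C) a b : CC f -> CC g ->
  CInt (fun t => Cminus (f t) (g t)) a b = Cminus (CInt f a b) (CInt g a b).
Proof.
  intros [H1 H2] [H3 H4]; unfold CInt, Cminus, Cplus, Copp; simpl; f_equal;
    apply (@RInt_minus R_CompleteNormedModule); apply ex_RInt_cont; auto.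
Qed.

Lemma CInt_const (c : C) a b : CInt (fun _ => c) a b = Cmult (RtoC (b - a)) c.
Proof.
  unfold CInt; rewrite !RInt_const; unfold scal; simpl; unfold mult; simpl.
  unfold Cmult; simpl; f_equal; ring.
Qed.

(** Test the integral [I] against its own conjugate: [|I|^2] is the integral of the real part of
    [conj I * f], which is at most [|I| |f|]. The case [I = 0] is separate because [|I|] is
    cancelled at the end. *)
Lemma Cmod_CInt_le (f : R -> C) a b : a <= b -> CC f ->
  Cmod (CInt f a b) <= RInt (fun t => Cmod (f t)) a b.
Proof.
  intros Hab Hf. set (I := CInt f a b).
  assert (Hm := CC_Cmod f Hf).
  assert (E0 : ex_RInt (fun t => Cmod (f t)) a b) by (apply ex_RInt_cont; auto).
  destruct (Req_dec (Cmod I) 0) as [H0|H0].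
  { rewrite H0. apply RInt_ge_0; auto. intros; apply Cmod_ge_0. }
  assert (Hp : 0 < Cmod I) by (generalize (Cmod_ge_0 I); lra).
  apply Rmult_le_reg_l with (Cmod I); [exact Hp|].
  assert (Hsq : Cmod I * Cmod I = fst I * fst I + snd I * snd I).
  { unfold Cmod. rewrite sqrt_sqrt; [ring|]. generalize (pow2_ge_0 (fst I)), (pow2_ge_0 (snd I)); lra. }
  rewrite Hsq.
  assert (E := CInt_scal (Cconj I) f a b Hf).
  assert (E1 : RInt (fun t => fst (Cconj I * f t)%C) a b = fst I * fst I + snd I * snd I).
  { change (fst (CInt (fun t => Cconj I * f t)%C a b) = fst I * fst I + snd I * snd I).
    rewrite E. fold I. simpl. ring. }
  rewrite <- E1.
  change (RInt (fun t => fst (Cconj I * f t)%C) a b <= scal (Cmod I) (RInt (fun t => Cmod (f t)) a b)).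
  rewrite <- (@RInt_scal R_CompleteNormedModule (fun t => Cmod (f t)) a b (Cmod I) E0).
  assert (Hc : CC (fun t => Cconj I * f t)%C) by (apply CC_mult; [apply CC_const | exact Hf]).
  apply RInt_le; [exact Hab | apply ex_RInt_cont; apply Hc |
    apply (@ex_RInt_scal R_NormedModule); exact E0 |].
  intros t _.
  eapply Rle_trans; [apply Rle_abs|]. eapply Rle_trans; [apply fst_le_Cmod|].
  rewrite Cmod_mult. unfold scal; simpl; unfold mult; simpl.
  rewrite Cmod_conj. apply Rle_refl.
Qed.

Lemma Cmod_CInt_le_const (f : R -> C) a b M : a <= b -> CC f ->
  (forall t, a <= t <= b -> Cmod (f t) <= M) -> Cmod (CInt f a b) <= (b - a) * M.
Proof.
  intros Hab Hf HM. eapply Rle_trans; [apply Cmod_CInt_le; assumption|].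
  assert (E := RInt_const (V := R_CompleteNormedModule) a b M).
  change (scal (b - a) M) with ((b - a) * M) in E. rewrite <- E.
  apply RInt_le; [exact Hab | apply ex_RInt_cont; apply CC_Cmod; exact Hf | apply ex_RInt_const |].
  intros; apply HM; lra.
Qed.

(** * Complex derivatives *)

(** The remainder is bounded by [eps |h|] without a division by [h], so [h = 0] is harmless and the
    bound can be integrated along segments. *)
Definition cderiv (g : C -> C) (w l : C) : Prop :=
  forall eps : R, 0 < eps -> exists delta : R, 0 < delta /\
    forall h : C, Cmod h < delta ->
      Cmod (g (w + h) - g w - l * h)%C <= eps * Cmod h.

Lemma is_derive_cderiv (g : C -> C) (w l : C) :
  is_derive (K := C_AbsRing) (V := C_NormedModule) g w l -> cderiv g w l.
Proof.
  intros [_ H] eps He.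
  destruct (H w (fun P HP => HP) (mkposreal eps He)) as [d Hd].
  exists d; split; [apply cond_pos|]. intros h Hh.
  assert (A : Cmod (w + h - w)%C < d ->
    Cmod (g (w + h) - g w - (w + h - w) * l)%C <= eps * Cmod (w + h - w)%C) by exact (Hd (w + h)%C).
  replace (w + h - w)%C with h in A by ring.
  rewrite (Cmult_comm l h). exact (A Hh).
Qed.

Lemma cderiv_bound (g : C -> C) (w l : C) : cderiv g w l ->
  exists delta, 0 < delta /\ forall h, Cmod h < delta ->
    Cmod (g (w + h) - g w)%C <= (1 + Cmod l) * Cmod h.
Proof.
  intros H. destruct (H 1 Rlt_0_1) as [d [Hd Hb]]. exists d; split; [exact Hd|].
  intros h Hh. specialize (Hb h Hh).
  replace (g (w + h) - g w)%C with ((g (w + h) - g w - l * h) + l * h)%C by ring.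
  eapply Rle_trans; [apply Cmod_triangle|]. rewrite Cmod_mult. lra.
Qed.

Definition ccont (g : C -> C) : Prop := forall z (eps : R), 0 < eps ->
  exists delta, 0 < delta /\ forall w, Cmod (w - z) < delta -> Cmod (g w - g z) < eps.

Lemma cderiv_ccont (g g' : C -> C) : (forall w, cderiv g w (g' w)) -> ccont g.
Proof.
  intros H z eps He. destruct (cderiv_bound _ _ _ (H z)) as [d [Hd Hb]].
  assert (Hl := Cmod_ge_0 (g' z)).
  exists (Rmin d (eps / (2 + Cmod (g' z)))); split.
  { apply Rmin_pos; [exact Hd|]. apply Rdiv_lt_0_compat; lra. }
  intros w Hw. specialize (Hb (w - z)%C (Rlt_le_trans _ _ _ Hw (Rmin_l _ _))).
  replace (z + (w - z))%C with w in Hb by ring.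
  eapply Rle_lt_trans; [exact Hb|].
  assert (Hw2 := Rlt_le_trans _ _ _ Hw (Rmin_r _ _)).
  assert (Hc := Cmod_ge_0 (w - z)).
  apply Rle_lt_trans with ((2 + Cmod (g' z)) * Cmod (w - z)).
  - apply Rmult_le_compat_r; lra.
  - apply Rmult_lt_reg_l with (/ (2 + Cmod (g' z))); [apply Rinv_0_lt_compat; lra|].
    rewrite <- Rmult_assoc, Rinv_l, Rmult_1_l by lra.
    rewrite Rmult_comm. exact Hw2.
Qed.

Lemma CC_ccont {U : UniformSpace} (g : C -> C) (f : U -> C) :
  ccont g -> CC f -> CC (fun u => g (f u)).
Proof.
  intros Hg Hf. apply CC_eps; intros u eps He.
  destruct (Hg (f u) eps He) as [d [Hd Hb]].
  destruct (proj1 (CC_eps f) Hf u d Hd) as [r Hr].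
  exists r; intros v Hv; apply Hb, Hr, Hv.
Qed.

Lemma cderiv_affine (a b w : C) : cderiv (fun s => a + s * b)%C w b.
Proof.
  intros eps He. exists 1; split; [lra|]. intros h _.
  replace (a + (w + h) * b - (a + w * b) - b * h)%C with (RtoC 0) by ring.
  rewrite Cmod_0. apply Rmult_le_pos; [lra | apply Cmod_ge_0].
Qed.

(** The remainder splits into the product of the two increments and the two single remainders, each
    at most [eps / 3] times [|h|]. The 1 added to the moduli in the denominators covers vanishing
    values and derivatives. *)
Lemma cderiv_mult (f g : C -> C) (w l m : C) : cderiv f w l -> cderiv g w m ->
  cderiv (fun s => f s * g s)%C w (l * g w + f w * m)%C.
Proof.
  intros Hf Hg eps He.
  destruct (cderiv_bound _ _ _ Hf) as [d0 [Hd0 B0]].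
  assert (G0 := Cmod_ge_0 (g w)). assert (F0 := Cmod_ge_0 (f w)).
  assert (M0 := Cmod_ge_0 m). assert (L0 := Cmod_ge_0 l).
  assert (E1 : 0 < eps / (3 * (1 + Cmod (g w)))) by (apply Rdiv_lt_0_compat; lra).
  assert (E2 : 0 < eps / (3 * (1 + Cmod (f w)))) by (apply Rdiv_lt_0_compat; lra).
  destruct (Hf _ E1) as [d1 [Hd1 B1]]. destruct (Hg _ E2) as [d2 [Hd2 B2]].
  destruct (cderiv_bound _ _ _ Hg) as [d3 [Hd3 B3]].
  assert (E4 : 0 < eps / (3 * ((1 + Cmod l) * (1 + Cmod m)))).
  { apply Rdiv_lt_0_compat; [lra|]. apply Rmult_lt_0_compat; [lra|]. apply Rmult_lt_0_compat; lra. }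
  set (d := Rmin (Rmin d0 d1) (Rmin (Rmin d2 d3) (eps / (3 * ((1 + Cmod l) * (1 + Cmod m)))))).
  exists d; split.
  { unfold d; repeat apply Rmin_pos; assumption. }
  intros h Hh.
  assert (h0 : Cmod h < d0) by (eapply Rlt_le_trans; [exact Hh|]; eapply Rle_trans; [apply Rmin_l|apply Rmin_l]).
  assert (h1 : Cmod h < d1) by (eapply Rlt_le_trans; [exact Hh|]; eapply Rle_trans; [apply Rmin_l|apply Rmin_r]).
  assert (h2 : Cmod h < d2) by (eapply Rlt_le_trans; [exact Hh|]; eapply Rle_trans; [apply Rmin_r|]; eapply Rle_trans; [apply Rmin_l|apply Rmin_l]).
  assert (h3 : Cmod h < d3) by (eapply Rlt_le_trans; [exact Hh|]; eapply Rle_trans; [apply Rmin_r|]; eapply Rle_trans; [apply Rmin_l|apply Rmin_r]).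
  assert (h4 : Cmod h < eps / (3 * ((1 + Cmod l) * (1 + Cmod m)))) by (eapply Rlt_le_trans; [exact Hh|]; eapply Rle_trans; [apply Rmin_r|apply Rmin_r]).
  specialize (B0 h h0). specialize (B1 h h1). specialize (B2 h h2). specialize (B3 h h3).
  set (F := f (w + h)%C) in *. set (G := g (w + h)%C) in *.
  replace (F * G - f w * g w - (l * g w + f w * m) * h)%C with
    ((F - f w) * (G - g w) + (F - f w - l * h) * g w + f w * (G - g w - m * h))%C by ring.
  assert (Hn := Cmod_ge_0 h).
  assert (T1 : Cmod ((F - f w) * (G - g w))%C <= eps / 3 * Cmod h).
  { rewrite Cmod_mult.
    apply Rle_trans with (((1 + Cmod l) * Cmod h) * ((1 + Cmod m) * Cmod h)).
    - apply Rmult_le_compat; try apply Cmod_ge_0; assumption.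
    - apply Rle_trans with ((((1 + Cmod l) * (1 + Cmod m)) * Cmod h) * Cmod h); [apply Req_le; ring|].
      apply Rmult_le_compat_r; [exact Hn|].
      apply Rlt_le in h4. apply Rmult_le_compat_l with (r := (1 + Cmod l) * (1 + Cmod m)) in h4.
      + eapply Rle_trans; [exact h4|]. apply Req_le. field. split; lra.
      + apply Rmult_le_pos; lra. }
  assert (T2 : Cmod ((F - f w - l * h) * g w)%C <= eps / 3 * Cmod h).
  { rewrite Cmod_mult.
    apply Rle_trans with ((eps / (3 * (1 + Cmod (g w))) * Cmod h) * (1 + Cmod (g w))).
    - apply Rmult_le_compat; try apply Cmod_ge_0; [assumption | lra].
    - apply Req_le; field; lra. }
  assert (T3 : Cmod (f w * (G - g w - m * h))%C <= eps / 3 * Cmod h).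
  { rewrite Cmod_mult.
    apply Rle_trans with ((1 + Cmod (f w)) * (eps / (3 * (1 + Cmod (f w))) * Cmod h)).
    - apply Rmult_le_compat; try apply Cmod_ge_0; [lra | assumption].
    - apply Req_le; field; lra. }
  eapply Rle_trans; [apply Cmod_triangle|].
  assert (T4 := Cmod_triangle ((F - f w) * (G - g w)) ((F - f w - l * h) * g w)). lra.
Qed.

Lemma cderiv_comp (f g : C -> C) (w l m : C) : cderiv g w m -> cderiv f (g w) l ->
  cderiv (fun s => f (g s)) w (l * m)%C.
Proof.
  intros Hg Hf eps He.
  assert (M0 := Cmod_ge_0 m). assert (L0 := Cmod_ge_0 l).
  assert (E1 : 0 < eps / (2 * (1 + Cmod m))) by (apply Rdiv_lt_0_compat; lra).
  assert (E2 : 0 < eps / (2 * (1 + Cmod l))) by (apply Rdiv_lt_0_compat; lra).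
  destruct (Hf _ E1) as [d1 [Hd1 B1]]. destruct (Hg _ E2) as [d2 [Hd2 B2]].
  destruct (cderiv_bound _ _ _ Hg) as [d3 [Hd3 B3]].
  exists (Rmin (d1 / (1 + Cmod m)) (Rmin d2 d3)); split.
  { repeat apply Rmin_pos; try assumption. apply Rdiv_lt_0_compat; lra. }
  intros h Hh. assert (Hn := Cmod_ge_0 h).
  assert (h1 : Cmod h < d1 / (1 + Cmod m)) by (eapply Rlt_le_trans; [exact Hh|apply Rmin_l]).
  assert (h2 : Cmod h < d2) by (eapply Rlt_le_trans; [exact Hh|]; eapply Rle_trans; [apply Rmin_r|apply Rmin_l]).
  assert (h3 : Cmod h < d3) by (eapply Rlt_le_trans; [exact Hh|]; eapply Rle_trans; [apply Rmin_r|apply Rmin_r]).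
  specialize (B2 h h2). specialize (B3 h h3).
  assert (Hk : Cmod (g (w + h) - g w)%C < d1).
  { eapply Rle_lt_trans; [exact B3|].
    apply Rmult_lt_compat_l with (r := 1 + Cmod m) in h1; [|lra].
    replace ((1 + Cmod m) * (d1 / (1 + Cmod m))) with d1 in h1 by (field; lra). exact h1. }
  specialize (B1 _ Hk).
  replace (g w + (g (w + h) - g w))%C with (g (w + h)%C) in B1 by ring.
  replace (f (g (w + h)) - f (g w) - l * m * h)%C with
    ((f (g (w + h)%C) - f (g w) - l * (g (w + h)%C - g w)) + l * (g (w + h)%C - g w - m * h))%C by ring.
  eapply Rle_trans; [apply Cmod_triangle|]. rewrite Cmod_mult.
  assert (T1 : eps / (2 * (1 + Cmod m)) * Cmod (g (w + h) - g w)%C <= eps / 2 * Cmod h).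
  { apply Rle_trans with (eps / (2 * (1 + Cmod m)) * ((1 + Cmod m) * Cmod h)).
    - apply Rmult_le_compat_l; [lra | exact B3].
    - apply Req_le; field; lra. }
  assert (T2 : Cmod l * Cmod (g (w + h) - g w - m * h)%C <= eps / 2 * Cmod h).
  { apply Rle_trans with ((1 + Cmod l) * (eps / (2 * (1 + Cmod l)) * Cmod h)).
    - apply Rmult_le_compat; try apply Cmod_ge_0; [lra | exact B2]. 
    - apply Req_le; field; lra. }
  lra.
Qed.

(** * The complex exponential *)

Definition cexp (z : C) : C := (RtoC (exp (fst z)) * cis (snd z))%C.

Lemma cis_add (a b : R) : cis (a + b) = (cis a * cis b)%C.
Proof. unfold cis, Cmult; simpl. rewrite cos_plus, sin_plus. f_equal; ring. Qed.

Lemma Cmod_cis (t : R) : Cmod (cis t) = 1.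
Proof.
  unfold Cmod, cis; simpl.
  replace (_ + _) with 1; [apply sqrt_1|].
  generalize (sin2_cos2 t); unfold Rsqr; lra.
Qed.

Lemma cis_0 : cis 0 = RtoC 1.
Proof. unfold cis; rewrite cos_0, sin_0; reflexivity. Qed.

Lemma cexp_add (a b : C) : cexp (a + b) = (cexp a * cexp b)%C.
Proof.
  unfold cexp. simpl. rewrite exp_plus, cis_add, RtoC_mult. ring.
Qed.

Lemma Cmod_cexp (z : C) : Cmod (cexp z) = exp (fst z).
Proof.
  unfold cexp. rewrite Cmod_mult, Cmod_cis, Cmod_R, Rabs_pos_eq; [ring|].
  apply Rlt_le, exp_pos.
Qed.

Lemma derive_at_0_bound (f : R -> R) (l : R) : is_derive f 0 l ->
  forall eps, 0 < eps -> exists d, 0 < d /\ forall x, Rabs x < d ->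
    Rabs (f x - f 0 - l * x) <= eps * Rabs x.
Proof.
  intros [_ H] eps He.
  destruct (H 0 (fun P HP => HP) (mkposreal eps He)) as [d Hd].
  exists d; split; [apply cond_pos|]. intros x Hx.
  assert (A : Rabs (x - 0) < d -> Rabs (f x - f 0 - (x - 0) * l) <= eps * Rabs (x - 0)) by exact (Hd x).
  rewrite Rminus_0_r in A.
  rewrite (Rmult_comm l x). exact (A Hx).
Qed.

(** For [h = a + ib] the components of the remainder are [(e^a - 1 - a) + e^a (cos b - 1)] and
    [e^a (sin b - b) + (e^a - 1) b]. The last product is of second order, whence the demand
    [|h| < eps / 16]; the four terms add up to at most [9 eps / 16] times [|h|]. *)
Lemma cderiv_cexp_0 : cderiv cexp (RtoC 0) (RtoC 1).
Proof.
  intros eps He.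
  assert (De : is_derive exp 0 1). { generalize (is_derive_exp 0); rewrite exp_0; auto. }
  assert (Dc : is_derive cos 0 0).
  { generalize (is_derive_cos 0); rewrite sin_0, Ropp_0; auto. }
  assert (Ds : is_derive sin 0 1). { generalize (is_derive_sin 0); rewrite cos_0; auto. }
  assert (E : 0 < Rmin 1 (eps / 16)) by (apply Rmin_pos; lra).
  destruct (derive_at_0_bound _ _ De _ E) as [d1 [Hd1 B1]].
  destruct (derive_at_0_bound _ _ Dc _ E) as [d2 [Hd2 B2]].
  destruct (derive_at_0_bound _ _ Ds _ E) as [d3 [Hd3 B3]].
  exists (Rmin (Rmin 1 (eps / 16)) (Rmin d1 (Rmin d2 d3))); split; [repeat apply Rmin_pos; lra|].
  intros h Hh. destruct h as [a b].
  assert (Ha := fst_le_Cmod (a, b)). assert (Hb := snd_le_Cmod (a, b)). simpl in Ha, Hb.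
  set (m := Cmod (a, b)) in *.
  assert (m1 : m < 1 /\ m < eps / 16 /\ m < d1 /\ m < d2 /\ m < d3).
  { generalize (Rmin_l (Rmin 1 (eps / 16)) (Rmin d1 (Rmin d2 d3))) (Rmin_r (Rmin 1 (eps / 16)) (Rmin d1 (Rmin d2 d3)))
      (Rmin_l 1 (eps / 16)) (Rmin_r 1 (eps / 16)) (Rmin_l d1 (Rmin d2 d3)) (Rmin_r d1 (Rmin d2 d3)) (Rmin_l d2 d3) (Rmin_r d2 d3).
    intros; repeat split; lra. }
  destruct m1 as [m1 [m2 [m3 [m4 m5]]]].
  assert (C1 := B1 a ltac:(lra)). assert (C2 := B2 b ltac:(lra)). assert (C3 := B3 b ltac:(lra)).
  rewrite exp_0 in C1. rewrite cos_0 in C2. rewrite sin_0 in C3.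
  set (q := Rmin 1 (eps / 16)) in *.
  assert (q1 : q <= 1) by apply Rmin_l. assert (q2 : q <= eps / 16) by apply Rmin_r.
  assert (m0 : 0 <= m) by apply Cmod_ge_0.
  assert (X1 : Rabs (exp a - 1 - a) <= eps / 16 * m).
  { replace (exp a - 1 - a) with (exp a - 1 - 1 * a) by ring. eapply Rle_trans; [exact C1|].
    apply Rmult_le_compat; try lra; apply Rabs_pos. }
  assert (X2 : Rabs (cos b - 1) <= eps / 16 * m).
  { replace (cos b - 1) with (cos b - 1 - 0 * b) by ring. eapply Rle_trans; [exact C2|].
    apply Rmult_le_compat; try lra; apply Rabs_pos. }
  assert (X3 : Rabs (sin b - b) <= eps / 16 * m).
  { replace (sin b - b) with (sin b - 0 - 1 * b) by ring. eapply Rle_trans; [exact C3|].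
    apply Rmult_le_compat; try lra; apply Rabs_pos. }
  assert (X4 : Rabs (exp a - 1) <= 2 * m).
  { replace (exp a - 1) with ((exp a - 1 - 1 * a) + a) by ring.
    eapply Rle_trans; [apply Rabs_triang|].
    apply Rle_trans with (q * Rabs a + m); [lra|].
    assert (q * Rabs a <= 1 * m) by (apply Rmult_le_compat; try lra; apply Rabs_pos). lra. }
  assert (X5 : Rabs (exp a) <= 3).
  { replace (exp a) with ((exp a - 1) + 1) by ring. eapply Rle_trans; [apply Rabs_triang|].
    rewrite Rabs_R1. lra. }
  eapply Rle_trans; [apply Cmod_le_abs|].
  unfold cexp, cis; simpl. rewrite !Rplus_0_l, exp_0, cos_0, sin_0.
  replace (exp a * cos b - 0 * sin b + - (1 * 1 - 0 * 0) + - (1 * a - 0 * b))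
    with ((exp a - 1 - a) + exp a * (cos b - 1)) by ring.
  replace (exp a * sin b + 0 * cos b + - (1 * 0 + 0 * 1) + - (1 * b + 0 * a))
    with (exp a * (sin b - b) + (exp a - 1) * b) by ring.
  assert (Y1 := Rabs_triang (exp a - 1 - a) (exp a * (cos b - 1))).
  assert (Y2 := Rabs_triang (exp a * (sin b - b)) ((exp a - 1) * b)).
  rewrite Rabs_mult in Y1. rewrite (Rabs_mult (exp a)), (Rabs_mult (exp a - 1)) in Y2.
  assert (0 <= eps * m) by (apply Rmult_le_pos; lra).
  assert (Z1 : Rabs (exp a) * Rabs (cos b - 1) <= 3 * (eps / 16 * m)).
  { apply Rmult_le_compat; try apply Rabs_pos; lra. }
  assert (Z2 : Rabs (exp a) * Rabs (sin b - b) <= 3 * (eps / 16 * m)).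
  { apply Rmult_le_compat; try apply Rabs_pos; lra. }
  assert (Z3 : Rabs (exp a - 1) * Rabs b <= (2 * m) * (eps / 16)).
  { apply Rmult_le_compat; try apply Rabs_pos; lra. }
  lra.
Qed.

Lemma cderiv_cexp (w : C) : cderiv cexp w (cexp w).
Proof.
  intros eps He.
  assert (E : 0 < eps / (1 + Cmod (cexp w))) by (apply Rdiv_lt_0_compat; generalize (Cmod_ge_0 (cexp w)); lra).
  destruct (cderiv_cexp_0 _ E) as [d [Hd B]]. exists d; split; [exact Hd|].
  intros h Hh. specialize (B h Hh).
  assert (E0 : cexp (RtoC 0) = RtoC 1).
  { unfold cexp; simpl. rewrite exp_0, cis_0. ring. }
  rewrite E0 in B. replace (RtoC 0 + h)%C with h in B by ring.
  rewrite cexp_add. replace (cexp w * cexp h - cexp w - cexp w * h)%C with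
    (cexp w * (cexp h - RtoC 1 - RtoC 1 * h))%C by ring.
  rewrite Cmod_mult. assert (W := Cmod_ge_0 (cexp w)).
  apply Rle_trans with ((1 + Cmod (cexp w)) * (eps / (1 + Cmod (cexp w)) * Cmod h)).
  - apply Rmult_le_compat; try apply Cmod_ge_0; lra.
  - apply Req_le; field; lra.
Qed.

Lemma ccont_cexp : ccont cexp.
Proof. exact (cderiv_ccont _ _ cderiv_cexp). Qed.

(** * Cauchy's theorem for triangles *)

Lemma CInt_comp_lin (f : R -> C) (u v a b : R) : CC f ->
  CInt f (u * a + v) (u * b + v) = (RtoC u * CInt (fun t : R => f (u * t + v)%R) a b)%C.
Proof.
  intros Hf.
  assert (Hg : CC (fun t : R => f (u * t + v))).
  { apply (CC_comp f (fun t : R => u * t + v)); [exact Hf|].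
    intros t. apply (ex_derive_continuous (K := R_AbsRing) (V := R_NormedModule)). auto_derive; auto. }
  rewrite <- CInt_scal by exact Hg.
  destruct Hf as [H1 H2]. unfold CInt. f_equal.
  - rewrite <- (@RInt_comp_lin R_CompleteNormedModule) by (apply ex_RInt_cont; exact H1).
    apply RInt_ext; intros x _. unfold scal, mult; simpl. unfold mult; simpl. ring.
  - rewrite <- (@RInt_comp_lin R_CompleteNormedModule) by (apply ex_RInt_cont; exact H2).
    apply RInt_ext; intros x _. unfold scal, mult; simpl. unfold mult; simpl. ring.
Qed.

Definition seg_int (g : C -> C) (a b : C) : C :=
  ((b - a) * CInt (fun t : R => g (a + RtoC t * (b - a))%C) 0 1)%C.

Lemma CC_line (a b : C) : CC (fun t : R => (a + RtoC t * b)%C).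
Proof.
  apply CC_plus; [apply CC_const|].
  apply CC_mult; [|apply CC_const].
  apply CC_RtoC. intros; apply continuous_id.
Qed.

Lemma CC_on_line (g : C -> C) (a b : C) : ccont g -> CC (fun t : R => g (a + RtoC t * b)%C).
Proof. intros Hg. apply (CC_ccont g (fun t : R => (a + RtoC t * b)%C)); [exact Hg | apply CC_line]. Qed.

Lemma RtoC_m1 : RtoC (-1) = (- RtoC 1)%C.
Proof. rewrite <- RtoC_opp. f_equal; ring. Qed.

Lemma seg_int_rev (g : C -> C) (a b : C) : ccont g -> seg_int g b a = (- seg_int g a b)%C.
Proof.
  intros Hg. unfold seg_int.
  assert (E := CInt_comp_lin (fun t : R => g (a + RtoC t * (b - a))%C) (-1) 1 0 1 (CC_on_line g a _ Hg)).
  replace (-1 * 0 + 1) with 1 in E by ring. replace (-1 * 1 + 1) with 0 in E by ring.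
  rewrite (CInt_ext (fun t : R => g (a + RtoC (-1 * t + 1) * (b - a))%C)
    (fun t : R => g (b + RtoC t * (a - b))%C)) in E.
  2: { intros t. cbv beta. f_equal. rewrite RtoC_plus, RtoC_mult. rewrite RtoC_m1; ring. }
  assert (E2 : CInt (fun t : R => g (a + RtoC t * (b - a))%C) 1 0 =
     (- CInt (fun t : R => g (a + RtoC t * (b - a))%C) 0 1)%C).
  { unfold CInt, Copp; simpl. f_equal; symmetry; apply (@opp_RInt_swap R_CompleteNormedModule);
    apply ex_RInt_cont; apply (CC_on_line g a (b - a) Hg). }
  rewrite E2 in E.
  replace ((a - b) * CInt (fun t : R => g (b + RtoC t * (a - b))%C) 0 1)%C with
    ((b - a) * (RtoC (-1) * CInt (fun t : R => g (b + RtoC t * (a - b))%C) 0 1))%C.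
  - rewrite <- E. ring.
  - rewrite RtoC_m1; ring.
Qed.

Definition Cmid (a b : C) : C := ((a + b) * RtoC (/ 2))%C.

Lemma RtoC_half : (RtoC (/ 2) + RtoC (/ 2) = RtoC 1)%C.
Proof. rewrite <- RtoC_plus. f_equal. lra. Qed.

Lemma Cmid_l (a b : C) : (Cmid a b - a = RtoC (/ 2) * (b - a))%C.
Proof.
  unfold Cmid. replace ((a + b) * RtoC (/ 2) - a)%C with ((a + b) * RtoC (/ 2) - RtoC 1 * a)%C by ring.
  rewrite <- RtoC_half. ring.
Qed.

Lemma Cmid_r (a b : C) : (b - Cmid a b = RtoC (/ 2) * (b - a))%C.
Proof.
  unfold Cmid. replace (b - (a + b) * RtoC (/ 2))%C with (RtoC 1 * b - (a + b) * RtoC (/ 2))%C by ring.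
  rewrite <- RtoC_half. ring.
Qed.

Lemma seg_int_mid (g : C -> C) (a b : C) : ccont g ->
  seg_int g a b = (seg_int g a (Cmid a b) + seg_int g (Cmid a b) b)%C.
Proof.
  intros Hg. unfold seg_int. rewrite Cmid_l, Cmid_r.
  set (f := fun t : R => g (a + RtoC t * (b - a))%C).
  assert (Hf : CC f) by (apply CC_on_line; exact Hg).
  assert (E1 := CInt_comp_lin f (/ 2) 0 0 1 Hf).
  assert (E2 := CInt_comp_lin f (/ 2) (/ 2) 0 1 Hf).
  replace (/ 2 * 0 + 0) with 0 in E1 by ring. replace (/ 2 * 1 + 0) with (/ 2) in E1 by ring.
  replace (/ 2 * 0 + / 2) with (/ 2) in E2 by ring. replace (/ 2 * 1 + / 2) with 1 in E2 by lra.
  assert (EC : CInt f 0 1 = (CInt f 0 (/ 2) + CInt f (/ 2) 1)%C).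
  { destruct Hf as [H1 H2]. unfold CInt, Cplus; simpl. f_equal; symmetry;
    apply (@RInt_Chasles R_CompleteNormedModule); apply ex_RInt_cont; assumption. }
  rewrite EC, E1, E2.
  rewrite (CInt_ext (fun t : R => f (/ 2 * t + 0)) (fun t : R => g (a + RtoC t * (RtoC (/ 2) * (b - a)))%C)).
  2: { intros t. unfold f. f_equal. rewrite RtoC_plus, RtoC_mult. ring. }
  rewrite (CInt_ext (fun t : R => f (/ 2 * t + / 2)) (fun t : R => g (Cmid a b + RtoC t * (RtoC (/ 2) * (b - a)))%C)).
  2: { intros t. unfold f. f_equal. rewrite RtoC_plus, RtoC_mult.
       replace (Cmid a b) with (a + (Cmid a b - a))%C by ring. rewrite Cmid_l. ring. }
  ring.
Qed.

Lemma Cmod_seg_int_le (g : C -> C) (a b : C) M : ccont g ->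
  (forall t : R, 0 <= t <= 1 -> Cmod (g (a + RtoC t * (b - a))%C) <= M) ->
  Cmod (seg_int g a b) <= Cmod (b - a) * M.
Proof.
  intros Hg HM. unfold seg_int. rewrite Cmod_mult.
  apply Rmult_le_compat_l; [apply Cmod_ge_0|].
  eapply Rle_trans; [apply Cmod_CInt_le_const with (M := M)|]; [lra | apply CC_on_line; exact Hg | exact HM | lra].
Qed.

Definition tri_int (g : C -> C) (a b c : C) : C :=
  (seg_int g a b + seg_int g b c + seg_int g c a)%C.

Lemma CInt_id : CInt (fun t : R => RtoC t) 0 1 = RtoC (/ 2).
Proof.
  unfold CInt; simpl. unfold RtoC. f_equal.
  - apply is_RInt_unique. replace (/ 2) with (minus (1 * 1 * / 2) (0 * 0 * / 2)).
    2: { unfold minus, plus, opp; simpl. lra. }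
    apply (is_RInt_derive (V := R_CompleteNormedModule) (fun t => t * t * / 2) (fun t => t)).
    + intros x _. auto_derive; [exact I | lra].
    + intros; apply continuous_id.
  - rewrite RInt_const. unfold scal; simpl. unfold mult; simpl. ring.
Qed.

Lemma ccont_affine (p q : C) : ccont (fun s => p + s * q)%C.
Proof. apply (cderiv_ccont _ (fun _ => q)). intros; apply cderiv_affine. Qed.

Lemma seg_int_affine (p q a b : C) :
  seg_int (fun s => p + s * q)%C a b = ((b - a) * (p + q * Cmid a b))%C.
Proof.
  unfold seg_int. f_equal.
  rewrite (CInt_ext _ (fun t : R => (p + a * q) + (q * (b - a)) * RtoC t)%C) by (intros; ring).
  assert (Hid : CC (fun t : R => RtoC t)) by (apply CC_RtoC; intros; apply continuous_id).
  rewrite CInt_plus, CInt_const, CInt_scal; [change (CInt RtoC 0 1) with (CInt (fun t : R => RtoC t) 0 1); rewrite CInt_id | exact Hid | apply CC_const |].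
  - replace (Cmid a b) with (a + (Cmid a b - a))%C by ring. rewrite Cmid_l.
    rewrite Rminus_0_r. ring.
  - apply CC_mult; [apply CC_const | exact Hid].
Qed.

Lemma seg_int_minus (f g : C -> C) (a b : C) : ccont f -> ccont g ->
  seg_int (fun s => f s - g s)%C a b = (seg_int f a b - seg_int g a b)%C.
Proof.
  intros Hf Hg. unfold seg_int.
  rewrite (CInt_minus (fun t : R => f (a + RtoC t * (b - a))%C)) by (apply CC_on_line; assumption).
  ring.
Qed.

Lemma tri_int_affine (p q a b c : C) : tri_int (fun s => p + s * q)%C a b c = RtoC 0.
Proof. unfold tri_int. rewrite !seg_int_affine. unfold Cmid. ring. Qed.

(** One bisection in Goursat's argument, made a function by deciding the comparisons. For continuous
    [g] the selected midpoint triangle carries at least a quarter of the integral in modulus. The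
    central one needs no test: if the three corner triangles fail, the triangle inequality forces it
    to qualify. *)
Definition tri_step (g : C -> C) (t : C * C * C) : C * C * C :=
  let '(a, b, c) := t in
  let I := Cmod (tri_int g a b c) in
  let big x y z := Rle_dec I (4 * Cmod (tri_int g x y z)) in
  if big a (Cmid a b) (Cmid c a) then (a, Cmid a b, Cmid c a)
  else if big (Cmid a b) b (Cmid b c) then (Cmid a b, b, Cmid b c)
  else if big (Cmid c a) (Cmid b c) c then (Cmid c a, Cmid b c, c)
  else (Cmid b c, Cmid c a, Cmid a b).

Definition tri_size (t : C * C * C) (d : R) : Prop :=
  let '(a, b, c) := t in Cmod (b - a) <= d /\ Cmod (c - b) <= d /\ Cmod (a - c) <= d.

Definition tri_val (g : C -> C) (t : C * C * C) : R :=
  let '(a, b, c) := t in Cmod (tri_int g a b c).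

(** Each inner edge is traversed once in each direction and cancels, and each outer side is cut at
    its midpoint. *)
Lemma tri_int_split (g : C -> C) (a b c : C) : ccont g ->
  tri_int g a b c =
  (tri_int g a (Cmid a b) (Cmid c a) + tri_int g (Cmid a b) b (Cmid b c) +
   tri_int g (Cmid c a) (Cmid b c) c + tri_int g (Cmid b c) (Cmid c a) (Cmid a b))%C.
Proof.
  intros Hg. unfold tri_int.
  rewrite (seg_int_mid g a b), (seg_int_mid g b c), (seg_int_mid g c a) by exact Hg.
  rewrite (seg_int_rev g (Cmid a b) (Cmid c a)), (seg_int_rev g (Cmid a b) (Cmid b c)),
    (seg_int_rev g (Cmid b c) (Cmid c a)) by exact Hg.
  ring.
Qed.

Lemma tri_step_val (g : C -> C) t : ccont g -> tri_val g t <= 4 * tri_val g (tri_step g t).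
Proof.
  intros Hg. destruct t as [[a b] c]. unfold tri_step.
  destruct Rle_dec as [H|H1]; [exact H|].
  destruct Rle_dec as [H|H2]; [exact H|].
  destruct Rle_dec as [H|H3]; [exact H|].
  simpl. assert (E := tri_int_split g a b c Hg).
  set (z1 := tri_int g a (Cmid a b) (Cmid c a)) in *.
  set (z2 := tri_int g (Cmid a b) b (Cmid b c)) in *.
  set (z3 := tri_int g (Cmid c a) (Cmid b c) c) in *.
  set (z4 := tri_int g (Cmid b c) (Cmid c a) (Cmid a b)) in *.
  assert (A1 := Cmod_triangle (z1 + z2 + z3) z4). assert (A2 := Cmod_triangle (z1 + z2) z3).
  assert (A3 := Cmod_triangle z1 z2). rewrite <- E in A1. lra.
Qed.

Lemma Cmod_half (z : C) d : Cmod z <= d -> Cmod (RtoC (/ 2) * z) <= d / 2.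
Proof.
  intros H. rewrite Cmod_mult, Cmod_R, Rabs_pos_eq; lra.
Qed.

Lemma Cmod_minus_sym (a b : C) : Cmod (a - b) = Cmod (b - a).
Proof. rewrite <- Cmod_opp. f_equal. ring. Qed.

(** Each side of a midpoint triangle is half of a side of its parent. The displacement of the first
    vertex is recorded because the sequence of first vertices is the one shown to converge. *)
Lemma tri_step_size (g : C -> C) t d : tri_size t d ->
  tri_size (tri_step g t) (d / 2) /\ Cmod (fst (fst (tri_step g t)) - fst (fst t)) <= d.
Proof.
  destruct t as [[a b] c]. intros [H1 [H2 H3]]. 
  assert (D := Cmod_ge_0 (b - a)).
  assert (K1 := Cmod_half _ _ H1). assert (K2 := Cmod_half _ _ H2). assert (K3 := Cmod_half _ _ H3).
  assert (P1 : (Cmid b c - Cmid a b = RtoC (/ 2) * - (a - c))%C) by (unfold Cmid; ring).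
  assert (P2 : (Cmid c a - Cmid b c = RtoC (/ 2) * - (b - a))%C) by (unfold Cmid; ring).
  assert (P3 : (Cmid a b - Cmid c a = RtoC (/ 2) * - (c - b))%C) by (unfold Cmid; ring).
  assert (N1 := H1). assert (N2 := H2). assert (N3 := H3).
  rewrite <- Cmod_opp in N1, N2, N3. apply Cmod_half in N1. apply Cmod_half in N2. apply Cmod_half in N3.
  rewrite <- P1 in N3. rewrite <- P2 in N1. rewrite <- P3 in N2.
  assert (M1 := K1). assert (M2 := K2). assert (M3 := K3).
  rewrite <- Cmid_l in K1, K2, K3. rewrite <- Cmid_r in M1, M2, M3.
  unfold tri_step. repeat destruct Rle_dec; simpl; repeat split; try assumption;
    try (rewrite Cmod_minus_sym; assumption).
  - replace (a - a)%C with (RtoC 0) by ring. rewrite Cmod_0. lra.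
  - lra.
  - rewrite Cmod_minus_sym. lra.
  - replace (Cmid b c - a)%C with ((Cmid b c - Cmid a b) + (Cmid a b - a))%C by ring.
    eapply Rle_trans; [apply Cmod_triangle|]. lra.
Qed.

(** The sequence [x n - 2d/2^n] increases, [x n + 2d/2^n] decreases, and the limit of the first lies
    between them. Goursat's argument uses the explicit rate: the limit stays at a distance
    proportional to the size of the [n]-th triangle. *)
Lemma fast_cauchy (x : nat -> R) d : (forall n, Rabs (x (S n) - x n) <= d / 2 ^ n) ->
  exists l, forall n, Rabs (x n - l) <= 2 * d / 2 ^ n.
Proof.
  intros H.
  assert (Hp : forall n, 0 < 2 ^ n) by (intros; apply pow_lt; lra).
  set (y := fun n => x n - 2 * d / 2 ^ n). set (z := fun n => x n + 2 * d / 2 ^ n).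
  assert (S1 : forall n, 2 * d / 2 ^ S n = d / 2 ^ n).
  { intros n. simpl. generalize (Hp n); intros; field; lra. }
  assert (S2 : forall n, 2 * d / 2 ^ n = d / 2 ^ n + d / 2 ^ n).
  { intros n. generalize (Hp n); intros; field; lra. }
  assert (Hy : forall n, y n <= y (S n)).
  { intros n. unfold y. rewrite S1, S2. generalize (proj1 (Rabs_le_between _ _) (H n)). lra. }
  assert (Hz : forall n, z (S n) <= z n).
  { intros n. unfold z. rewrite S1, S2. generalize (proj1 (Rabs_le_between _ _) (H n)). lra. }
  assert (Hyz : forall n, y n <= z n).
  { intros n. unfold y, z. rewrite S2.
    generalize (Rle_trans _ _ _ (Rabs_pos _) (H n)). lra. }
  assert (Hz0 : forall n m, y n <= z m).
  { intros n m. destruct (Nat.le_ge_cases n m) as [L|L].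
    - apply Rle_trans with (y m); [|apply Hyz].
      induction L; [lra|]. eapply Rle_trans; [apply IHL | apply Hy].
    - apply Rle_trans with (z n); [apply Hyz|].
      induction L; [lra|]. eapply Rle_trans; [apply Hz | apply IHL]. }
  destruct (ex_finite_lim_seq_incr y (z 0%nat)) as [l Hl]; [exact Hy | intros; apply Hz0 |].
  exists l. intros n.
  assert (L1 : y n <= l) by (apply (is_lim_seq_incr_compare y l Hl Hy)).
  assert (L2 : l <= z n).
  { apply (is_lim_seq_le y (fun _ => z n) l (z n)); [intros; apply Hz0 | exact Hl | apply is_lim_seq_const]. }
  unfold y, z in *. apply Rabs_le. lra.
Qed.

Lemma goursat (g g' : C -> C) : (forall w, cderiv g w (g' w)) ->
  forall a b c, tri_int g a b c = RtoC 0.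
Proof.
  intros Hg' a b c.
  assert (Hg := cderiv_ccont _ _ Hg').
  set (d := Cmod (b - a) + Cmod (c - b) + Cmod (a - c)).
  assert (D1 := Cmod_ge_0 (b - a)). assert (D2 := Cmod_ge_0 (c - b)). assert (D3 := Cmod_ge_0 (a - c)).
  set (t := fun n => Nat.iter n (tri_step g) (a, b, c)).
  assert (Hp : forall n, 0 < 2 ^ n) by (intros; apply pow_lt; lra).
  assert (Hs : forall n, tri_size (t n) (d / 2 ^ n)).
  { induction n.
    - simpl. unfold d. repeat split; lra.
    - replace (d / 2 ^ S n) with (d / 2 ^ n / 2) by (simpl; field; apply Rgt_not_eq, Hp).
      apply (tri_step_size g (t n)), IHn. }
  assert (Hm : forall n, Cmod (fst (fst (t (S n))) - fst (fst (t n))) <= d / 2 ^ n).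
  { intros n. apply (tri_step_size g (t n)), Hs. }
  assert (Hv : forall n, tri_val g (a, b, c) <= 4 ^ n * tri_val g (t n)).
  { induction n; [simpl; lra|]. eapply Rle_trans; [exact IHn|].
    simpl pow. assert (A := tri_step_val g (t n) Hg). change (tri_step g (t n)) with (t (S n)) in A.
    rewrite Rmult_assoc, (Rmult_comm 4), Rmult_assoc.
    apply Rmult_le_compat_l; [apply pow_le; lra | lra]. }
  destruct (fast_cauchy (fun n => fst (fst (fst (t n)))) d) as [l1 Hl1].
  { intros n. eapply Rle_trans; [|apply (Hm n)]. apply (fst_le_Cmod (fst (fst (t (S n))) - fst (fst (t n)))). }
  destruct (fast_cauchy (fun n => snd (fst (fst (t n)))) d) as [l2 Hl2].
  { intros n. eapply Rle_trans; [|apply (Hm n)]. apply (snd_le_Cmod (fst (fst (t (S n))) - fst (fst (t n)))). }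
  set (l := (l1, l2) : C).
  assert (Hl : forall n, Cmod (fst (fst (t n)) - l) <= 4 * d / 2 ^ n).
  { intros n. eapply Rle_trans; [apply Cmod_le_abs|].
    assert (A1 := Hl1 n). assert (A2 := Hl2 n).
    change (Rabs (fst (fst (fst (t n))) - l1) + Rabs (snd (fst (fst (t n))) - l2) <= 4 * d / 2 ^ n).
    replace (4 * d / 2 ^ n) with (2 * d / 2 ^ n + 2 * d / 2 ^ n) by (field; apply Rgt_not_eq, Hp). lra. }
  apply Cmod_eq_0. apply Rle_antisym; [|apply Cmod_ge_0].
  apply le_epsilon. intros eps He. rewrite Rplus_0_l.
  (* The limit point is only known to lie within [4q] of a vertex, where [q = d / 2^n], so points of
     the boundary lie within [6q]. Three sides of length at most [q] then give [18 q^2], and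
     [4^n q^2 = d^2]. The [1 +] covers [d = 0]. *)
  assert (E1 : 0 < eps / (18 * (1 + d * d))) by (apply Rdiv_lt_0_compat; nra).
  destruct (Hg' l _ E1) as [r [Hr B]].
  assert (Hn : exists n, 6 * d / 2 ^ n < r).
  { assert (L : is_lim_seq (fun n => 6 * d * (/ 2) ^ n) (6 * d * 0)).
    { apply (is_lim_seq_scal_l _ (6 * d) 0). apply is_lim_seq_geom. rewrite Rabs_pos_eq; lra. }
    rewrite Rmult_0_r in L. apply is_lim_seq_spec in L. destruct (L (mkposreal r Hr)) as [n Hn].
    exists n. specialize (Hn n (Nat.le_refl n)). simpl in Hn.
    rewrite Rminus_0_r in Hn. rewrite pow_inv in Hn. eapply Rle_lt_trans; [apply Rle_abs | exact Hn]. }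
  destruct Hn as [n Hn].
  eapply Rle_trans; [apply (Hv n)|].
  assert (Hsn := Hs n). assert (Hln := Hl n).
  destruct (t n) as [[x y] z]. simpl in Hsn, Hln |- *. destruct Hsn as [S1 [S2 S3]].
  set (q := d / 2 ^ n) in *.
  assert (Hq : 0 <= q) by (eapply Rle_trans; [apply Cmod_ge_0 | exact S1]).
  replace (4 * d / 2 ^ n) with (4 * q) in Hln by (unfold q; field; apply Rgt_not_eq, Hp).
  replace (6 * d / 2 ^ n) with (6 * q) in Hn by (unfold q; field; apply Rgt_not_eq, Hp).
  (* The tangent affine map at [l] contributes nothing by [tri_int_affine], so [g] may be replaced
     by the remainder of its linear approximation. *)
  set (h := fun s => (g l - g' l * l + s * g' l)%C).
  assert (Eh : tri_int g x y z = tri_int (fun s => g s - h s)%C x y z).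
  { unfold tri_int. rewrite !seg_int_minus by (try exact Hg; apply ccont_affine).
    assert (A := tri_int_affine (g l - g' l * l) (g' l) x y z). unfold tri_int in A. fold h in A.
    transitivity (seg_int g x y + seg_int g y z + seg_int g z x - (seg_int h x y + seg_int h y z + seg_int h z x))%C; [rewrite A; ring | ring]. }
  rewrite Eh.
  assert (Hgh : ccont (fun s => g s - h s)%C).
  { intros w e Hw. assert (e2 : 0 < e / 2) by lra.
    destruct (Hg w _ e2) as [r1 [R1 B1]].
    destruct (ccont_affine (g l - g' l * l) (g' l) w _ e2) as [r2 [R2 B2]].
    exists (Rmin r1 r2); split; [apply Rmin_pos; assumption|]. intros v Hv0.
    assert (V1 := B1 v (Rlt_le_trans _ _ _ Hv0 (Rmin_l _ _))).
    assert (V2 := B2 v (Rlt_le_trans _ _ _ Hv0 (Rmin_r _ _))). fold (h v) (h w) in V2.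
    change (Cmod (h v - h w) < e / 2) in V2.
    replace (g v - h v - (g w - h w))%C with ((g v - g w) + - (h v - h w))%C by ring.
    eapply Rle_lt_trans; [apply Cmod_triangle|]. rewrite Cmod_opp. lra. }
  assert (Bd : forall u v, Cmod (u - l) <= 5 * q -> Cmod (v - u) <= q ->
    Cmod (seg_int (fun s => g s - h s)%C u v) <= q * (eps / (18 * (1 + d * d)) * (6 * q))).
  { intros u v Hu Huv. eapply Rle_trans.
    - apply Cmod_seg_int_le with (M := eps / (18 * (1 + d * d)) * (6 * q)); [exact Hgh|].
      intros s Hs0. set (w := (u + RtoC s * (v - u))%C).
      assert (Hw : Cmod (w - l) <= 6 * q).
      { unfold w. replace (u + RtoC s * (v - u) - l)%C with ((u - l) + RtoC s * (v - u))%C by ring.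
        eapply Rle_trans; [apply Cmod_triangle|]. rewrite Cmod_mult, Cmod_R, Rabs_pos_eq by lra.
        assert (s * Cmod (v - u) <= 1 * q) by (apply Rmult_le_compat; try apply Cmod_ge_0; lra). lra. }
      assert (Bw := B (w - l)%C ltac:(lra)).
      replace (l + (w - l))%C with w in Bw by ring.
      unfold h. replace (g w - (g l - g' l * l + w * g' l))%C with (g w - g l - g' l * (w - l))%C by ring.
      eapply Rle_trans; [exact Bw|]. apply Rmult_le_compat_l; lra.
    - apply Rmult_le_compat_r; [|exact Huv]. apply Rmult_le_pos; lra. }
  assert (Y1 : Cmod (x - l) <= 5 * q) by lra.
  assert (Y2 : Cmod (y - l) <= 5 * q).
  { replace (y - l)%C with ((y - x) + (x - l))%C by ring. eapply Rle_trans; [apply Cmod_triangle|]. lra. }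
  assert (Y3 : Cmod (z - l) <= 5 * q).
  { replace (z - l)%C with (- (x - z) + (x - l))%C by ring. eapply Rle_trans; [apply Cmod_triangle|].
    rewrite Cmod_opp. lra. }
  assert (B1 := Bd x y Y1 S1). assert (B2 := Bd y z Y2 S2). assert (B3 := Bd z x Y3 S3).
  assert (T : Cmod (tri_int (fun s => g s - h s)%C x y z) <= 3 * (q * (eps / (18 * (1 + d * d)) * (6 * q)))).
  { unfold tri_int. eapply Rle_trans; [apply Cmod_triangle|].
    assert (A := Cmod_triangle (seg_int (fun s => g s - h s)%C x y) (seg_int (fun s => g s - h s)%C y z)). lra. }
  assert (P4 : 4 ^ n = 2 ^ n * 2 ^ n) by (rewrite <- Rpow_mult_distr; f_equal; ring).
  apply Rle_trans with (4 ^ n * (3 * (q * (eps / (18 * (1 + d * d)) * (6 * q))))).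
  { apply Rmult_le_compat_l; [apply pow_le; lra | exact T]. }
  rewrite P4. replace (2 ^ n * 2 ^ n * (3 * (q * (eps / (18 * (1 + d * d)) * (6 * q))))) with
    (eps * ((d * d) / (1 + d * d))).
  2: { unfold q. field. split; [apply Rgt_not_eq, Hp | nra]. }
  rewrite <- (Rmult_1_r eps) at 2. apply Rmult_le_compat_l; [lra|].
  apply Rmult_le_reg_r with (1 + d * d); [nra|]. unfold Rdiv. rewrite Rmult_assoc, Rinv_l by nra. lra.
Qed.

(** * Integrals depending on a parameter *)

Lemma continuous_RInt_param {U : UniformSpace} (K : U * R -> R) (a b : R) : a <= b ->
  (forall w, continuous K w) -> forall u, continuous (fun v : U => RInt (fun s => K (v, s)) a b) u.
Proof.
  intros Hab HK u.
  assert (Hs : forall v s, continuous (fun s : R => K (v, s)) s).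
  { intros v s. apply (continuous_comp (fun s : R => (v, s)) K); [|apply HK].
    apply continuous_pair; [apply continuous_const | apply continuous_id]. }
  apply continuous_eps; intros eps He.
  assert (He2 : 0 < eps / (4 * (1 + (b - a)))) by (apply Rdiv_lt_0_compat; lra).
  (* A radius [delta s] is chosen around each [(u, s)]. Compactness of [[a,b]] gives one [d] such
     that every [s] is [delta t]-close to some [t] with [d <= delta t]; then [K (v, s)] and
     [K (u, s)] are both compared with [K (u, t)]. The covering property holds under a double
     negation, hence [NNPP]. *)
  destruct (functional_choice (fun (s : R) (d : posreal) => forall v : U * R, ball (u, s) d v ->
     Rabs (K v - K (u, s)) < eps / (4 * (1 + (b - a))))) as [delta Hd].
  { intros s. apply (proj1 (continuous_eps K (u, s)) (HK (u, s)) _ He2). }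
  destruct (compactness_value_1d a b delta) as [d Hdd].
  exists d; intros v Hv.
  rewrite <- (@RInt_minus R_CompleteNormedModule) by (apply ex_RInt_cont; apply Hs).
  apply Rle_lt_trans with ((b - a) * (eps / (2 * (1 + (b - a))))).
  - apply abs_RInt_le_const; [exact Hab | |].
    { apply (@ex_RInt_minus R_NormedModule); apply ex_RInt_cont; apply Hs. }
    intros s Hsab. apply NNPP; intros HN. apply (Hdd s Hsab). intros [t [Ht [Hst Hdt]]].
    apply HN.
    assert (B1 : Rabs (K (v, s) - K (u, t)) < eps / (4 * (1 + (b - a)))).
    { apply Hd. split; [apply (ball_le u d (delta t) Hdt v Hv) | exact Hst]. }
    assert (B2 : Rabs (K (u, s) - K (u, t)) < eps / (4 * (1 + (b - a)))).
    { apply Hd. split; [apply ball_center | exact Hst]. }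
    change (Rabs (K (v, s) - K (u, s)) <= eps / (2 * (1 + (b - a)))).
    replace (K (v, s) - K (u, s)) with ((K (v, s) - K (u, t)) + - (K (u, s) - K (u, t))) by ring.
    eapply Rle_trans; [apply Rabs_triang|]. rewrite Rabs_Ropp.
    replace (eps / (2 * (1 + (b - a)))) with (eps / (4 * (1 + (b - a))) + eps / (4 * (1 + (b - a)))) by (field; lra).
    lra.
  - replace ((b - a) * (eps / (2 * (1 + (b - a))))) with (eps * ((b - a) / (2 * (1 + (b - a))))) by (field; lra).
    rewrite <- (Rmult_1_r eps) at 2. apply Rmult_lt_compat_l; [lra|].
    apply Rmult_lt_reg_r with (2 * (1 + (b - a))); [lra|]. unfold Rdiv. rewrite Rmult_assoc, Rinv_l by lra. lra.
Qed.

Lemma CC_CInt_param {U : UniformSpace} (K : U * R -> C) (a b : R) : a <= b -> CC K ->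
  CC (fun v : U => CInt (fun s => K (v, s)) a b).
Proof.
  intros Hab [H1 H2]; split; simpl;
    [apply (continuous_RInt_param (fun w => fst (K w))) | apply (continuous_RInt_param (fun w => snd (K w)))];
    assumption.
Qed.

(** * The derivative as a mean over the unit circle *)

(** The diagonal from [a] to [c] cuts the contour into two triangles, and its two traversals
    cancel. *)
Lemma rect_int (h h' : C -> C) (a b c d : C) : (forall w, cderiv h w (h' w)) ->
  (seg_int h a b + seg_int h b c + seg_int h c d + seg_int h d a = 0)%C.
Proof.
  intros H. assert (Hc := cderiv_ccont _ _ H).
  assert (E1 := goursat h h' H a b c). assert (E2 := goursat h h' H a c d).
  unfold tri_int in E1, E2. rewrite (seg_int_rev h a c Hc) in E1.
  transitivity ((seg_int h a b + seg_int h b c + - seg_int h a c) + (seg_int h a c + seg_int h c d + seg_int h d a))%C; [ring|].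
  rewrite E1, E2. ring.
Qed.

Definition Cpair (x y : R) : C := (x, y).

(** Cauchy's integral for the first derivative, [1 / (2 pi i)] times the integral of
    [g(zeta) / (zeta - w)^2] over the unit circle around [w], with [zeta = w + e^{2 pi i t}]. *)
Definition circ_mean (g : C -> C) (w : C) : C :=
  CInt (fun t : R => g (w + cis (2 * PI * t)) * cis (- (2 * PI * t)))%C 0 1.

Lemma cexp_period (z : C) : cexp (z + (Cpair 0 (2 * PI))) = cexp z.
Proof.
  rewrite cexp_add. assert (E : cexp (Cpair 0 (2 * PI)) = RtoC 1).
  { unfold cexp, cis; simpl. rewrite exp_0, cos_2PI, sin_2PI. unfold RtoC, Cmult; simpl. f_equal; ring. }
  rewrite E. ring.
Qed.

Lemma CInt_cis_period : CInt (fun t : R => cis (- (2 * PI * t))) 0 1 = RtoC 0.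
Proof.
  assert (P0 := PI_RGT_0).
  unfold CInt, RtoC; simpl. f_equal; apply is_RInt_unique.
  - replace 0 with (minus (sin (- (2 * PI * 1)) / (- (2 * PI))) (sin (- (2 * PI * 0)) / (- (2 * PI)))) at 2.
    2: { rewrite !sin_neg, Rmult_1_r, sin_2PI, Rmult_0_r, sin_0. unfold minus, plus, opp; simpl. field. lra. }
    apply (is_RInt_derive (V := R_CompleteNormedModule) (fun t => sin (- (2 * PI * t)) / (- (2 * PI))) (fun t => cos (- (2 * PI * t)))).
    + intros x _. auto_derive; [exact I | field; lra].
    + intros x _. apply (ex_derive_continuous (K := R_AbsRing) (V := R_NormedModule)). auto_derive; exact I.
  - replace 0 with (minus (cos (- (2 * PI * 1)) / (2 * PI)) (cos (- (2 * PI * 0)) / (2 * PI))) at 2.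
    2: { rewrite !cos_neg, Rmult_1_r, cos_2PI, Rmult_0_r, cos_0. unfold minus, plus, opp; simpl. field. lra. }
    apply (is_RInt_derive (V := R_CompleteNormedModule) (fun t => cos (- (2 * PI * t)) / (2 * PI)) (fun t => sin (- (2 * PI * t)))).
    + intros x _. auto_derive; [exact I | field; lra].
    + intros x _. apply (ex_derive_continuous (K := R_AbsRing) (V := R_NormedModule)). auto_derive; exact I.
Qed.

(* In the coordinate [w + exp z] circles around [w] become vertical segments, so
   Cauchy's theorem on a rectangle shrinks the unit circle to the point [w]. *)
Lemma cderiv_circ_mean (g g' : C -> C) : (forall w, cderiv g w (g' w)) ->
  forall w, g' w = circ_mean g w.
Proof.
  intros Hg w. assert (Hgc := cderiv_ccont _ _ Hg). assert (P0 := PI_RGT_0).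
  set (k := fun z : C => (w + cexp z * RtoC 1)%C).
  set (m := fun z : C => (RtoC 0 + z * RtoC (-1))%C).
  set (h := fun z : C => (g (k z) * cexp (m z))%C).
  assert (Hk : forall z, cderiv k z (RtoC 1 * cexp z)%C).
  { intros z. apply (cderiv_comp (fun s => w + s * RtoC 1)%C cexp); [apply cderiv_cexp | apply cderiv_affine]. }
  assert (Hm : forall z, cderiv (fun z => cexp (m z)) z (cexp (m z) * RtoC (-1))%C).
  { intros z. apply (cderiv_comp cexp m); [apply cderiv_affine | apply cderiv_cexp]. }
  assert (Hh : forall z, cderiv h z ((g' (k z) * (RtoC 1 * cexp z)) * cexp (m z) + g (k z) * (cexp (m z) * RtoC (-1)))%C).
  { intros z. apply (cderiv_mult (fun z => g (k z)) (fun z => cexp (m z))); [|apply Hm].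
    apply (cderiv_comp g k); [apply Hk | apply Hg]. }
  assert (Hhc := cderiv_ccont _ _ Hh).
  (* [K r] is Cauchy's integral for the derivative over the circle of radius [e^r]; [r = 0] is the
     unit circle. *)
  set (K := fun r : R => CInt (fun t : R => h (Cpair r (2 * PI * t))) 0 1).
  assert (HhK : forall r : R, CC (fun t : R => h (Cpair r (2 * PI * t)))).
  { intros r. apply (CC_ccont h (fun t : R => Cpair r (2 * PI * t))); [exact Hhc|].
    split; intro t; simpl; [apply continuous_const|].
    apply (ex_derive_continuous (K := R_AbsRing) (V := R_NormedModule)). auto_derive; exact I. }
  assert (per : forall z, h (z + (Cpair 0 (2 * PI)))%C = h z).
  { intros z. unfold h, k, m. rewrite cexp_period. f_equal.
    rewrite <- (cexp_period (0 + (z + (Cpair 0 (2 * PI))) * RtoC (-1))). f_equal.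
    rewrite RtoC_m1. ring. }
  (* The horizontal sides of the rectangle cancel because [h] has period [2 pi i], so the integrals
     over the two vertical sides agree. *)
  assert (EK : forall r, K r = K 0).
  { intros r.
    assert (E := rect_int h _ (Cpair r 0) (Cpair 0 0) (Cpair 0 (2 * PI)) (Cpair r (2 * PI)) Hh).
    rewrite (seg_int_rev h (Cpair r (2 * PI))) in E by exact Hhc.
    rewrite (seg_int_rev h (Cpair r 0) (Cpair r (2 * PI))) in E by exact Hhc.
    assert (E1 : seg_int h (Cpair r (2 * PI)) (Cpair 0 (2 * PI)) = seg_int h (Cpair r 0) (Cpair 0 0)).
    { unfold seg_int. f_equal.
      - unfold Cminus, Cplus, Copp, Cpair; simpl; f_equal; ring.
      - apply CInt_ext; intros t. rewrite <- (per ((Cpair r 0) + RtoC t * ((Cpair 0 0) - (Cpair r 0)))%C). f_equal.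
        unfold Cminus, Cplus, Copp, Cmult, Cpair; simpl; f_equal; ring. }
    rewrite E1 in E.
    assert (E2 : forall q, seg_int h (Cpair q 0) (Cpair q (2 * PI)) = ((Cpair 0 (2 * PI)) * K q)%C).
    { intros q. unfold seg_int, K. f_equal.
      - unfold Cminus, Cplus, Copp, Cpair; simpl; f_equal; ring.
      - apply CInt_ext; intros t. f_equal.
        unfold Cminus, Cplus, Copp, Cmult, Cpair; simpl; f_equal; ring. }
    rewrite !E2 in E.
    assert (E3 : ((Cpair 0 (2 * PI)) * (K r - K 0) = 0)%C).
    { transitivity (- (seg_int h (Cpair r 0) (Cpair 0 0) + (Cpair 0 (2 * PI)) * K 0 + - seg_int h (Cpair r 0) (Cpair 0 0) +
       - ((Cpair 0 (2 * PI)) * K r)))%C; [ring|]. rewrite E. ring. }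
    assert (E4 : Cmod ((Cpair 0 (2 * PI)) * (K r - K 0))%C = 0) by (rewrite E3; apply Cmod_0).
    rewrite Cmod_mult in E4. apply Rmult_integral in E4. destruct E4 as [E4|E4].
    - exfalso. apply Cmod_eq_0 in E4. injection E4. intros. lra.
    - apply Cmod_eq_0 in E4. transitivity (K r - K 0 + K 0)%C; [ring|]. rewrite E4. ring. }
  assert (EKm : K 0 = circ_mean g w).
  { unfold K, circ_mean. apply CInt_ext; intros t. unfold h, k, m, cexp; simpl.
    replace (0 + (0 * -1 - 2 * PI * t * 0)) with 0 by ring. rewrite exp_0.
    replace (0 + (0 * 0 + 2 * PI * t * -1)) with (- (2 * PI * t)) by ring.
    replace (w + 1 * cis (2 * PI * t) * 1)%C with (w + cis (2 * PI * t))%C by ring. ring. }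
  rewrite <- EKm.
  assert (HC : Cmod (K 0 - g' w) <= 0).
  { apply le_epsilon; intros eps He. rewrite Rplus_0_l.
    destruct (Hg w eps He) as [d [Hd B]].
    (* Radius [d / 2] lies where the linear approximation of [g] at [w] is valid. The constant term
       [g w] integrates to zero, the linear term to [g' w]. *)
    set (r := ln (d / 2)). assert (Er : exp r = d / 2) by (apply exp_ln; lra).
    rewrite <- (EK r).
    assert (HX : forall c, CC (fun t : R => (c * cexp (m (Cpair r (2 * PI * t))))%C)).
    { intros c. apply CC_mult; [apply CC_const|].
      apply (CC_ccont (fun z => cexp (m z)) (fun t : R => Cpair r (2 * PI * t))); [exact (cderiv_ccont _ _ Hm)|].
      split; intro t; simpl; [apply continuous_const|].
      apply (ex_derive_continuous (K := R_AbsRing) (V := R_NormedModule)). auto_derive; exact I. }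
    assert (E0 : CInt (fun t : R => (g w * cexp (m (Cpair r (2 * PI * t))))%C) 0 1 = RtoC 0).
    { rewrite (CInt_ext _ (fun t : R => (g w * RtoC (exp (- r))) * cis (- (2 * PI * t)))%C).
      - rewrite CInt_scal, CInt_cis_period; [ring|]. apply CC_cis. intros t.
        apply (ex_derive_continuous (K := R_AbsRing) (V := R_NormedModule)). auto_derive; exact I.
      - intros t. unfold m, cexp; simpl.
        replace (0 + (r * -1 - 2 * PI * t * 0)) with (- r) by ring.
        replace (0 + (r * 0 + 2 * PI * t * -1)) with (- (2 * PI * t)) by ring. ring. }
    assert (E1 : (K r - g' w)%C = CInt (fun t : R => h (Cpair r (2 * PI * t)) - g w * cexp (m (Cpair r (2 * PI * t))) - g' w)%C 0 1).
    { rewrite CInt_minus, CInt_minus, CInt_const, E0; [| apply HhK | apply HX | | apply CC_const].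
      - unfold K. rewrite Rminus_0_r. ring.
      - apply CC_minus; [apply HhK | apply HX]. }
    rewrite E1.
    replace eps with ((1 - 0) * eps) by ring.
    apply Cmod_CInt_le_const; [lra | |].
    - apply CC_minus; [|apply CC_const]. apply CC_minus; [apply HhK | apply HX].
    - intros t _. set (z := Cpair r (2 * PI * t)).
      assert (Hz : (cexp z * cexp (m z) = 1)%C).
      { rewrite <- cexp_add. unfold m. replace (z + (0 + z * RtoC (-1)))%C with (RtoC 0) by (rewrite RtoC_m1; ring).
        unfold cexp; simpl. rewrite exp_0, cis_0. ring. }
      unfold h, k. replace (w + cexp z * 1)%C with (w + cexp z)%C by ring.
      replace (g (w + cexp z) * cexp (m z) - g w * cexp (m z) - g' w)%C with
        ((g (w + cexp z) - g w - g' w * cexp z) * cexp (m z))%C.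
      2: { transitivity (g (w + cexp z) * cexp (m z) - g w * cexp (m z) - g' w * (cexp z * cexp (m z)))%C; [ring|].
           rewrite Hz. ring. }
      assert (Mz : Cmod (cexp z) = d / 2) by (rewrite Cmod_cexp; exact Er).
      assert (Bz := B (cexp z) ltac:(lra)).
      rewrite Cmod_mult. apply Rle_trans with (eps * Cmod (cexp z) * Cmod (cexp (m z))).
      + apply Rmult_le_compat_r; [apply Cmod_ge_0 | exact Bz].
      + rewrite Rmult_assoc, <- Cmod_mult, Hz, Cmod_1. lra. }
  symmetry. transitivity (K 0 - g' w + g' w)%C; [ring|].
  rewrite (Cmod_eq_0 (K 0 - g' w)); [ring|]. apply Rle_antisym; [exact HC | apply Cmod_ge_0].
Qed.

(** * Mean value inequality and directional derivatives *)

Lemma cderiv_plus (f g : C -> C) (w l m : C) : cderiv f w l -> cderiv g w m ->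
  cderiv (fun s => f s + g s)%C w (l + m)%C.
Proof.
  intros Hf Hg eps He. assert (E : 0 < eps / 2) by lra.
  destruct (Hf _ E) as [d1 [D1 B1]]. destruct (Hg _ E) as [d2 [D2 B2]].
  exists (Rmin d1 d2); split; [apply Rmin_pos; assumption|]. intros h Hh.
  assert (A1 := B1 h (Rlt_le_trans _ _ _ Hh (Rmin_l _ _))).
  assert (A2 := B2 h (Rlt_le_trans _ _ _ Hh (Rmin_r _ _))).
  replace (f (w + h) + g (w + h) - (f w + g w) - (l + m) * h)%C with
    ((f (w + h) - f w - l * h) + (g (w + h) - g w - m * h))%C by ring.
  eapply Rle_trans; [apply Cmod_triangle|]. lra.
Qed.

Lemma cderiv_const (c w : C) : cderiv (fun _ => c) w (RtoC 0).
Proof.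
  intros eps He. exists 1; split; [lra|]. intros h _.
  replace (c - c - 0 * h)%C with (RtoC 0) by ring. rewrite Cmod_0.
  apply Rmult_le_pos; [lra | apply Cmod_ge_0].
Qed.

Lemma cderiv_line (f f' : C -> C) (a k : C) : (forall w, cderiv f w (f' w)) -> forall t : R,
  is_derive (fun t : R => fst (f (a + RtoC t * k)%C)) t (fst (f' (a + RtoC t * k) * k)%C).
Proof.
  intros Hf t. apply is_derive_Reals. intros eps He.
  assert (K0 := Cmod_ge_0 k).
  assert (E : 0 < eps / (2 * (1 + Cmod k))) by (apply Rdiv_lt_0_compat; lra).
  destruct (Hf (a + RtoC t * k)%C _ E) as [d [Hd B]].
  assert (D : 0 < d / (1 + Cmod k)) by (apply Rdiv_lt_0_compat; lra).
  exists (mkposreal _ D). intros h Hh0 Hh. simpl in Hh.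
  assert (Hhp := Rabs_pos_lt h Hh0).
  assert (M : Cmod (RtoC h * k) = Rabs h * Cmod k) by (rewrite Cmod_mult, Cmod_R; reflexivity).
  assert (M1 : Cmod (RtoC h * k) < d).
  { rewrite M. apply Rle_lt_trans with (Rabs h * (1 + Cmod k)); [apply Rmult_le_compat_l; lra|].
    apply Rmult_lt_compat_r with (r := 1 + Cmod k) in Hh; [|lra].
    replace (d / (1 + Cmod k) * (1 + Cmod k)) with d in Hh by (field; lra). exact Hh. }
  specialize (B _ M1).
  replace (a + RtoC t * k + RtoC h * k)%C with (a + RtoC (t + h) * k)%C in B by (rewrite RtoC_plus; ring).
  set (X := f (a + RtoC (t + h) * k)%C) in *. set (Y := f (a + RtoC t * k)%C) in *.
  set (l := f' (a + RtoC t * k)%C) in *.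
  replace ((fst X - fst Y) / h - fst (l * k)%C) with (fst (X - Y - l * (RtoC h * k))%C / h).
  2: { simpl. field. exact Hh0. }
  unfold Rdiv. rewrite Rabs_mult, Rabs_inv.
  apply Rmult_lt_reg_r with (Rabs h); [exact Hhp|]. rewrite Rmult_assoc, Rinv_l, Rmult_1_r by lra.
  eapply Rle_lt_trans; [apply fst_le_Cmod|]. eapply Rle_lt_trans; [exact B|]. rewrite M.
  apply Rle_lt_trans with (eps / 2 * Rabs h).
  - apply Rle_trans with (eps / (2 * (1 + Cmod k)) * (Rabs h * (1 + Cmod k))).
    + apply Rmult_le_compat_l; [lra|]. apply Rmult_le_compat_l; lra.
    + apply Req_le; field; lra.
  - apply Rmult_lt_compat_r; lra.
Qed.

Lemma fst_conj_mult (z : C) : fst (Cconj z * z)%C = Cmod z * Cmod z.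
Proof.
  unfold Cmod. rewrite sqrt_sqrt; [simpl; ring|]. generalize (pow2_ge_0 (fst z)), (pow2_ge_0 (snd z)); lra.
Qed.

(** With [E] the quantity to be bounded, the real mean value theorem is applied to the real part of
    [conj E * (f w - D w)] along the segment: its increment is [|E|^2], its derivative at most
    [|E| eps |k|]. *)
Lemma cderiv_mean_value (f f' : C -> C) (a k D : C) eps : (forall w, cderiv f w (f' w)) ->
  (forall t : R, 0 <= t <= 1 -> Cmod (f' (a + RtoC t * k) - D)%C <= eps) ->
  Cmod (f (a + k) - f a - D * k)%C <= eps * Cmod k.
Proof.
  intros Hf HD. set (E := (f (a + k) - f a - D * k)%C).
  set (F := fun w => (Cconj E * (f w + (RtoC 0 + w * - D)))%C).
  set (F' := fun w => (RtoC 0 * (f w + (RtoC 0 + w * - D)) + Cconj E * (f' w + - D))%C).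
  assert (HF : forall w, cderiv F w (F' w)).
  { intros w. apply (cderiv_mult (fun _ => Cconj E) (fun w => f w + (RtoC 0 + w * - D))%C); [apply cderiv_const|].
    apply (cderiv_plus f (fun w => RtoC 0 + w * - D)%C); [apply Hf | apply cderiv_affine]. }
  destruct (MVT_gen (fun t : R => fst (F (a + RtoC t * k)%C)) 0 1
    (fun t => fst (F' (a + RtoC t * k) * k)%C)) as [t [Ht Et]].
  { intros t _. apply cderiv_line. exact HF. }
  { intros t _. apply derivable_continuous_pt. eexists. apply is_derive_Reals, cderiv_line, HF. }
  rewrite Rmin_left, Rmax_right in Ht by lra.
  assert (EE : fst (F (a + RtoC 1 * k)%C) - fst (F (a + RtoC 0 * k)%C) = Cmod E * Cmod E).
  { rewrite <- fst_conj_mult.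
    transitivity (fst (F (a + RtoC 1 * k) - F (a + RtoC 0 * k))%C); [reflexivity|]. f_equal.
    unfold F. replace (a + RtoC 1 * k)%C with (a + k)%C by ring. replace (a + RtoC 0 * k)%C with a by ring.
    set (c := Cconj E). clearbody c. unfold E. ring. }
  rewrite EE in Et. 
  assert (B : Cmod E * Cmod E <= Cmod E * (eps * Cmod k)).
  { rewrite Et, Rminus_0_r, Rmult_1_r. eapply Rle_trans; [apply Rle_abs|]. eapply Rle_trans; [apply fst_le_Cmod|].
    unfold F'. replace ((0 * (f (a + RtoC t * k) + (0 + (a + RtoC t * k) * - D)) + Cconj E * (f' (a + RtoC t * k) + - D)) * k)%C
      with (Cconj E * ((f' (a + RtoC t * k) - D) * k))%C by ring.
    rewrite !Cmod_mult, Cmod_conj. apply Rmult_le_compat_l; [apply Cmod_ge_0|].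
    apply Rmult_le_compat_r; [apply Cmod_ge_0 | apply HD, Ht]. }
  destruct (Req_dec (Cmod E) 0) as [Z|Z].
  - rewrite Z. apply Rmult_le_pos; [|apply Cmod_ge_0]. eapply Rle_trans; [apply Cmod_ge_0 | apply (HD 0); lra].
  - apply Rmult_le_reg_l with (Cmod E); [generalize (Cmod_ge_0 E); lra | exact B].
Qed.

Lemma sumn_le (p : nat) (a b : nat -> R) : (forall i, (i < p)%nat -> a i <= b i) -> sumn p a <= sumn p b.
Proof.
  induction p; intros H; simpl; [lra|].
  apply Rplus_le_compat; [apply IHp; intros; apply H; lia | apply H; lia].
Qed.

Lemma sumn_ge_0 (p : nat) (a : nat -> R) : (forall i, (i < p)%nat -> 0 <= a i) -> 0 <= sumn p a.
Proof.
  induction p; intros H; simpl; [lra|].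
  apply Rplus_le_le_0_compat; [apply IHp; intros; apply H; lia | apply H; lia].
Qed.

Lemma sumn_const (p : nat) (c : R) : sumn p (fun _ => c) = INR p * c.
Proof. induction p; [simpl; ring|]. simpl sumn. rewrite IHp, S_INR. ring. Qed.

Lemma sumn_sqr_le (p : nat) (a : nat -> R) : (forall i, (i < p)%nat -> 0 <= a i) ->
  sumn p (fun i => a i ^ 2) <= (sumn p a) ^ 2.
Proof.
  induction p; intros H; [simpl; lra|].
  change (sumn p (fun i => a i ^ 2) + a p ^ 2 <= (sumn p a + a p) ^ 2).
  assert (A := IHp (fun i Hi => H i (Nat.lt_trans _ _ _ Hi (Nat.lt_succ_diag_r p)))).
  assert (B := sumn_ge_0 p a (fun i Hi => H i (Nat.lt_trans _ _ _ Hi (Nat.lt_succ_diag_r p)))).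
  assert (D := Rmult_le_pos _ _ B (H p (Nat.lt_succ_diag_r p))). nra.
Qed.

Lemma cnorm_le_sumn (p : nat) (z : nat -> C) : cnorm p z <= sumn p (fun i => Cmod (z i)).
Proof.
  assert (P : 0 <= sumn p (fun i => Cmod (z i))) by (apply sumn_ge_0; intros; apply Cmod_ge_0).
  unfold cnorm. rewrite <- (sqrt_pow2 (sumn p (fun i => Cmod (z i)))) by exact P.
  apply sqrt_le_1_alt, sumn_sqr_le. intros; apply Cmod_ge_0.
Qed.

(** * Holomorphy along complex lines *)

Section Entire.
Variables (p : nat) (F : (nat -> C) -> C).
Hypothesis HF : entire p F.

(** No topology is put on [nat -> C]: a continuous family of points is one whose relevant
    coordinates are continuous, and finitely many of them admit a common radius. *)
Lemma CC_coords {U : UniformSpace} (q : nat) (z : U -> nat -> C) :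
  (forall i, (i < q)%nat -> CC (fun u => z u i)) ->
  forall u (eps : R), 0 < eps -> exists delta : posreal,
    forall v, ball u delta v -> forall i, (i < q)%nat -> Cmod (z v i - z u i) < eps.
Proof.
  induction q; intros H u eps He.
  - exists (mkposreal 1 Rlt_0_1). intros; lia.
  - destruct (IHq (fun i Hi => H i (Nat.lt_trans _ _ _ Hi (Nat.lt_succ_diag_r q))) u eps He) as [d1 H1].
    destruct (proj1 (CC_eps _) (H q (Nat.lt_succ_diag_r q)) u eps He) as [d2 H2].
    assert (Hd : 0 < Rmin d1 d2) by (apply Rmin_pos; apply cond_pos).
    exists (mkposreal _ Hd). intros v Hv i Hi.
    destruct (Nat.eq_dec i q) as [->|Hne].
    + apply H2. exact (ball_le _ _ _ (Rmin_r d1 d2) _ Hv).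
    + apply H1; [exact (ball_le _ _ _ (Rmin_l d1 d2) _ Hv) | lia].
Qed.

Lemma CC_entire {U : UniformSpace} (z : U -> nat -> C) :
  (forall i, (i < p)%nat -> CC (fun u => z u i)) -> CC (fun u => F (z u)).
Proof.
  intros Hz. apply CC_eps. intros u eps He.
  destruct HF as [_ [Hc _]]. destruct (Hc (z u) eps He) as [d [Hd B]].
  assert (Hd' : 0 < d / (1 + INR p)) by (apply Rdiv_lt_0_compat; [exact Hd | generalize (pos_INR p); lra]).
  destruct (CC_coords p z Hz u _ Hd') as [r Hr].
  exists r. intros v Hv. apply B.
  eapply Rle_lt_trans; [apply cnorm_le_sumn|].
  apply Rle_lt_trans with (INR p * (d / (1 + INR p))).
  - rewrite <- sumn_const. apply sumn_le. intros i Hi. apply Rlt_le, Hr; assumption.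
  - assert (I := pos_INR p). apply Rmult_lt_reg_r with (1 + INR p); [lra|].
    unfold Rdiv. rewrite !Rmult_assoc, Rinv_l, Rmult_1_r by lra. nra.
Qed.

Definition pderiv (j : nat) (z : nat -> C) : C := circ_mean (fun w => F (upd z j w)) (z j).

Lemma upd_upd {A : Type} (z : nat -> A) (j : nat) (v w : A) : upd (upd z j v) j w = upd z j w.
Proof. apply functional_extensionality; intro i. unfold upd. destruct Nat.eqb; reflexivity. Qed.

Lemma upd_same {A : Type} (z : nat -> A) (j : nat) (v : A) : upd z j v j = v.
Proof. unfold upd. rewrite Nat.eqb_refl. reflexivity. Qed.

Lemma upd_id {A : Type} (z : nat -> A) (j : nat) : upd z j (z j) = z.
Proof.
  apply functional_extensionality; intro i. unfold upd. destruct (Nat.eqb_spec i j); congruence.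
Qed.

(** Separate holomorphy only says that some derivative exists at each point. One is chosen
    pointwise, and [cderiv_circ_mean] then identifies the choice with the circle mean. *)
Lemma cderiv_pderiv (j : nat) (z : nat -> C) : (j < p)%nat ->
  forall w, cderiv (fun v => F (upd z j v)) w (pderiv j (upd z j w)).
Proof.
  intros Hj.
  destruct (functional_choice (fun w l => cderiv (fun v => F (upd z j v)) w l)) as [g' Hg'].
  { intros w. destruct HF as [_ [_ Hd]]. destruct (Hd (upd z j w) j Hj) as [l Hl].
    apply is_derive_cderiv in Hl. rewrite upd_same in Hl.
    replace (fun w0 : C => F (upd (upd z j w) j w0)) with (fun v => F (upd z j v)) in Hl.
    - exists l; exact Hl.
    - apply functional_extensionality; intro v. rewrite upd_upd. reflexivity. }
  intros w. replace (pderiv j (upd z j w)) with (g' w); [apply Hg'|].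
  rewrite (cderiv_circ_mean _ g' Hg' w). unfold pderiv. rewrite upd_same. f_equal.
  apply functional_extensionality; intro v. rewrite upd_upd. reflexivity.
Qed.

Lemma CC_pderiv {U : UniformSpace} (j : nat) (z : U -> nat -> C) : (j < p)%nat ->
  (forall i, (i < p)%nat -> CC (fun u => z u i)) -> CC (fun u => pderiv j (z u)).
Proof.
  intros Hj Hz. unfold pderiv, circ_mean.
  assert (Hlin : forall w : U * R, continuous (fun w : U * R => 2 * PI * snd w) w).
  { intros w. apply (@continuous_mult (prod_UniformSpace U R_UniformSpace) R_AbsRing);
      [apply continuous_const | apply continuous_snd]. }
  assert (Hfst : forall f : U -> C, CC f -> CC (fun w : U * R => f (fst w))).
  { intros f Hf. apply (CC_comp f fst Hf). intros; apply continuous_fst. }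
  apply (CC_CInt_param (fun w : U * R => F (upd (z (fst w)) j (z (fst w) j + cis (2 * PI * snd w))%C)
     * cis (- (2 * PI * snd w)))%C); [lra|].
  apply CC_mult.
  - apply CC_entire. intros i Hi. unfold upd. destruct (Nat.eqb i j).
    + apply CC_plus; [apply (Hfst (fun u => z u j)), Hz, Hj | apply CC_cis, Hlin].
    + apply (Hfst (fun u => z u i)), Hz, Hi.
  - apply CC_cis. intros w. apply (@continuous_opp (prod_UniformSpace U R_UniformSpace) R_AbsRing R_NormedModule), Hlin.
Qed.

Lemma CC_id : CC (fun z : C => z).
Proof. split; intro u; [apply continuous_fst | apply continuous_snd]. Qed.

Lemma ball_C_0 (z : C) (d : posreal) : Cmod z < d -> ball (M := C_UniformSpace) (RtoC 0) d z.
Proof.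
  intros H. split.
  - change (Rabs (fst z - 0) < d). rewrite Rminus_0_r. eapply Rle_lt_trans; [apply fst_le_Cmod | exact H].
  - change (Rabs (snd z - 0) < d). rewrite Rminus_0_r. eapply Rle_lt_trans; [apply snd_le_Cmod | exact H].
Qed.

(** The intermediate points in Osgood's telescoping; for [k = p] a function on C^p sees the full
    displacement [h u]. *)
Definition shift_below (k : nat) (z u : nat -> C) (h : C) : nat -> C :=
  fun i => if Nat.ltb i k then (z i + h * u i)%C else z i.

Lemma shift_below_0 (k : nat) (z u : nat -> C) : shift_below k z u (RtoC 0) = z.
Proof. apply functional_extensionality; intro i. unfold shift_below. destruct Nat.ltb; [ring|reflexivity]. Qed.

Lemma shift_below_S (k : nat) (z u : nat -> C) (h : C) :
  shift_below (S k) z u h = upd (shift_below k z u h) k (z k + h * u k)%C.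
Proof.
  apply functional_extensionality; intro i. unfold shift_below, upd.
  destruct (Nat.eqb_spec i k) as [->|N].
  - rewrite (proj2 (Nat.ltb_lt k (S k))) by lia. reflexivity.
  - destruct (Nat.ltb_spec i k), (Nat.ltb_spec i (S k)); try lia; reflexivity.
Qed.

(* Osgood's lemma: [circ_mean] makes the partial derivatives jointly continuous, so the
   coordinates can be moved one at a time with errors [o(h)]. *)
Lemma cderiv_shift_below (z u : nat -> C) (k : nat) : (k <= p)%nat ->
  exists l, cderiv (fun h => F (shift_below k z u h)) (RtoC 0) l.
Proof.
  induction k; intros Hk.
  { exists (RtoC 0). apply (cderiv_const (F z)). }
  destruct (IHk ltac:(lia)) as [l Hl]. assert (Hkp : (k < p)%nat) by lia.
  set (D := pderiv k z). exists (l + D * u k)%C. intros eps He.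
  assert (U0 := Cmod_ge_0 (u k)).
  assert (E2 : 0 < eps / 2) by lra.
  destruct (Hl _ E2) as [d1 [Hd1 B1]].
  assert (E3 : 0 < eps / (2 * (1 + Cmod (u k)))) by (apply Rdiv_lt_0_compat; lra).
  (* [G (h, q)] describes all points met while coordinate [k] is moved. Joint continuity at the
     origin keeps the partial derivative near [D] for small [h] and [q] at once, as the mean value
     inequality requires. *)
  set (G := fun hq : C * C => upd (shift_below k z u (fst hq)) k (z k + snd hq)%C).
  assert (HG : CC (fun hq : C * C => pderiv k (G hq))).
  { apply CC_pderiv; [exact Hkp|]. intros i Hi. unfold G, upd, shift_below.
    assert (C1 : CC (fun hq : C * C => fst hq)) by (apply (CC_comp (fun z : C => z) fst CC_id); intros; apply continuous_fst).
    assert (C2 : CC (fun hq : C * C => snd hq)) by (apply (CC_comp (fun z : C => z) snd CC_id); intros; apply continuous_snd).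
    destruct (Nat.eqb i k).
    - apply CC_plus; [apply CC_const | exact C2].
    - destruct (Nat.ltb i k); [|apply CC_const].
      apply CC_plus; [apply CC_const|]. apply CC_mult; [exact C1 | apply CC_const]. }
  destruct (proj1 (CC_eps _) HG (RtoC 0, RtoC 0) _ E3) as [d2 B2].
  assert (G0 : G (RtoC 0, RtoC 0) = z).
  { unfold G; simpl. rewrite shift_below_0. replace (z k + 0)%C with (z k) by ring. apply upd_id. }
  rewrite G0 in B2.
  exists (Rmin d1 (d2 / (1 + Cmod (u k)))). split.
  { apply Rmin_pos; [exact Hd1|]. apply Rdiv_lt_0_compat; [apply cond_pos | lra]. }
  intros h Hh. assert (Hh0 := Cmod_ge_0 h).
  assert (H1 := B1 h (Rlt_le_trans _ _ _ Hh (Rmin_l _ _))).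
  assert (H2 := Rlt_le_trans _ _ _ Hh (Rmin_r _ _)).
  assert (H2' : Cmod h * (1 + Cmod (u k)) < d2).
  { apply Rmult_lt_compat_r with (r := 1 + Cmod (u k)) in H2; [|lra].
    replace (d2 / (1 + Cmod (u k)) * (1 + Cmod (u k))) with (pos d2) in H2 by (field; lra). exact H2. }
  set (y := shift_below k z u h).
  assert (yk : y k = z k) by (unfold y, shift_below; rewrite Nat.ltb_irrefl; reflexivity).
  assert (M := cderiv_mean_value (fun v => F (upd y k v)) (fun v => pderiv k (upd y k v)) (z k) (h * u k) D
    (eps / (2 * (1 + Cmod (u k)))) (cderiv_pderiv k y Hkp)).
  assert (HM : Cmod (F (upd y k (z k + h * u k)) - F (upd y k (z k)) - D * (h * u k))%C
     <= eps / (2 * (1 + Cmod (u k))) * Cmod (h * u k)).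
  { apply M. intros t Ht. apply Rlt_le. apply (B2 (h, RtoC t * (h * u k))%C). split.
    - apply ball_C_0. simpl. nra.
    - apply ball_C_0. simpl. rewrite !Cmod_mult, Cmod_R, Rabs_pos_eq by lra.
      assert (0 <= Cmod h * Cmod (u k)) by (apply Rmult_le_pos; assumption).
      apply Rle_lt_trans with (1 * (Cmod h * Cmod (u k))); [apply Rmult_le_compat_r; lra | nra]. }
  replace (upd y k (z k)) with y in HM by (rewrite <- yk; symmetry; apply upd_id).
  rewrite !shift_below_S, !shift_below_0.
  replace (RtoC 0 + h)%C with h in H1 |- * by ring. rewrite shift_below_0 in H1. fold y in H1 |- *.
  replace (z k + 0 * u k)%C with (z k) by ring. rewrite upd_id.
  replace (F (upd y k (z k + h * u k)) - F z - (l + D * u k) * h)%C with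
    ((F (upd y k (z k + h * u k)%C) - F y - D * (h * u k)) + (F y - F z - l * h))%C by ring.
  eapply Rle_trans; [apply Cmod_triangle|].
  assert (HM2 : eps / (2 * (1 + Cmod (u k))) * Cmod (h * u k) <= eps / 2 * Cmod h).
  { rewrite Cmod_mult. apply Rle_trans with (eps / (2 * (1 + Cmod (u k))) * (Cmod h * (1 + Cmod (u k)))).
    - apply Rmult_le_compat_l; [lra|]. apply Rmult_le_compat_l; lra.
    - apply Req_le; field; lra. }
  lra.
Qed.

(** Differentiability at [s] is differentiability at [0] after moving the base point. The line also
    moves coordinates from [p] on, which [shift_below p] does not; [on_Cp] makes the difference
    invisible. *)
Lemma entire_line (z u : nat -> C) :
  exists g', forall s, cderiv (fun s => F (fun i => z i + s * u i)%C) s (g' s).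
Proof.
  apply (functional_choice (fun s l => cderiv (fun s => F (fun i => z i + s * u i)%C) s l)).
  intros s. destruct (cderiv_shift_below (fun i => z i + s * u i)%C u p (Nat.le_refl p)) as [l Hl].
  exists l. intros eps He. destruct (Hl eps He) as [d [Hd B]]. exists d; split; [exact Hd|].
  intros h Hh. specialize (B h Hh).
  rewrite shift_below_0 in B.
  replace (F (fun i => z i + (s + h) * u i)%C) with (F (shift_below p (fun i => z i + s * u i)%C u (0 + h)%C)); [exact B|].
  apply (proj1 HF). intros i Hi. unfold shift_below. rewrite (proj2 (Nat.ltb_lt i p) Hi). ring.
Qed.

End Entire.

(** * Iterated integrals over cubes *)

(* The topology is that of uniform convergence in all coordinates, for which [upd] and
   every coordinate are continuous; only finitely many coordinates ever matter. *)
Notation RN := (fct_UniformSpace nat R_UniformSpace).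

Lemma continuous_coord (i : nat) (x : RN) : continuous (fun y : RN => y i) x.
Proof.
  apply continuous_eps. intros eps He. exists (mkposreal eps He). intros y Hy. exact (Hy i).
Qed.

Lemma continuous_RN {U : UniformSpace} (z : U -> RN) (u : U) :
  (forall e : posreal, exists d : posreal, forall v, ball u d v -> forall i, Rabs (z v i - z u i) < e) ->
  continuous z u.
Proof.
  intros H P [e HP]. destruct (H e) as [d Hd]. exists d. intros v Hv. apply HP.
  intros i. exact (Hd v Hv i).
Qed.

Lemma continuous_upd {U : UniformSpace} (z : U -> RN) (m : nat) (s : U -> R) (u : U) :
  continuous z u -> continuous s u -> continuous (fun v => upd (z v) m (s v) : RN) u.
Proof.
  intros Hz Hs. apply continuous_RN. intros e.
  assert (A : locally u (fun v => ball (z u) e (z v))) by exact (Hz _ (locally_ball (z u) e)).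
  assert (B : locally u (fun v => ball (s u) e (s v))) by exact (Hs _ (locally_ball (s u) e)).
  destruct (filter_and _ _ A B) as [d Hd]. exists d. intros v Hv i.
  destruct (Hd v Hv) as [X Y]. unfold upd. destruct Nat.eqb; [exact Y | exact (X i)].
Qed.

(** The parameter space is arbitrary so that the induction can hand the outermost variable over to
    it: the inner integral is a function of a point of [U * R]. *)
Lemma continuous_cube_int {U : UniformSpace} (m : nat) (T : R) (H : U * RN -> R) : 0 <= T ->
  (forall w, continuous H w) -> forall u, continuous (fun v => cube_int m T (fun x => H (v, x))) u.
Proof.
  intros HT. revert U H. induction m; intros U H HH u; simpl.
  - apply (continuous_comp (fun v : U => (v, (fun _ => 0) : RN)) H); [|apply HH].
    apply continuous_pair; [apply continuous_id | apply continuous_const].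
  - apply (continuous_RInt_param (fun w : U * R => cube_int m T (fun x => H (fst w, upd x m (snd w))))); [lra|].
    intros w. apply (IHm (prod_UniformSpace U R_UniformSpace)
      (fun q : (U * R) * RN => H (fst (fst q), upd (snd q) m (snd (fst q))))).
    intros q. apply (continuous_comp (fun q : (U * R) * RN => (fst (fst q), (upd (snd q) m (snd (fst q))) : RN)) H); [|apply HH].
    apply continuous_pair.
    + apply (continuous_comp fst fst); apply continuous_fst.
    + apply continuous_upd; [apply continuous_snd|].
      apply (continuous_comp fst snd); [apply continuous_fst | apply continuous_snd].
Qed.

Lemma continuous_slice (g : RN -> R) (m : nat) (t : R) : (forall x, continuous g x) ->
  forall x, continuous (fun x : RN => g (upd x m t)) x.
Proof.
  intros Hg x. apply (continuous_comp (fun x : RN => (upd x m t) : RN) g); [|apply Hg].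
  apply continuous_upd; [apply continuous_id | apply continuous_const].
Qed.

Lemma continuous_cube_slice (m : nat) (T : R) (g : RN -> R) : 0 <= T -> (forall x, continuous g x) ->
  forall t, continuous (fun t : R => cube_int m T (fun x => g (upd x m t))) t.
Proof.
  intros HT Hg t.
  apply (continuous_cube_int m T (fun w : R * RN => g (upd (snd w) m (fst w))) HT).
  intros w. apply (continuous_comp (fun w : R * RN => (upd (snd w) m (fst w)) : RN) g); [|apply Hg].
  apply continuous_upd; [apply continuous_snd | apply continuous_fst].
Qed.

Lemma cube_int_ext (m : nat) (T : R) (f g : RN -> R) : (forall x, f x = g x) -> cube_int m T f = cube_int m T g.
Proof. intros H. f_equal. apply functional_extensionality. exact H. Qed.

(** The comparison is required only at points that the iterated integral evaluates. The recursion
    ends at [fun _ => 0], so their coordinates from [m] on vanish. *)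
Lemma cube_int_le (m : nat) (T : R) (f g : RN -> R) : 0 <= T ->
  (forall x, continuous f x) -> (forall x, continuous g x) ->
  (forall x, (forall i, (i < m)%nat -> Rabs (x i) <= T) -> (forall i, (m <= i)%nat -> x i = 0) -> f x <= g x) ->
  cube_int m T f <= cube_int m T g.
Proof.
  intros HT. revert f g. induction m; intros f g Hf Hg H; simpl.
  - apply H; [intros; lia | reflexivity].
  - apply RInt_le; [lra | apply ex_RInt_cont, continuous_cube_slice; assumption
      | apply ex_RInt_cont, continuous_cube_slice; assumption |].
    intros t Ht. apply IHm; [apply continuous_slice; assumption | apply continuous_slice; assumption |].
    intros x Hx Hx0. apply H.
    + intros i Hi. unfold upd. destruct (Nat.eqb_spec i m); [apply Rabs_le; lra | apply Hx; lia].
    + intros i Hi. unfold upd. destruct (Nat.eqb_spec i m); [lia | apply Hx0; lia].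
Qed.

Lemma cube_int_plus (m : nat) (T : R) (f g : RN -> R) : 0 <= T ->
  (forall x, continuous f x) -> (forall x, continuous g x) ->
  cube_int m T (fun x => f x + g x) = cube_int m T f + cube_int m T g.
Proof.
  intros HT. revert f g. induction m; intros f g Hf Hg; simpl; [reflexivity|].
  rewrite <- (@RInt_plus R_CompleteNormedModule) by (apply ex_RInt_cont, continuous_cube_slice; assumption).
  apply RInt_ext. intros t _. apply IHm; apply continuous_slice; assumption.
Qed.

Lemma cube_int_scal (m : nat) (T c : R) (f : RN -> R) : 0 <= T -> (forall x, continuous f x) ->
  cube_int m T (fun x => c * f x) = c * cube_int m T f.
Proof.
  intros HT. revert f. induction m; intros f Hf; simpl; [reflexivity|].
  change (c * RInt (fun t => cube_int m T (fun x => f (upd x m t))) (- T) T) with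
    (scal c (RInt (fun t => cube_int m T (fun x => f (upd x m t))) (- T) T)).
  rewrite <- (@RInt_scal R_CompleteNormedModule) by (apply ex_RInt_cont, continuous_cube_slice; assumption).
  apply RInt_ext. intros t _. apply (IHm (fun x => f (upd x m t))). apply continuous_slice; assumption.
Qed.

Lemma cube_int_const (m : nat) (T c : R) : cube_int m T (fun _ => c) = (2 * T) ^ m * c.
Proof.
  induction m; simpl; [ring|].
  rewrite (RInt_ext _ (fun _ => (2 * T) ^ m * c)) by (intros; exact IHm).
  rewrite RInt_const. change ((T - - T) * ((2 * T) ^ m * c) = 2 * T * (2 * T) ^ m * c). ring.
Qed.

(** Fubini by differentiation: as functions of the upper limit [r] in place of [b], both sides have
    derivative equal to the integral of [K (r, s)] over [s], and both vanish at [r = a]. *)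
Lemma RInt_swap (K : R * R -> R) (a b c d : R) : a <= b -> c <= d -> (forall w, continuous K w) ->
  RInt (fun t => RInt (fun s => K (t, s)) c d) a b = RInt (fun s => RInt (fun t => K (t, s)) a b) c d.
Proof.
  intros Hab Hcd HK.
  assert (K1 : forall t s, continuous (fun s => K (t, s)) s).
  { intros t s. apply (continuous_comp (fun s : R => (t, s)) K); [|apply HK].
    apply continuous_pair; [apply continuous_const | apply continuous_id]. }
  assert (K2 : forall s t, continuous (fun t => K (t, s)) t).
  { intros s t. apply (continuous_comp (fun t : R => (t, s)) K); [|apply HK].
    apply continuous_pair; [apply continuous_id | apply continuous_const]. }
  assert (KI : forall t, continuous (fun t => RInt (fun s => K (t, s)) c d) t).
  { intros t. apply (continuous_RInt_param K c d Hcd HK). }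
  assert (D1 : forall r, is_derive (fun r => RInt (fun t => RInt (fun s => K (t, s)) c d) a r) r (RInt (fun s => K (r, s)) c d)).
  { intros r. apply (is_derive_RInt (V := R_NormedModule) (fun t => RInt (fun s => K (t, s)) c d) _ a).
    - apply filter_forall. intros r'. apply (RInt_correct (V := R_CompleteNormedModule)), ex_RInt_cont, KI.
    - apply KI. }
  assert (D0 : forall s r, is_derive (fun r => RInt (fun t => K (t, s)) a r) r (K (r, s))).
  { intros s r. apply (is_derive_RInt (V := R_NormedModule) (fun t => K (t, s)) _ a).
    - apply filter_forall. intros r'. apply (RInt_correct (V := R_CompleteNormedModule)), ex_RInt_cont, K2.
    - apply K2. }
  assert (DE : forall s r, Derive (fun r => RInt (fun t => K (t, s)) a r) r = K (r, s)).
  { intros s r. apply is_derive_unique, D0. }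
  assert (CK : forall r s, continuous (fun s => RInt (fun t => K (t, s)) a r) s).
  { intros r s. destruct (Rle_dec a r) as [L|L].
    - apply (continuous_RInt_param (fun w : R * R => K (snd w, fst w)) a r L).
      intros w. apply (continuous_comp (fun w : R * R => (snd w, fst w)) K); [|apply HK].
      apply continuous_pair; [apply continuous_snd | apply continuous_fst].
    - apply (continuous_ext (fun s => opp (RInt (fun t => K (t, s)) r a))).
      { intros q. apply (opp_RInt_swap (V := R_CompleteNormedModule)). apply ex_RInt_cont, K2. }
      apply (@continuous_opp R_UniformSpace R_AbsRing R_NormedModule).
      apply (continuous_RInt_param (fun w : R * R => K (snd w, fst w)) r a); [lra|].
      intros w. apply (continuous_comp (fun w : R * R => (snd w, fst w)) K); [|apply HK].
      apply continuous_pair; [apply continuous_snd | apply continuous_fst]. }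
  assert (D2 : forall r, is_derive (fun r => RInt (fun s => RInt (fun t => K (t, s)) a r) c d) r (RInt (fun s => K (r, s)) c d)).
  { intros r.
    replace (RInt (fun s => K (r, s)) c d) with (RInt (fun s => Derive (fun r => RInt (fun t => K (t, s)) a r) r) c d)
      by (apply RInt_ext; intros; apply DE).
    apply (is_derive_RInt_param (fun r s => RInt (fun t => K (t, s)) a r) c d r).
    - apply filter_forall. intros r' s _. exists (K (r', s)). apply D0.
    - intros s _ eps. destruct (proj1 (continuous_eps K (r, s)) (HK (r, s)) eps (cond_pos eps)) as [dl Hdl].
      exists dl. intros r' s' Hr Hs. rewrite !DE. apply (Hdl (r', s')). split; assumption.
    - apply filter_forall. intros r'. apply ex_RInt_cont, CK. }
  assert (P0 : forall r, RInt (fun s => RInt (fun t => K (t, s)) r r) c d = 0).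
  { intros r. rewrite (RInt_ext _ (fun _ => 0)) by (intros; exact (RInt_point _ _)).
    rewrite RInt_const. apply Rmult_0_r. }
  destruct (Req_dec a b) as [->|Hne].
  { rewrite RInt_point, P0. reflexivity. }
  assert (E : forall r, is_derive (fun r => minus (RInt (fun t => RInt (fun s => K (t, s)) c d) a r)
      (RInt (fun s => RInt (fun t => K (t, s)) a r) c d)) r (zero : R_NormedModule)).
  { intros r. generalize (is_derive_minus (V := R_NormedModule) _ _ r _ _ (D1 r) (D2 r)).
    rewrite minus_eq_zero. exact (fun H => H). }
  assert (E' := eq_is_derive (V := R_NormedModule) _ a b (fun t _ => E t) ltac:(lra)).
  cbv beta in E'. rewrite P0 in E'.
  rewrite (RInt_point (V := R_CompleteNormedModule)) in E'.
  apply Rminus_diag_uniq. transitivity (0 - 0); [symmetry; exact E' | ring].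
Qed.

Lemma RInt_cube_int_swap (m : nat) (T a b : R) (H : R * RN -> R) : 0 <= T -> a <= b ->
  (forall w, continuous H w) ->
  RInt (fun t => cube_int m T (fun x => H (t, x))) a b = cube_int m T (fun x => RInt (fun t => H (t, x)) a b).
Proof.
  intros HT Hab. revert H. induction m; intros H HH; simpl; [reflexivity|].
  etransitivity; [apply (RInt_swap (fun w : R * R => cube_int m T (fun x => H (fst w, upd x m (snd w)))) a b (- T) T Hab ltac:(lra))|].
  - intros w. apply (continuous_cube_int m T (fun q : (R * R) * RN => H (fst (fst q), upd (snd q) m (snd (fst q)))) HT).
    intros q. apply (continuous_comp (fun q : (R * R) * RN => (fst (fst q), (upd (snd q) m (snd (fst q))) : RN)) H); [|apply HH].
    apply continuous_pair.
    + apply (continuous_comp fst fst); apply continuous_fst.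
    + apply continuous_upd; [apply continuous_snd|].
      apply (continuous_comp fst snd); [apply continuous_fst | apply continuous_snd].
  - apply RInt_ext. intros s _. simpl. apply (IHm (fun w : R * RN => H (fst w, upd (snd w) m s))).
    intros w. apply (continuous_comp (fun w : R * RN => (fst w, (upd (snd w) m s) : RN)) H); [|apply HH].
    apply continuous_pair; [apply continuous_fst|].
    apply continuous_upd; [apply continuous_snd | apply continuous_const].
Qed.

(** The translated cube lies inside the enlarged one, and a nonnegative integrand can only gain from
    enlargement. *)
Lemma cube_int_shift_le (m : nat) (T h : R) (g : RN -> R) (y : RN) : 0 <= T -> 0 <= h ->
  (forall x, continuous g x) -> (forall x, 0 <= g x) ->
  (forall i, (i < m)%nat -> Rabs (y i) <= h) -> (forall i, (m <= i)%nat -> y i = 0) ->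
  cube_int m T (fun x => g (fun i => x i + y i)) <= cube_int m (T + h) g.
Proof.
  intros HT Hh. revert g y. induction m; intros g y Hg Hp Hy Hy0.
  - simpl. apply Req_le. f_equal. apply functional_extensionality; intro i. rewrite Hy0 by lia. ring.
  - simpl.
    set (G := fun s => cube_int m (T + h) (fun x => g (upd x m s))).
    assert (GC : forall s, continuous G s) by (apply continuous_cube_slice; [lra | exact Hg]).
    assert (Gp : forall s, 0 <= G s).
    { intros s. replace 0 with (cube_int m (T + h) (fun _ => 0)) by (rewrite cube_int_const; ring).
      apply cube_int_le; [lra | intros; apply continuous_const | apply continuous_slice, Hg | intros; apply Hp]. }
    assert (ym := proj1 (Rabs_le_between _ _) (Hy m (Nat.lt_succ_diag_r m))).
    assert (HS : forall x, continuous (fun x : RN => g (fun i => x i + y i)) x).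
    { intros x. apply (continuous_comp (fun x : RN => (fun i => x i + y i) : RN) g); [|apply Hg].
      apply continuous_RN. intros e. exists e. intros v Hv i. 
      replace (v i + y i - (x i + y i)) with (v i - x i) by ring. exact (Hv i). }
    apply Rle_trans with (RInt (fun t => G (1 * t + y m)) (- T) T).
    + apply RInt_le; [lra | apply ex_RInt_cont, (continuous_cube_slice m T (fun x : RN => g (fun i => x i + y i))); assumption | |].
      { apply ex_RInt_cont. intros t. apply (continuous_comp (fun t => 1 * t + y m) G); [|apply GC].
        apply (ex_derive_continuous (K := R_AbsRing) (V := R_NormedModule)). auto_derive; exact I. }
      intros t _. unfold G.
      (* The [m]-th coordinate of the shift is absorbed into the outer variable [1 * t + y m]; the
         inner integral keeps the shift [upd y m 0]. *)
      eapply Rle_trans; [|apply (IHm (fun x => g (upd x m (1 * t + y m))) (upd y m 0))].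
      * apply Req_le. apply cube_int_ext. intros x. f_equal. apply functional_extensionality; intro i.
        unfold upd. destruct (Nat.eqb_spec i m) as [->|]; ring.
      * apply continuous_slice, Hg.
      * intros; apply Hp.
      * intros i Hi. unfold upd. destruct (Nat.eqb_spec i m); [lia | apply Hy; lia].
      * intros i Hi. unfold upd. destruct (Nat.eqb_spec i m); [reflexivity | apply Hy0; lia].
    + rewrite (RInt_ext _ (fun t => scal 1 (G (1 * t + y m)))).
      2: { intros t _. unfold scal; simpl. unfold mult; simpl. ring. }
      rewrite (RInt_comp_lin (V := R_CompleteNormedModule)) by (apply ex_RInt_cont, GC).
      set (a := 1 * - T + y m). set (b := 1 * T + y m).
      assert (EX : forall a b, ex_RInt G a b) by (intros; apply ex_RInt_cont, GC).
      assert (C1 := RInt_Chasles (V := R_CompleteNormedModule) G (- (T + h)) a (T + h) (EX _ _) (EX _ _)).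
      assert (C2 := RInt_Chasles (V := R_CompleteNormedModule) G a b (T + h) (EX _ _) (EX _ _)).
      change (RInt G (- (T + h)) a + RInt G a (T + h) = RInt G (- (T + h)) (T + h)) in C1.
      change (RInt G a b + RInt G b (T + h) = RInt G a (T + h)) in C2.
      assert (P1 : 0 <= RInt G (- (T + h)) a) by (apply RInt_ge_0; [unfold a; lra | apply EX | intros; apply Gp]).
      assert (P2 : 0 <= RInt G b (T + h)) by (apply RInt_ge_0; [unfold b; lra | apply EX | intros; apply Gp]).
      change (RInt G a b <= RInt G (- (T + h)) (T + h)). lra.
Qed.

(** * Means of exponentials *)

Lemma sumn_ext (p : nat) (a b : nat -> R) : (forall i, (i < p)%nat -> a i = b i) -> sumn p a = sumn p b.
Proof.
  induction p; intros H; simpl; [reflexivity|].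
  rewrite H by lia. f_equal. apply IHp. intros; apply H; lia.
Qed.

Definition cos_int (nu T : R) : R := RInt (fun t => cos (nu * t)) (- T) T.

Fixpoint cos_prod (m : nat) (nu : nat -> R) (T : R) : R :=
  match m with O => 1 | S k => cos_prod k nu T * cos_int (nu k) T end.

Lemma continuous_cos_affine (a nu t : R) : continuous (fun t => cos (a + nu * t)) t.
Proof. apply (ex_derive_continuous (K := R_AbsRing) (V := R_NormedModule)). auto_derive; exact I. Qed.

Lemma RInt_sin_odd (nu T : R) : RInt (fun t => sin (nu * t)) (- T) T = 0.
Proof.
  assert (C : forall t, continuous (fun t => sin (nu * t)) t).
  { intros t. apply (ex_derive_continuous (K := R_AbsRing) (V := R_NormedModule)). auto_derive; exact I. }
  assert (E := RInt_comp_lin (V := R_CompleteNormedModule) (fun t => sin (nu * t)) (-1) 0 (- T) T ltac:(apply ex_RInt_cont, C)).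
  rewrite (RInt_ext _ (fun t => sin (nu * t))) in E.
  2: { intros t _. unfold scal; simpl. unfold mult; simpl.
       replace (nu * (-1 * t + 0)) with (- (nu * t)) by ring. rewrite sin_neg. ring. }
  replace (-1 * - T + 0) with T in E by ring. replace (-1 * T + 0) with (- T) in E by ring.
  assert (S := opp_RInt_swap (V := R_CompleteNormedModule) (fun t => sin (nu * t)) (- T) T ltac:(apply ex_RInt_cont, C)).
  rewrite <- S in E. unfold opp in E; simpl in E. lra.
Qed.

Lemma RInt_cos_affine (a nu T : R) : RInt (fun t => cos (a + nu * t)) (- T) T = cos a * cos_int nu T.
Proof.
  assert (C1 : ex_RInt (fun t => cos (nu * t)) (- T) T).
  { apply ex_RInt_cont. intros t. apply (ex_derive_continuous (K := R_AbsRing) (V := R_NormedModule)). auto_derive; exact I. }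
  assert (C2 : ex_RInt (fun t => sin (nu * t)) (- T) T).
  { apply ex_RInt_cont. intros t. apply (ex_derive_continuous (K := R_AbsRing) (V := R_NormedModule)). auto_derive; exact I. }
  rewrite (RInt_ext _ (fun t => minus (scal (cos a) (cos (nu * t))) (scal (sin a) (sin (nu * t))))).
  2: { intros t _. rewrite cos_plus. reflexivity. }
  assert (E := RInt_minus (V := R_CompleteNormedModule) _ _ _ _
    (ex_RInt_scal (V := R_NormedModule) _ _ _ (cos a) C1) (ex_RInt_scal (V := R_NormedModule) _ _ _ (sin a) C2)).
  etransitivity; [exact E|].
  etransitivity; [apply (f_equal2 Rminus); [exact (RInt_scal (V := R_CompleteNormedModule) _ _ _ (cos a) C1)
    | exact (RInt_scal (V := R_CompleteNormedModule) _ _ _ (sin a) C2)]|].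
  rewrite RInt_sin_odd.
  change (cos a * cos_int nu T - sin a * 0 = cos a * cos_int nu T). ring.
Qed.

Lemma inner_upd (m : nat) (x nu : nat -> R) (t : R) : inner (S m) (upd x m t) nu = inner m x nu + t * nu m.
Proof.
  unfold inner. simpl. rewrite upd_same. f_equal. apply sumn_ext. intros i Hi. unfold upd.
  destruct (Nat.eqb_spec i m); [lia | reflexivity].
Qed.

(** The phase [a] is left free so that the outer variable can be absorbed into it. Sine terms are
    odd and drop out, so the integral factors into cosine integrals. *)
Lemma cube_int_cos (m : nat) (T a : R) (nu : nat -> R) :
  cube_int m T (fun x => cos (a + inner m x nu)) = cos a * cos_prod m nu T.
Proof.
  revert a. induction m; intros a.
  - simpl. unfold inner; simpl. rewrite Rplus_0_r. ring.
  - change (RInt (fun t => cube_int m T (fun x => cos (a + inner (S m) (upd x m t) nu))) (- T) T = cos a * (cos_prod m nu T * cos_int (nu m) T)).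
    rewrite (RInt_ext _ (fun t => scal (cos_prod m nu T) (cos (a + nu m * t)))).
    + rewrite (RInt_scal (V := R_CompleteNormedModule)) by (apply ex_RInt_cont; intros; apply continuous_cos_affine).
      rewrite RInt_cos_affine. unfold scal; simpl. unfold mult; simpl. ring.
    + intros t _. transitivity (cube_int m T (fun x => cos ((a + nu m * t) + inner m x nu))).
      * apply cube_int_ext. intros x. f_equal. rewrite inner_upd. ring.
      * rewrite IHm. unfold scal; simpl. unfold mult; simpl. ring.
Qed.

Lemma cos_int_le (nu T : R) : 0 <= T -> Rabs (cos_int nu T) <= 2 * T.
Proof.
  intros HT. unfold cos_int. replace (2 * T) with ((T - - T) * 1) by ring.
  apply abs_RInt_le_const; [lra | |].
  - apply ex_RInt_cont. intros t. apply (ex_derive_continuous (K := R_AbsRing) (V := R_NormedModule)). auto_derive; exact I.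
  - intros t _. apply Rabs_le. generalize (COS_bound (nu * t)). lra.
Qed.

Lemma cos_int_bound (nu T : R) : Rabs (cos_int nu T) * Rabs nu <= 2.
Proof.
  rewrite <- Rabs_mult.
  assert (E : cos_int nu T * nu = sin (nu * T) - sin (nu * - T)).
  { unfold cos_int. rewrite Rmult_comm.
    change (nu * RInt (fun t => cos (nu * t)) (- T) T) with (scal nu (RInt (fun t => cos (nu * t)) (- T) T)).
    rewrite <- (RInt_scal (V := R_CompleteNormedModule)).
    - apply is_RInt_unique. apply (is_RInt_derive (V := R_CompleteNormedModule) (fun t => sin (nu * t))).
      + intros t _. unfold scal; simpl; unfold mult; simpl. auto_derive; [exact I | ring].
      + intros t _. apply (ex_derive_continuous (K := R_AbsRing) (V := R_NormedModule)). unfold scal; simpl; unfold mult; simpl. auto_derive; exact I.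
    - apply ex_RInt_cont. intros t. apply (ex_derive_continuous (K := R_AbsRing) (V := R_NormedModule)). auto_derive; exact I. }
  rewrite E. apply Rabs_le. generalize (SIN_bound (nu * T)), (SIN_bound (nu * - T)). lra.
Qed.

Lemma cos_prod_le (m : nat) (nu : nat -> R) (T : R) : 0 <= T -> Rabs (cos_prod m nu T) <= (2 * T) ^ m.
Proof.
  intros HT. induction m; simpl; [rewrite Rabs_R1; lra|].
  rewrite Rabs_mult, (Rmult_comm (2 * T)). apply Rmult_le_compat; try apply Rabs_pos; [exact IHm | apply cos_int_le, HT].
Qed.

(** One nonzero frequency improves the trivial bound [(2 * T) ^ m] by a factor [1 / T], since its
    cosine integral is at most [2 / |nu j|]. Written without division, the bound also admits
    [nu j = 0]. *)
Lemma cos_prod_bound (m : nat) (nu : nat -> R) (T : R) (j : nat) : 0 <= T -> (j < m)%nat ->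
  Rabs (cos_prod m nu T) * (T * Rabs (nu j)) <= (2 * T) ^ m.
Proof.
  intros HT. induction m; intros Hj; [lia|]. simpl. rewrite Rabs_mult.
  destruct (Nat.eq_dec j m) as [->|Hne].
  - replace (Rabs (cos_prod m nu T) * Rabs (cos_int (nu m) T) * (T * Rabs (nu m))) with
      (T * (Rabs (cos_int (nu m) T) * Rabs (nu m)) * Rabs (cos_prod m nu T)) by ring.
    apply Rmult_le_compat; [| apply Rabs_pos | | apply cos_prod_le, HT].
    + apply Rmult_le_pos; [exact HT|]. apply Rmult_le_pos; apply Rabs_pos.
    + rewrite (Rmult_comm 2 T). apply Rmult_le_compat_l; [exact HT | apply cos_int_bound].
  - replace (Rabs (cos_prod m nu T) * Rabs (cos_int (nu m) T) * (T * Rabs (nu j))) with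
      (Rabs (cos_int (nu m) T) * (Rabs (cos_prod m nu T) * (T * Rabs (nu j)))) by ring.
    apply Rmult_le_compat; [apply Rabs_pos | | apply cos_int_le, HT | apply IHm; lia].
    apply Rmult_le_pos; [apply Rabs_pos|]. apply Rmult_le_pos; [exact HT | apply Rabs_pos].
Qed.

(** * Gamma integrals *)

(** The incomplete Gamma integral. All ray integrals are cut off at one large [r], so no improper
    integral occurs; [gamma_val] is the limit value. *)
Definition gamma_int (n : nat) (a r : R) : R := RInt (fun t => t ^ n * exp (- (a * t))) 0 r.

Lemma continuous_gamma (n : nat) (a t : R) : continuous (fun t => t ^ n * exp (- (a * t))) t.
Proof. apply (ex_derive_continuous (K := R_AbsRing) (V := R_NormedModule)). auto_derive; exact I. Qed.

Lemma gamma_int_0 (a r : R) : 0 < a -> gamma_int 0 a r = (1 - exp (- (a * r))) / a.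
Proof.
  intros Ha. unfold gamma_int. apply is_RInt_unique.
  replace ((1 - exp (- (a * r))) / a) with (minus (- exp (- (a * r)) / a) (- exp (- (a * 0)) / a)).
  2: { rewrite Rmult_0_r, Ropp_0, exp_0. unfold minus, plus, opp; simpl. field. lra. }
  apply (is_RInt_derive (V := R_CompleteNormedModule) (fun t => - exp (- (a * t)) / a)).
  - intros t _. auto_derive; [exact I | simpl; field; lra].
  - intros t _. apply continuous_gamma.
Qed.

(** Integration by parts, with primitive [- t^{n+1} e^{-at} / a]. *)
Lemma gamma_int_S (n : nat) (a r : R) : 0 < a ->
  gamma_int (S n) a r = (INR (S n) * gamma_int n a r - r ^ S n * exp (- (a * r))) / a.
Proof.
  intros Ha.
  assert (E : RInt (fun t => minus (t ^ S n * exp (- (a * t))) (scal (INR (S n) / a) (t ^ n * exp (- (a * t))))) 0 r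
     = - (r ^ S n * exp (- (a * r))) / a).
  { apply is_RInt_unique.
    replace (- (r ^ S n * exp (- (a * r))) / a) with
      (minus (- (r ^ S n * exp (- (a * r))) / a) (- (0 ^ S n * exp (- (a * 0))) / a)).
    2: { unfold minus, plus, opp; simpl. field. lra. }
    apply (is_RInt_derive (V := R_CompleteNormedModule) (fun t => - (t ^ S n * exp (- (a * t))) / a)).
    - intros t _.
      change (is_derive (fun t => - (t ^ S n * exp (- (a * t))) / a) t
        (t ^ S n * exp (- (a * t)) - INR (S n) / a * (t ^ n * exp (- (a * t))))).
      auto_derive; [exact I|]. change (match n with O => 1 | S _ => INR n + 1 end) with (INR (S n)). change (t ^ S n) with (t * t ^ n). field. lra.
    - intros t _. apply (@continuous_minus R_UniformSpace R_AbsRing R_NormedModule); [apply continuous_gamma|].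
      apply (@continuous_scal_r R_UniformSpace R_AbsRing R_NormedModule), continuous_gamma. }
  rewrite (RInt_minus (V := R_CompleteNormedModule)) in E.
  2: { apply ex_RInt_cont, continuous_gamma. }
  2: { apply (ex_RInt_scal (V := R_NormedModule)), ex_RInt_cont, continuous_gamma. }
  rewrite (RInt_scal (V := R_CompleteNormedModule)) in E by (apply ex_RInt_cont, continuous_gamma).
  change (gamma_int (S n) a r - INR (S n) / a * gamma_int n a r = - (r ^ S n * exp (- (a * r))) / a) in E.
  replace (gamma_int (S n) a r) with ((gamma_int (S n) a r - INR (S n) / a * gamma_int n a r) + INR (S n) / a * gamma_int n a r) by ring.
  rewrite E. field. lra.
Qed.

Definition gamma_val (n : nat) (a : R) : R := INR (fact n) / a ^ S n.

Lemma gamma_val_S (n : nat) (a : R) : 0 < a -> gamma_val (S n) a = INR (S n) * gamma_val n a / a.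
Proof.
  intros Ha. unfold gamma_val. change (fact (S n)) with (S n * fact n)%nat. rewrite mult_INR.
  simpl pow. assert (a ^ n <> 0) by (apply pow_nonzero; lra). field. split; [assumption | lra].
Qed.

Lemma gamma_val_pos (n : nat) (a : R) : 0 < a -> 0 < gamma_val n a.
Proof. intros Ha. apply Rdiv_lt_0_compat; [apply INR_fact_lt_0 | apply pow_lt, Ha]. Qed.

Lemma gamma_int_le (n : nat) (a r : R) : 0 < a -> 0 <= r -> gamma_int n a r <= gamma_val n a.
Proof.
  intros Ha HR. induction n.
  - rewrite gamma_int_0 by exact Ha. unfold gamma_val; simpl. unfold Rdiv. rewrite Rmult_1_r.
    apply Rmult_le_compat_r; [apply Rlt_le, Rinv_0_lt_compat, Ha|]. generalize (exp_pos (- (a * r))). lra.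
  - rewrite gamma_int_S, gamma_val_S by exact Ha. unfold Rdiv.
    apply Rmult_le_compat_r; [apply Rlt_le, Rinv_0_lt_compat, Ha|].
    assert (A := Rmult_le_compat_l _ _ _ (pos_INR (S n)) IHn).
    assert (B : 0 <= r ^ S n * exp (- (a * r))) by (apply Rmult_le_pos; [apply pow_le, HR | apply Rlt_le, exp_pos]).
    lra.
Qed.

Lemma exp_pow (k : nat) (y : R) : exp y ^ k = exp (INR k * y).
Proof.
  induction k.
  - change (1 = exp (0 * y)). rewrite Rmult_0_l, exp_0. reflexivity.
  - rewrite S_INR, Rmult_plus_distr_r, Rmult_1_l, exp_plus, <- IHk. simpl. ring.
Qed.

(** For [n > 0], raise [x / n <= e^{x/n}] to the power [n]. *)
Lemma pow_le_exp (n : nat) (x : R) : 0 <= x -> x ^ n <= INR n ^ n * exp x.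
Proof.
  intros Hx. destruct n.
  - simpl. generalize (exp_ineq1_le x). lra.
  - assert (Hn : 0 < INR (S n)) by (apply lt_0_INR; lia).
    assert (E : x ^ S n = INR (S n) ^ S n * (x / INR (S n)) ^ S n).
    { rewrite <- Rpow_mult_distr. f_equal. field. lra. }
    rewrite E. apply Rmult_le_compat_l; [apply pow_le; lra|].
    assert (E2 : exp x = exp (x / INR (S n)) ^ S n).
    { rewrite exp_pow. f_equal. field. lra. }
    rewrite E2. apply pow_incr. split.
    + apply Rdiv_le_0_compat; lra.
    + generalize (exp_ineq1_le (x / INR (S n))). lra.
Qed.

(** Applying [pow_le_exp] with exponent [n + 1] bounds [r^n e^{-ar}] by [M / r]. *)
Lemma pow_exp_decay (n : nat) (a eps : R) : 0 < a -> 0 < eps ->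
  exists R0, forall r, R0 <= r -> r ^ n * exp (- (a * r)) <= eps.
Proof.
  intros Ha He. set (M := INR (S n) ^ S n / a ^ S n).
  assert (Hap : 0 < a ^ S n) by (apply pow_lt, Ha).
  assert (HM : 0 <= M) by (apply Rdiv_le_0_compat; [apply pow_le, pos_INR | exact Hap]).
  exists (Rmax 1 (M / eps)). intros r HR.
  assert (R1 : 1 <= r) by (eapply Rle_trans; [apply Rmax_l | exact HR]).
  assert (R2 : M / eps <= r) by (eapply Rle_trans; [apply Rmax_r | exact HR]).
  apply Rmult_le_compat_r with (r := eps) in R2; [|lra].
  replace (M / eps * eps) with M in R2 by (field; lra).
  assert (A := pow_le_exp (S n) (a * r) ltac:(apply Rmult_le_pos; lra)).
  rewrite Rpow_mult_distr in A.
  assert (B : r ^ S n * exp (- (a * r)) <= M).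
  { unfold M. apply Rmult_le_reg_l with (a ^ S n); [exact Hap|].
    replace (a ^ S n * (INR (S n) ^ S n / a ^ S n)) with (INR (S n) ^ S n) by (field; lra).
    apply Rmult_le_reg_r with (exp (a * r)); [apply exp_pos|].
    replace (a ^ S n * (r ^ S n * exp (- (a * r))) * exp (a * r)) with
      (a ^ S n * r ^ S n * (exp (- (a * r)) * exp (a * r))) by ring.
    rewrite <- exp_plus, Rplus_opp_l, exp_0, Rmult_1_r. exact A. }
  apply Rmult_le_reg_l with r; [lra|].
  apply Rle_trans with M; [simpl in B; lra | lra].
Qed.

Lemma gamma_int_ge (n : nat) (a : R) : 0 < a -> forall eps, 0 < eps ->
  exists R0, forall r, R0 <= r -> gamma_val n a - eps <= gamma_int n a r.
Proof.
  intros Ha. assert (Hi := Rinv_0_lt_compat _ Ha). induction n; intros eps He.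
  - destruct (pow_exp_decay 0 a (eps * a) Ha ltac:(apply Rmult_lt_0_compat; assumption)) as [R0 H0].
    exists R0. intros r HR. specialize (H0 r HR). rewrite gamma_int_0 by exact Ha.
    simpl in H0. rewrite Rmult_1_l in H0. unfold gamma_val; simpl. rewrite Rmult_1_r.
    apply Rmult_le_reg_r with a; [exact Ha|]. 
    replace ((1 / a - eps) * a) with (1 - eps * a) by (field; lra).
    replace ((1 - exp (- (a * r))) / a * a) with (1 - exp (- (a * r))) by (field; lra). lra.
  - assert (Hn : 0 < INR (S n)) by (apply lt_0_INR; lia).
    destruct (IHn (eps * a / (2 * INR (S n)))) as [R1 H1].
    { apply Rdiv_lt_0_compat; [apply Rmult_lt_0_compat|]; lra. }
    destruct (pow_exp_decay (S n) a (eps * a / 2) Ha) as [R2 H2].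
    { assert (0 < eps * a) by (apply Rmult_lt_0_compat; lra). lra. }
    exists (Rmax R1 R2). intros r HR.
    specialize (H1 r (Rle_trans _ _ _ (Rmax_l _ _) HR)). specialize (H2 r (Rle_trans _ _ _ (Rmax_r _ _) HR)).
    rewrite gamma_int_S, gamma_val_S by exact Ha.
    apply Rmult_le_reg_r with a; [exact Ha|].
    apply Rmult_le_compat_l with (r := INR (S n)) in H1; [|lra].
    replace (INR (S n) * (gamma_val n a - eps * a / (2 * INR (S n)))) with
      (INR (S n) * gamma_val n a - eps * a / 2) in H1 by (field; lra).
    replace ((INR (S n) * gamma_val n a / a - eps) * a) with (INR (S n) * gamma_val n a - eps * a) by (field; lra).
    replace ((INR (S n) * gamma_int n a r - r ^ S n * exp (- (a * r))) / a * a) with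
      (INR (S n) * gamma_int n a r - r ^ S n * exp (- (a * r))) by (field; lra). lra.
Qed.

(** * Means over cubes of complex functions *)

(** Taken by components in the form of [fourier_avg], which is convertible to the mean of [f] times
    the character of [lam]. *)
Definition cmean (p : nat) (T : R) (h : RN -> C) : C :=
  (cube_avg p T (fun x => fst (h x)), cube_avg p T (fun x => snd (h x))).

Lemma cmean_ext (p : nat) (T : R) (h k : RN -> C) : (forall x, h x = k x) -> cmean p T h = cmean p T k.
Proof. intros H. f_equal. apply functional_extensionality, H. Qed.

Lemma cube_vol_pos (p : nat) (T : R) : 0 < T -> 0 < (2 * T) ^ p.
Proof. intros HT. apply pow_lt. lra. Qed.

Lemma cube_avg_plus (p : nat) (T : R) (f g : RN -> R) : 0 < T ->
  (forall x, continuous f x) -> (forall x, continuous g x) ->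
  cube_avg p T (fun x => f x + g x) = cube_avg p T f + cube_avg p T g.
Proof.
  intros HT Hf Hg. unfold cube_avg. rewrite (cube_int_plus p T f g) by (assumption || lra).
  apply Rdiv_plus_distr.
Qed.

Lemma cube_avg_scal (p : nat) (T c : R) (f : RN -> R) : 0 < T -> (forall x, continuous f x) ->
  cube_avg p T (fun x => c * f x) = c * cube_avg p T f.
Proof.
  intros HT Hf. unfold cube_avg. rewrite (cube_int_scal p T c f) by (assumption || lra).
  unfold Rdiv. ring.
Qed.

Lemma cube_avg_le (p : nat) (T : R) (f g : RN -> R) : 0 < T ->
  (forall x, continuous f x) -> (forall x, continuous g x) ->
  (forall x, (forall i, (i < p)%nat -> Rabs (x i) <= T) -> (forall i, (p <= i)%nat -> x i = 0) -> f x <= g x) ->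
  cube_avg p T f <= cube_avg p T g.
Proof.
  intros HT Hf Hg H. unfold cube_avg, Rdiv.
  apply Rmult_le_compat_r; [apply Rlt_le, Rinv_0_lt_compat, cube_vol_pos, HT|].
  apply cube_int_le; [lra | assumption..].
Qed.

Lemma cube_avg_const (p : nat) (T c : R) : 0 < T -> cube_avg p T (fun _ => c) = c.
Proof.
  intros HT. unfold cube_avg. rewrite cube_int_const. field. apply Rgt_not_eq, cube_vol_pos, HT.
Qed.

Lemma cmean_plus (p : nat) (T : R) (h k : RN -> C) : 0 < T -> CC h -> CC k ->
  cmean p T (fun x => h x + k x)%C = (cmean p T h + cmean p T k)%C.
Proof.
  intros HT [H1 H2] [K1 K2]. unfold cmean, Cplus; simpl. f_equal.
  - exact (cube_avg_plus p T _ _ HT H1 K1).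
  - exact (cube_avg_plus p T _ _ HT H2 K2).
Qed.

Lemma continuous_Rscal {U : UniformSpace} (c : R) (f : U -> R) :
  (forall x, continuous f x) -> forall x, continuous (fun x => c * f x) x.
Proof. intros Hf x. apply (@continuous_mult U R_AbsRing); [apply continuous_const | apply Hf]. Qed.

Lemma cmean_scal (p : nat) (T : R) (c : C) (h : RN -> C) : 0 < T -> CC h ->
  cmean p T (fun x => c * h x)%C = (c * cmean p T h)%C.
Proof.
  intros HT [H1 H2]. unfold cmean, Cmult; simpl. f_equal.
  - transitivity (cube_avg p T (fun x : RN => fst c * fst (h x) + (- snd c) * snd (h x))).
    + f_equal. apply functional_extensionality; intro x. ring.
    + etransitivity; [exact (cube_avg_plus p T (fun x => fst c * fst (h x)) (fun x => - snd c * snd (h x)) HT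
        (continuous_Rscal _ _ H1) (continuous_Rscal _ _ H2))|].
      rewrite (cube_avg_scal p T _ (fun x => fst (h x)) HT H1), (cube_avg_scal p T _ (fun x => snd (h x)) HT H2).
      exact (f_equal (Rplus _) (eq_sym (Ropp_mult_distr_l _ _))).
  - etransitivity; [exact (cube_avg_plus p T (fun x => fst c * snd (h x)) (fun x => snd c * fst (h x)) HT
        (continuous_Rscal _ _ H2) (continuous_Rscal _ _ H1))|].
    rewrite (cube_avg_scal p T _ (fun x => snd (h x)) HT H2), (cube_avg_scal p T _ (fun x => fst (h x)) HT H1). reflexivity.
Qed.

(** Same device as for [Cmod_CInt_le]: multiply by the conjugate of the mean and compare real
    parts. *)
Lemma Cmod_cmean_le (p : nat) (T : R) (h : RN -> C) : 0 < T -> CC h ->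
  Cmod (cmean p T h) <= cube_avg p T (fun x => Cmod (h x)).
Proof.
  intros HT Hh. set (I := cmean p T h).
  assert (Hm := CC_Cmod h Hh).
  assert (P : 0 <= cube_avg p T (fun x => Cmod (h x))).
  { rewrite <- (cube_avg_const p T 0 HT). apply (cube_avg_le p T _ _ HT); [intros; apply continuous_const | exact Hm |].
    intros; apply Cmod_ge_0. }
  destruct (Req_dec (Cmod I) 0) as [H0|H0]; [rewrite H0; exact P|].
  assert (Hp : 0 < Cmod I) by (generalize (Cmod_ge_0 I); lra).
  apply Rmult_le_reg_l with (Cmod I); [exact Hp|].
  rewrite <- fst_conj_mult. unfold I at 2. rewrite <- (cmean_scal p T _ h HT Hh).
  assert (Es : cube_avg p T (fun x => Cmod I * Cmod (h x)) = Cmod I * cube_avg p T (fun x => Cmod (h x)))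
    by exact (cube_avg_scal p T (Cmod I) _ HT Hm).
  rewrite <- Es.
  assert (Hc : CC (fun x => Cconj I * h x)%C) by (apply CC_mult; [apply CC_const | exact Hh]).
  unfold cmean. cbn [fst].
  apply (cube_avg_le p T _ _ HT (proj1 Hc) (continuous_Rscal _ _ Hm)).
  intros x _ _. eapply Rle_trans; [apply Rle_abs|]. eapply Rle_trans; [apply fst_le_Cmod|].
  rewrite Cmod_mult, Cmod_conj. apply Rle_refl.
Qed.

Lemma CInt_cmean_swap (p : nat) (T a b : R) (H : R * RN -> C) : 0 < T -> a <= b -> CC H ->
  CInt (fun t => cmean p T (fun x => H (t, x))) a b = cmean p T (fun x => CInt (fun t => H (t, x)) a b).
Proof.
  intros HT Hab HH. 
  assert (G : forall K : R * RN -> R, (forall w, continuous K w) ->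
    RInt (fun t => cube_avg p T (fun x => K (t, x))) a b = cube_avg p T (fun x => RInt (fun t => K (t, x)) a b)).
  { intros K HK. unfold cube_avg.
    rewrite <- (RInt_cube_int_swap p T a b K ltac:(lra) Hab HK).
    transitivity (RInt (fun t => scal (/ (2 * T) ^ p) (cube_int p T (fun x => K (t, x)))) a b).
    - apply RInt_ext. intros t _. unfold Rdiv. apply Rmult_comm.
    - etransitivity; [apply (RInt_scal (V := R_CompleteNormedModule))|].
      + apply ex_RInt_cont. apply (continuous_cube_int p T K ltac:(lra) HK).
      + unfold Rdiv. apply Rmult_comm. }
  unfold CInt, cmean; cbn [fst snd]. f_equal.
  - apply (G (fun w => fst (H w))), HH.
  - apply (G (fun w => snd (H w))), HH.
Qed.

Lemma CC_cmean_param (p : nat) (T : R) (H : R * RN -> C) : 0 < T -> CC H ->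
  CC (fun t => cmean p T (fun x => H (t, x))).
Proof.
  intros HT [H1 H2].
  assert (G : forall K : R * RN -> R, (forall w, continuous K w) ->
    forall t, continuous (fun t => cube_avg p T (fun x => K (t, x))) t).
  { intros K HK t. unfold cube_avg, Rdiv.
    apply (@continuous_mult R_UniformSpace R_AbsRing); [|apply continuous_const].
    apply (continuous_cube_int p T K ltac:(lra) HK). }
  split; [apply (G (fun w => fst (H w))) | apply (G (fun w => snd (H w)))]; assumption.
Qed.

(** * Means of translates *)

Definition vadd (x y : RN) : RN := fun i => x i + y i.

Lemma continuous_vadd (y x : RN) : continuous (fun x => vadd x y) x.
Proof.
  apply continuous_RN. intros e. exists e. intros v Hv i. unfold vadd.
  replace (v i + y i - (x i + y i)) with (v i - x i) by ring. exact (Hv i).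
Qed.

(** The two cubes have volume ratio [(1 + h/T)^p <= e^{ph/T}]. The exponential form is chosen
    because it can later be merged with the factor [e^{-eta t}] of the kernel. *)
Lemma cube_avg_shift_le (p : nat) (T h : R) (g : RN -> R) (y : RN) : 0 < T -> 0 <= h ->
  (forall x, continuous g x) -> (forall x, 0 <= g x) ->
  (forall i, (i < p)%nat -> Rabs (y i) <= h) -> (forall i, (p <= i)%nat -> y i = 0) ->
  cube_avg p T (fun x => g (vadd x y)) <= exp (INR p * h / T) * cube_avg p (T + h) g.
Proof.
  intros HT Hh Hg Hp Hy Hy0. unfold cube_avg.
  assert (V := cube_vol_pos p T HT). assert (V' := cube_vol_pos p (T + h) ltac:(lra)).
  assert (A := cube_int_shift_le p T h g y ltac:(lra) Hh Hg Hp Hy Hy0).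
  assert (I0 : 0 <= cube_int p (T + h) g).
  { replace 0 with (cube_int p (T + h) (fun _ => 0)) by (rewrite cube_int_const; ring).
    apply cube_int_le; [lra | intros; apply continuous_const | exact Hg | intros; apply Hp]. }
  assert (B : (2 * (T + h)) ^ p <= exp (INR p * h / T) * (2 * T) ^ p).
  { replace (INR p * h / T) with (INR p * (h / T)) by (unfold Rdiv; ring). rewrite <- exp_pow, <- Rpow_mult_distr. apply pow_incr. split; [lra|].
    replace (2 * (T + h)) with ((1 + h / T) * (2 * T)) by (field; lra).
    apply Rmult_le_compat_r; [lra | apply exp_ineq1_le]. }
  apply Rle_trans with (cube_int p (T + h) g / (2 * T) ^ p).
  - apply Rmult_le_compat_r; [apply Rlt_le, Rinv_0_lt_compat, V | exact A].
  - apply Rmult_le_reg_r with ((2 * T) ^ p * (2 * (T + h)) ^ p); [apply Rmult_lt_0_compat; assumption|].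
    replace (cube_int p (T + h) g / (2 * T) ^ p * ((2 * T) ^ p * (2 * (T + h)) ^ p)) with
      (cube_int p (T + h) g * (2 * (T + h)) ^ p) by (field; lra).
    replace (exp (INR p * h / T) * (cube_int p (T + h) g / (2 * (T + h)) ^ p) * ((2 * T) ^ p * (2 * (T + h)) ^ p)) with
      (cube_int p (T + h) g * (exp (INR p * h / T) * (2 * T) ^ p)) by (field; lra).
    apply Rmult_le_compat_l; assumption.
Qed.

Lemma continuous_inner (p : nat) (lam : nat -> R) (x : RN) : continuous (fun x : RN => inner p x lam) x.
Proof.
  unfold inner. induction p; simpl; [apply continuous_const|].
  apply (@continuous_plus RN R_AbsRing R_NormedModule); [exact IHp|].
  apply (@continuous_mult RN R_AbsRing); [apply continuous_coord | apply continuous_const].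
Qed.

Lemma inner_vadd (p : nat) (x y lam : nat -> R) : inner p (vadd x y) lam = inner p x lam + inner p y lam.
Proof. unfold inner, vadd. induction p; simpl; [ring|]. rewrite IHp. ring. Qed.

Definition character (p : nat) (lam x : nat -> R) : C := cis (- inner p x lam).

Lemma CC_character (p : nat) (lam : nat -> R) : CC (fun x : RN => character p lam x).
Proof.
  apply CC_cis. intros x. apply (@continuous_opp RN R_AbsRing R_NormedModule), continuous_inner.
Qed.

Lemma Cmod_character (p : nat) (lam x : nat -> R) : Cmod (character p lam x) = 1.
Proof. apply Cmod_cis. Qed.

Lemma CC_vadd (h : RN -> C) (y : RN) : CC h -> CC (fun x => h (vadd x y)).
Proof. intros Hh. apply (CC_comp h (fun x => vadd x y) Hh). intros; apply continuous_vadd. Qed.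

(** By symmetry of the cube the mean is [cis a] times a real number. The sine component is reduced
    to [cube_int_cos] by shifting the phase by [- PI / 2]. *)
Lemma cmean_cis (p : nat) (T a : R) (nu : nat -> R) : 
  cmean p T (fun x => cis (a + inner p x nu)) = (cis a * RtoC (cos_prod p nu T / (2 * T) ^ p))%C.
Proof.
  unfold cmean, cis, Cmult, cube_avg; simpl. f_equal.
  - rewrite cube_int_cos. unfold Rdiv. ring.
  - assert (S : forall t, sin t = cos (t - PI / 2)).
    { intros t. rewrite cos_minus, cos_PI2, sin_PI2. ring. }
    rewrite (S a), <- (Rplus_0_r (_ * (_ / _))), Rmult_0_r, Rplus_0_r.
    transitivity (cube_int p T (fun x => cos ((a - PI / 2) + inner p x nu)) / (2 * T) ^ p).
    + f_equal. apply cube_int_ext. intros x. rewrite S. f_equal. ring.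
    + rewrite cube_int_cos. unfold Rdiv. ring.
Qed.

Lemma sumn_0 (p : nat) (a : nat -> R) : (forall i, (i < p)%nat -> a i = 0) -> sumn p a = 0.
Proof. intros H. rewrite (sumn_ext p a (fun _ => 0) H), sumn_const. ring. Qed.

(** A shift multiplies the mean by a number of modulus 1. If some [nu j] with [j < p] is nonzero,
    the mean itself is at most [1 / (T |nu j|)]; otherwise the shift has no effect. The threshold
    [T1] precedes [y], and this uniformity is needed because [y] will range over a window growing
    with [T]. *)
Lemma exp_mean_shift (p : nat) (nu : nat -> R) (eps : R) : 0 < eps ->
  exists T1, 0 < T1 /\ forall T, T1 <= T -> forall y : RN,
    Cmod (cmean p T (fun x => cis (inner p (vadd x y) nu)) - cmean p T (fun x => cis (inner p x nu))) <= eps.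
Proof.
  intros He.
  assert (E : forall T (y : RN), 
    Cmod (cmean p T (fun x => cis (inner p (vadd x y) nu)) - cmean p T (fun x => cis (inner p x nu)))
    = Cmod (cis (inner p y nu) - cis 0) * Rabs (cos_prod p nu T / (2 * T) ^ p)).
  { intros T y.
    rewrite (cmean_ext p T (fun x => cis (inner p (vadd x y) nu)) (fun x => cis (inner p y nu + inner p x nu)))
      by (intros; rewrite inner_vadd; f_equal; ring).
    rewrite (cmean_ext p T (fun x => cis (inner p x nu)) (fun x => cis (0 + inner p x nu)))
      by (intros; f_equal; ring).
    rewrite !cmean_cis.
    replace (cis (inner p y nu) * RtoC (cos_prod p nu T / (2 * T) ^ p) - cis 0 * RtoC (cos_prod p nu T / (2 * T) ^ p))%C
      with ((cis (inner p y nu) - cis 0) * RtoC (cos_prod p nu T / (2 * T) ^ p))%C by ring.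
    rewrite Cmod_mult, Cmod_R. reflexivity. }
  destruct (classic (exists j, (j < p)%nat /\ nu j <> 0)) as [[j [Hj Hnu]]|Hno].
  - assert (N := Rabs_pos_lt _ Hnu). exists (2 / (eps * Rabs (nu j))). split.
    { apply Rdiv_lt_0_compat; [lra | apply Rmult_lt_0_compat; assumption]. }
    intros T HT y. rewrite E.
    assert (T0 : 0 < T). { eapply Rlt_le_trans; [|exact HT]. apply Rdiv_lt_0_compat; [lra | apply Rmult_lt_0_compat; assumption]. }
    assert (B := cos_prod_bound p nu T j ltac:(lra) Hj). assert (V := cube_vol_pos p T T0).
    assert (M : Cmod (cis (inner p y nu) - cis 0) <= 2).
    { eapply Rle_trans; [apply Cmod_triangle|]. rewrite Cmod_opp, !Cmod_cis. lra. }
    apply Rle_trans with (2 * Rabs (cos_prod p nu T / (2 * T) ^ p)); [apply Rmult_le_compat_r; [apply Rabs_pos | exact M]|].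
    unfold Rdiv. rewrite Rabs_mult, Rabs_inv, (Rabs_pos_eq ((2 * T) ^ p)) by lra.
    apply Rmult_le_reg_r with ((2 * T) ^ p * (T * Rabs (nu j))).
    { apply Rmult_lt_0_compat; [exact V | apply Rmult_lt_0_compat; assumption]. }
    replace (2 * (Rabs (cos_prod p nu T) * / (2 * T) ^ p) * ((2 * T) ^ p * (T * Rabs (nu j)))) with
      (2 * (Rabs (cos_prod p nu T) * (T * Rabs (nu j)))) by (field; lra).
    apply Rle_trans with (2 * (2 * T) ^ p); [lra|].
    replace (eps * ((2 * T) ^ p * (T * Rabs (nu j)))) with ((T * (eps * Rabs (nu j))) * (2 * T) ^ p) by ring.
    apply Rmult_le_compat_r; [lra|].
    apply Rmult_le_compat_r with (r := eps * Rabs (nu j)) in HT; [|apply Rmult_le_pos; lra].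
    replace (2 / (eps * Rabs (nu j)) * (eps * Rabs (nu j))) with 2 in HT by (field; lra). exact HT.
  - exists 1. split; [lra|]. intros T _ y. rewrite E.
    assert (Z : inner p y nu = 0).
    { apply sumn_0. intros i Hi. destruct (Req_dec (nu i) 0) as [->|N]; [ring|].
      exfalso. apply Hno. exists i. split; assumption. }
    rewrite Z. replace (cis 0 - cis 0)%C with (RtoC 0) by ring. rewrite Cmod_0. lra.
Qed.

Lemma CC_trig_poly (p : nat) (P : list (C * (nat -> R))) : CC (fun x : RN => trig_poly p P x).
Proof.
  unfold trig_poly. induction P as [|[c l] P IH]; simpl; [apply CC_const|].
  apply CC_plus; [|exact IH]. apply CC_mult; [apply CC_const|]. apply CC_cis. intros; apply continuous_inner.
Qed.

Lemma inner_minus_r (p : nat) (x a b : nat -> R) : inner p x (fun i => a i - b i) = inner p x a - inner p x b.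
Proof. unfold inner. induction p; simpl; [ring|]. rewrite IHp. ring. Qed.

Lemma trig_poly_mean_shift (p : nat) (P : list (C * (nat -> R))) (lam : nat -> R) (eps : R) : 0 < eps ->
  exists T1, 0 < T1 /\ forall T, T1 <= T -> forall y : RN,
    Cmod (cmean p T (fun x => trig_poly p P (vadd x y) * character p lam (vadd x y))%C
        - cmean p T (fun x => trig_poly p P x * character p lam x)%C) <= eps.
Proof.
  revert eps. induction P as [|[c l] P IH]; intros eps He.
  - exists 1. split; [lra|]. intros T HT y.
    rewrite (cmean_ext p T _ (fun x => trig_poly p nil x * character p lam x)%C) by (intros; simpl; ring).
    replace (_ - _)%C with (RtoC 0) by ring. rewrite Cmod_0. lra.
  - set (nu := fun i => l i - lam i).
    assert (C0 := Cmod_ge_0 c).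
    destruct (IH (eps / 2) ltac:(lra)) as [T1 [HT1 H1]].
    destruct (exp_mean_shift p nu (eps / (2 * (1 + Cmod c)))) as [T2 [HT2 H2]].
    { apply Rdiv_lt_0_compat; lra. }
    exists (Rmax T1 T2). split; [eapply Rlt_le_trans; [exact HT1 | apply Rmax_l]|].
    intros T HT y.
    specialize (H1 T (Rle_trans _ _ _ (Rmax_l _ _) HT) y). specialize (H2 T (Rle_trans _ _ _ (Rmax_r _ _) HT) y).
    assert (T0 : 0 < T). { eapply Rlt_le_trans; [exact HT1|]. eapply Rle_trans; [apply Rmax_l | exact HT]. }
    assert (Ex : forall x : RN, (trig_poly p ((c, l) :: P) x * character p lam x)%C =
      (c * cis (inner p x nu) + trig_poly p P x * character p lam x)%C).
    { intros x. unfold nu. rewrite inner_minus_r. unfold Rminus. rewrite cis_add. unfold character. simpl. ring. }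
    assert (Cn : CC (fun x : RN => cis (inner p x nu))) by (apply CC_cis; intros; apply continuous_inner).
    assert (CP : CC (fun x : RN => trig_poly p P x * character p lam x)%C) by (apply CC_mult; [apply CC_trig_poly | apply CC_character]).
    rewrite (cmean_ext p T _ (fun x => c * cis (inner p (vadd x y) nu) + trig_poly p P (vadd x y) * character p lam (vadd x y))%C)
      by (intros; apply Ex).
    rewrite (cmean_ext p T (fun x => (trig_poly p ((c, l) :: P) x * character p lam x)%C) _ Ex).
    rewrite (cmean_plus p T (fun x => c * cis (inner p (vadd x y) nu))%C (fun x => trig_poly p P (vadd x y) * character p lam (vadd x y))%C T0).
    2: { apply CC_mult; [apply CC_const | apply (CC_vadd (fun x => cis (inner p x nu)) y Cn)]. }
    2: { apply (CC_vadd (fun x => trig_poly p P x * character p lam x)%C y CP). }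
    rewrite (cmean_plus p T (fun x => c * cis (inner p x nu))%C (fun x => trig_poly p P x * character p lam x)%C T0).
    2: { apply CC_mult; [apply CC_const | exact Cn]. }
    2: exact CP.
    rewrite (cmean_scal p T c _ T0 Cn).
    rewrite (cmean_scal p T c (fun x => cis (inner p (vadd x y) nu)) T0 (CC_vadd (fun x => cis (inner p x nu)) y Cn)).
    match goal with |- Cmod (?c * ?a + ?b - (?c * ?a' + ?b'))%C <= _ =>
      replace (c * a + b - (c * a' + b'))%C with (c * (a - a') + (b - b'))%C by ring end.
    eapply Rle_trans; [apply Cmod_triangle|]. rewrite Cmod_mult.
    match goal with |- Cmod c * ?X + ?Y <= _ => assert (K : Cmod c * X <= (1 + Cmod c) * (eps / (2 * (1 + Cmod c)))) end.
    { apply Rmult_le_compat; [exact C0 | apply Cmod_ge_0 | lra | exact H2]. }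
    replace ((1 + Cmod c) * (eps / (2 * (1 + Cmod c)))) with (eps / 2) in K by (field; lra). lra.
Qed.

(** The polynomial part contributes [eps], the remainder over the cube of side [2T] another [eps],
    and the shifted remainder [eps e^{ph/T}]. The approximation holds for every size from [T0] on,
    in particular for [T + h], so the threshold does not depend on [h] or [y]. *)
Lemma ap_mean_shift (p : nat) (f : RN -> C) (lam : nat -> R) : CC f -> B_almost_periodic p f ->
  forall eps, 0 < eps -> exists T1, 0 < T1 /\ forall T h, T1 <= T -> 0 <= h -> forall y : RN,
    (forall i, (i < p)%nat -> Rabs (y i) <= h) -> (forall i, (p <= i)%nat -> y i = 0) ->
    Cmod (cmean p T (fun x => f (vadd x y) * character p lam (vadd x y))%C
        - cmean p T (fun x => f x * character p lam x)%C) <= 3 * eps * exp (INR p * h / T).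
Proof.
  intros Hf Hap eps He. destruct (Hap eps He) as [P [T0 HP]].
  destruct (trig_poly_mean_shift p P lam eps He) as [T1 [HT1 H1]].
  exists (Rmax T0 T1). split; [eapply Rlt_le_trans; [exact HT1 | apply Rmax_r]|].
  intros T h HT Hh y Hy Hy0.
  assert (HT0 : T0 <= T) by (eapply Rle_trans; [apply Rmax_l | exact HT]).
  specialize (H1 T (Rle_trans _ _ _ (Rmax_r _ _) HT) y).
  assert (Tp : 0 < T). { eapply Rlt_le_trans; [exact HT1|]. eapply Rle_trans; [apply Rmax_r | exact HT]. }
  set (q := fun x : RN => (trig_poly p P x * character p lam x)%C) in *.
  set (r := fun x : RN => ((f x - trig_poly p P x) * character p lam x)%C).
  assert (Cq : CC q) by (apply CC_mult; [apply CC_trig_poly | apply CC_character]).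
  assert (Cfp : CC (fun x : RN => f x - trig_poly p P x)%C) by (apply CC_minus; [exact Hf | apply CC_trig_poly]).
  assert (Cr : CC r) by (apply CC_mult; [exact Cfp | apply CC_character]).
  assert (Mr : forall x, Cmod (r x) = Cmod (f x - trig_poly p P x)).
  { intros x. unfold r. rewrite Cmod_mult, Cmod_character. ring. }
  assert (Em : forall S, cube_avg p S (fun x => Cmod (r x)) = cube_avg p S (fun x => Cmod (f x - trig_poly p P x))).
  { intros S. f_equal. apply functional_extensionality; exact Mr. }
  assert (X : 1 <= exp (INR p * h / T)).
  { assert (0 <= INR p * h / T) by (apply Rdiv_le_0_compat; [apply Rmult_le_pos; [apply pos_INR | exact Hh] | exact Tp]).
    generalize (exp_ineq1_le (INR p * h / T)). lra. }
  rewrite (cmean_ext p T (fun x => (f (vadd x y) * character p lam (vadd x y))%C) (fun x => q (vadd x y) + r (vadd x y))%C)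
    by (intros; unfold q, r; ring).
  rewrite (cmean_ext p T (fun x => (f x * character p lam x)%C) (fun x => q x + r x)%C)
    by (intros; unfold q, r; ring).
  rewrite (cmean_plus p T q r Tp Cq Cr).
  rewrite (cmean_plus p T (fun x => q (vadd x y)) (fun x => r (vadd x y)) Tp (CC_vadd q y Cq) (CC_vadd r y Cr)).
  assert (B1 : Cmod (cmean p T r) <= eps).
  { eapply Rle_trans; [apply (Cmod_cmean_le p T r Tp Cr)|]. rewrite Em. apply HP, HT0. }
  assert (B2 : Cmod (cmean p T (fun x => r (vadd x y))) <= exp (INR p * h / T) * eps).
  { eapply Rle_trans; [apply (Cmod_cmean_le p T _ Tp (CC_vadd r y Cr))|].
    eapply Rle_trans; [apply (cube_avg_shift_le p T h (fun x => Cmod (r x)) y Tp Hh (CC_Cmod r Cr)); [intros; apply Cmod_ge_0 | exact Hy | exact Hy0]|].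
    apply Rmult_le_compat_l; [lra|]. rewrite Em. apply HP. lra. }
  change (Cmod (cmean p T (fun x => q (vadd x y)) - cmean p T q) <= eps) in H1.
  replace (cmean p T (fun x => q (vadd x y)) + cmean p T (fun x => r (vadd x y)) - (cmean p T q + cmean p T r))%C with
    ((cmean p T (fun x => q (vadd x y)) - cmean p T q) + (cmean p T (fun x => r (vadd x y)) + - cmean p T r))%C by ring.
  eapply Rle_trans; [apply Cmod_triangle|].
  assert (B3 := Cmod_triangle (cmean p T (fun x => r (vadd x y))) (- cmean p T r)). rewrite Cmod_opp in B3.
  assert (B4 : 1 * eps <= exp (INR p * h / T) * eps) by (apply Rmult_le_compat_r; lra). lra.
Qed.

(** * Rotation of the ray of integration *)

Lemma cderiv_pow (n : nat) : exists d, forall s, cderiv (fun s => s ^ n)%C s (d s).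
Proof.
  induction n as [|n [d Hd]].
  - exists (fun _ => RtoC 0). intros s. apply (cderiv_const (RtoC 1)).
  - exists (fun s => RtoC 1 * s ^ n + (RtoC 0 + s * RtoC 1) * d s)%C. intros s.
    replace (fun s => s ^ S n)%C with (fun s => (RtoC 0 + s * RtoC 1) * s ^ n)%C.
    + apply (cderiv_mult (fun s => RtoC 0 + s * RtoC 1)%C (fun s => s ^ n)%C); [apply cderiv_affine | apply Hd].
    + apply functional_extensionality; intro q. rewrite Cpow_S. ring.
Qed.

Lemma cderiv_exp_quadratic (b c : C) :
  exists d, forall s, cderiv (fun s => cexp (s * b + s * s * c))%C s (d s).
Proof.
  eexists. intros s.
  replace (fun s => cexp (s * b + s * s * c))%C with
    (fun s => cexp ((RtoC 0 + s * b) + (RtoC 0 + s * c) * (RtoC 0 + s * RtoC 1)))%C.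
  - apply (cderiv_comp cexp (fun s => (RtoC 0 + s * b) + (RtoC 0 + s * c) * (RtoC 0 + s * RtoC 1))%C); [|apply cderiv_cexp].
    apply (cderiv_plus (fun s => RtoC 0 + s * b)%C (fun s => (RtoC 0 + s * c) * (RtoC 0 + s * RtoC 1))%C); [apply cderiv_affine|].
    apply (cderiv_mult (fun s => RtoC 0 + s * c)%C (fun s => RtoC 0 + s * RtoC 1)%C); apply cderiv_affine.
  - apply functional_extensionality; intro q. f_equal. ring.
Qed.

Lemma CC_on_ray (g : C -> C) (z : C) : ccont g -> CC (fun t : R => g (RtoC t * z)%C).
Proof.
  intros Hg. generalize (CC_on_line g (RtoC 0) z Hg). intros H.
  replace (fun t : R => g (RtoC t * z)%C) with (fun t : R => g (RtoC 0 + RtoC t * z)%C); [exact H|].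
  apply functional_extensionality; intro t. f_equal. ring.
Qed.

Lemma seg_int_ray (g : C -> C) (r : R) (z : C) : ccont g ->
  seg_int g (RtoC 0) (RtoC r * z)%C = (z * CInt (fun t : R => g (RtoC t * z)%C) 0 r)%C.
Proof.
  intros Hg. unfold seg_int.
  assert (Hf : CC (fun t : R => g (RtoC t * z)%C)).
  { apply CC_on_ray, Hg. }
  assert (E := CInt_comp_lin (fun t : R => g (RtoC t * z)%C) r 0 0 1 Hf).
  replace (r * 0 + 0) with 0 in E by ring. replace (r * 1 + 0) with r in E by ring.
  rewrite E.
  rewrite (CInt_ext (fun t : R => g (RtoC 0 + RtoC t * (RtoC r * z - RtoC 0))%C) (fun t : R => g (RtoC (r * t + 0) * z)%C)).
  - ring.
  - intros t. f_equal. rewrite RtoC_plus, RtoC_mult. ring.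
Qed.

(** Cauchy's theorem on the triangle [0], [r], [r z]. Closing by a chord instead of an arc keeps the
    contour a triangle, for which [goursat] suffices. *)
Lemma rotate_ray (g g' : C -> C) (r : R) (z : C) : (forall w, cderiv g w (g' w)) -> 0 <= r -> Cmod z = 1 ->
  Cmod (CInt (fun t : R => g (RtoC t)) 0 r) <=
  RInt (fun t => Cmod (g (RtoC t * z)%C)) 0 r + Cmod (seg_int g (RtoC r) (RtoC r * z)).
Proof.
  intros Hg' Hr Hz. assert (Hg := cderiv_ccont _ _ Hg').
  assert (E := goursat g g' Hg' (RtoC 0) (RtoC r) (RtoC r * z)%C). unfold tri_int in E.
  rewrite (seg_int_rev g (RtoC 0)), (seg_int_ray g r z Hg) in E by exact Hg.
  assert (E1 := seg_int_ray g r (RtoC 1) Hg).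
  replace (RtoC r * RtoC 1)%C with (RtoC r) in E1 by ring. rewrite E1 in E.
  rewrite (CInt_ext (fun t : R => g (RtoC t * RtoC 1)%C) (fun t : R => g (RtoC t))) in E
    by (intros; f_equal; ring).
  set (X := CInt (fun t : R => g (RtoC t)) 0 r) in *. set (Y := CInt (fun t : R => g (RtoC t * z)%C) 0 r) in *.
  set (Z := seg_int g (RtoC r) (RtoC r * z)%C) in *.
  replace X with (z * Y + - Z)%C.
  2: { transitivity (X - (RtoC 1 * X + Z + - (z * Y)))%C; [ring | rewrite E; ring]. }
  eapply Rle_trans; [apply Cmod_triangle|]. rewrite Cmod_opp, Cmod_mult, Hz, Rmult_1_l.
  apply Rplus_le_compat_r. apply Cmod_CInt_le; [exact Hr|].
  apply CC_on_ray, Hg.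
Qed.

(** In the cross terms each [b i] is at most the Euclidean norm of [b], which leaves the sum of the
    [a i]. The mixed norms suit the application: the direction needs its exact Euclidean norm, since
    the threshold [sigma] is sharp, while the crude bound [p T] is affordable for the base point. *)
Lemma sqrt_sumn_sqr_le (p : nat) (a b : nat -> R) :
  (forall i, (i < p)%nat -> 0 <= a i) -> (forall i, (i < p)%nat -> 0 <= b i) ->
  sqrt (sumn p (fun i => (a i + b i) ^ 2)) <= sumn p a + sqrt (sumn p (fun i => b i ^ 2)).
Proof.
  intros Ha Hb. set (B := sqrt (sumn p (fun i => b i ^ 2))).
  assert (HB : 0 <= B) by apply sqrt_pos.
  assert (HA := sumn_ge_0 p a Ha).
  assert (HS : 0 <= sumn p (fun i => b i ^ 2)) by (apply sumn_ge_0; intros; apply pow2_ge_0).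
  assert (HBB : B * B = sumn p (fun i => b i ^ 2)) by (apply sqrt_sqrt, HS).
  assert (HbB : forall m, (m <= p)%nat -> forall i, (i < m)%nat -> b i ^ 2 <= sumn m (fun i => b i ^ 2)).
  { induction m; intros Hm i Hi; [lia|].
    change (b i ^ 2 <= sumn m (fun i => b i ^ 2) + b m ^ 2).
    assert (P := sumn_ge_0 m (fun i => b i ^ 2) (fun i _ => pow2_ge_0 (b i))).
    destruct (Nat.eq_dec i m) as [->|N]; [lra|].
    generalize (IHm ltac:(lia) i ltac:(lia)) (pow2_ge_0 (b m)). lra. }
  assert (Hle : forall i, (i < p)%nat -> b i <= B).
  { intros i Hi. rewrite <- (sqrt_pow2 (b i)) by (apply Hb, Hi). apply sqrt_le_1_alt, (HbB p); auto. }
  assert (K : forall m, (m <= p)%nat -> sumn m (fun i => (a i + b i) ^ 2) <=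
     (sumn m a) ^ 2 + 2 * sumn m a * B + sumn m (fun i => b i ^ 2)).
  { induction m; intros Hm; [simpl; lra|].
    change (sumn m (fun i => (a i + b i) ^ 2) + (a m + b m) ^ 2 <=
      (sumn m a + a m) ^ 2 + 2 * (sumn m a + a m) * B + (sumn m (fun i => b i ^ 2) + b m ^ 2)).
    assert (I := IHm ltac:(lia)). assert (am := Ha m ltac:(lia)).
    assert (P1 := Rmult_le_compat_l _ _ _ am (Hle m ltac:(lia))).
    assert (P2 := Rmult_le_pos _ _ (sumn_ge_0 m a (fun i Hi => Ha i ltac:(lia))) am). nra. }
  rewrite <- (sqrt_pow2 (sumn p a + B)) by lra.
  apply sqrt_le_1_alt. eapply Rle_trans; [apply (K p); lia|]. rewrite <- HBB. apply Req_le; ring.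
Qed.

Definition cline (x u : nat -> R) (s : C) : nat -> C := fun i => (RtoC (x i) + s * RtoC (u i))%C.

Lemma cnorm_cline (p : nat) (x u : nat -> R) (s : C) : rnorm p u = 1 ->
  cnorm p (cline x u s) <= sumn p (fun i => Rabs (x i)) + Cmod s.
Proof.
  intros Hu. unfold cnorm.
  apply Rle_trans with (sqrt (sumn p (fun i => (Rabs (x i) + Cmod s * Rabs (u i)) ^ 2))).
  - apply sqrt_le_1_alt, sumn_le. intros i _. apply pow_incr. split; [apply Cmod_ge_0|].
    unfold cline. eapply Rle_trans; [apply Cmod_triangle|]. rewrite Cmod_mult, !Cmod_R. apply Rle_refl.
  - eapply Rle_trans; [apply (sqrt_sumn_sqr_le p (fun i => Rabs (x i)) (fun i => Cmod s * Rabs (u i)))|].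
    + intros; apply Rabs_pos.
    + intros; apply Rmult_le_pos; [apply Cmod_ge_0 | apply Rabs_pos].
    + apply Rplus_le_compat_l.
      assert (E : forall q, sumn q (fun i => (Cmod s * Rabs (u i)) ^ 2) = Cmod s ^ 2 * sumn q (fun i => u i ^ 2)).
      { induction q; [simpl; ring|].
        change (sumn q (fun i => (Cmod s * Rabs (u i)) ^ 2) + (Cmod s * Rabs (u q)) ^ 2 = Cmod s ^ 2 * (sumn q (fun i => u i ^ 2) + u q ^ 2)).
        rewrite IHq, Rpow_mult_distr, pow2_abs. ring. }
      rewrite E, sqrt_mult_alt, sqrt_pow2 by (apply Cmod_ge_0 || apply pow2_ge_0).
      change (Cmod s * rnorm p u <= Cmod s). rewrite Hu. lra.
Qed.

Lemma exp_le_compat (a b : R) : a <= b -> exp a <= exp b.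
Proof. intros [H|H]; [left; apply exp_increasing, H | right; f_equal; exact H]. Qed.

Section RayEstimate.
Variables (p : nat) (F : (nat -> C) -> C) (sigma C0 : R) (u : nat -> R).
Hypothesis HF : entire p F.
Hypothesis Hsigma : 0 < sigma.
Hypothesis HC0 : 0 < C0.
Hypothesis Hgrowth : forall z : nat -> C, Cmod (F z) <= C0 * exp (sigma * cnorm p z).
Hypothesis Hu : rnorm p u = 1.
Variables (L ca sa eta delta : R) (n : nat).
Hypothesis HL : 0 < L.
Hypothesis Hca : 0 < ca.
Hypothesis Hcs : ca * ca + sa * sa = 1.
Hypothesis HLs : sigma < L * sa.
Hypothesis Heta : 0 < eta.
Hypothesis Hdelta : 0 < delta.

(* With [ca + i sa = e^{i alpha}], the exponent is [- (eta + i L) s - delta e^{i alpha} s^2]. *)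
Definition ray_fun (x : nat -> R) (s : C) : C :=
  (F (cline x u s) * (s ^ n * cexp (s * Cpair (- eta) (- L) + s * s * Cpair (- (delta * ca)) (- (delta * sa)))))%C.

Lemma ray_fun_le (x : nat -> R) (s : C) S : sumn p (fun i => Rabs (x i)) <= S ->
  Cmod (ray_fun x s) <= C0 * exp (sigma * S) * (Cmod s ^ n * exp (sigma * Cmod s +
     (L * snd s - eta * fst s - delta * (ca * (fst s * fst s - snd s * snd s) - 2 * sa * fst s * snd s)))).
Proof.
  intros HS. unfold ray_fun. rewrite !Cmod_mult, Cmod_cexp, Cmod_pow, exp_plus.
  replace (fst (s * Cpair (- eta) (- L) + s * s * Cpair (- (delta * ca)) (- (delta * sa)))%C) with
    (L * snd s - eta * fst s - delta * (ca * (fst s * fst s - snd s * snd s) - 2 * sa * fst s * snd s))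
    by (simpl; ring).
  set (Q := exp (L * snd s - _ - _)).
  assert (P : 0 <= Cmod s ^ n * Q) by (apply Rmult_le_pos; [apply pow_le, Cmod_ge_0 | apply Rlt_le, exp_pos]).
  replace (C0 * exp (sigma * S) * (Cmod s ^ n * (exp (sigma * Cmod s) * Q))) with
    (C0 * (exp (sigma * S) * exp (sigma * Cmod s)) * (Cmod s ^ n * Q)) by ring.
  apply Rmult_le_compat_r; [exact P|]. eapply Rle_trans; [apply Hgrowth|].
  apply Rmult_le_compat_l; [lra|]. rewrite <- exp_plus, <- Rmult_plus_distr_l.
  apply exp_le_compat, Rmult_le_compat_l; [lra|].
  generalize (cnorm_cline p x u s Hu). lra.
Qed.

Lemma ray_fun_holo (x : nat -> R) : exists d, forall s, cderiv (ray_fun x) s (d s).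
Proof.
  destruct (entire_line p F HF (fun i => RtoC (x i)) (fun i => RtoC (u i))) as [d1 H1].
  destruct (cderiv_pow n) as [d2 H2].
  destruct (cderiv_exp_quadratic (Cpair (- eta) (- L)) (Cpair (- (delta * ca)) (- (delta * sa)))) as [d3 H3].
  eexists. intros s.
  apply (cderiv_mult (fun s => F (cline x u s))
    (fun s => s ^ n * cexp (s * Cpair (- eta) (- L) + s * s * Cpair (- (delta * ca)) (- (delta * sa))))%C); [apply H1|].
  apply (cderiv_mult (fun s => s ^ n)%C); [apply H2 | apply H3].
Qed.

Lemma ray_fun_on_ray (x : nat -> R) (t S : R) : 0 <= t -> sumn p (fun i => Rabs (x i)) <= S ->
  Cmod (ray_fun x (RtoC t * Cpair ca (- sa))) <= C0 * exp (sigma * S) * (t ^ n * exp (- ((L * sa - sigma) * t))).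
Proof.
  intros Ht HS. eapply Rle_trans; [apply (ray_fun_le x _ S HS)|].
  assert (Hm : Cmod (RtoC t * Cpair ca (- sa)) = t).
  { rewrite Cmod_mult, Cmod_R, Rabs_pos_eq by exact Ht.
    unfold Cmod, Cpair; simpl. replace (ca * (ca * 1) + - sa * (- sa * 1)) with 1 by lra. rewrite sqrt_1. ring. }
  rewrite Hm.
  apply Rmult_le_compat_l; [apply Rmult_le_pos; [lra | apply Rlt_le, exp_pos]|].
  apply Rmult_le_compat_l; [apply pow_le, Ht|]. apply exp_le_compat. simpl.
  assert (T2 : 0 <= t * t) by (apply Rmult_le_pos; exact Ht).
  assert (K1 : 0 <= eta * (t * ca)) by (apply Rmult_le_pos; [lra | apply Rmult_le_pos; lra]).
  assert (K2 : 0 <= delta * (ca * (t * t))) by (apply Rmult_le_pos; [lra | apply Rmult_le_pos; lra]).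
  (* At [s = t e^{-i alpha}] one has [e^{i alpha} s^2 = t^2 e^{-i alpha}], with real part
     [ca t^2 >= 0]; the Gaussian and the [eta] term can only help here. *)
  replace (ca * ((t * ca - 0 * - sa) * (t * ca - 0 * - sa) - (t * - sa + 0 * ca) * (t * - sa + 0 * ca)) -
     2 * sa * (t * ca - 0 * - sa) * (t * - sa + 0 * ca)) with (ca * (t * t) * (ca * ca + sa * sa)) by ring.
  rewrite Hcs. lra.
Qed.

(* On the chord from [r] to [r e^{-i alpha}] the real part of [e^{i alpha} s^2] is at least
   [ca r^2], so the Gaussian factor beats the exponential growth. *)
Lemma ray_fun_on_segment (x : nat -> R) (r tau S : R) : 0 <= r -> 0 <= tau <= 1 -> sumn p (fun i => Rabs (x i)) <= S ->
  Cmod (ray_fun x (RtoC r + RtoC tau * (RtoC r * Cpair ca (- sa) - RtoC r))) <=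
  C0 * exp (sigma * S) * (r ^ n * exp ((sigma + L) * r - delta * ca * (r * r))).
Proof.
  intros Hr Ht HS. eapply Rle_trans; [apply (ray_fun_le x _ S HS)|].
  set (s := (RtoC r + RtoC tau * (RtoC r * Cpair ca (- sa) - RtoC r))%C).
  assert (Hz1 : Cmod (Cpair ca (- sa)) = 1).
  { unfold Cmod, Cpair; simpl. replace (ca * (ca * 1) + - sa * (- sa * 1)) with 1 by lra. apply sqrt_1. }
  assert (Hm : Cmod s <= r).
  { replace s with (RtoC ((1 - tau) * r) + RtoC (tau * r) * Cpair ca (- sa))%C.
    2: { unfold s. rewrite !RtoC_mult, RtoC_minus. ring. }
    eapply Rle_trans; [apply Cmod_triangle|]. rewrite Cmod_mult, !Cmod_R, Hz1.
    rewrite !Rabs_pos_eq by (apply Rmult_le_pos; lra). lra. }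
  assert (Hs2 : snd s <= r) by (eapply Rle_trans; [apply Rle_abs|]; eapply Rle_trans; [apply snd_le_Cmod | exact Hm]).
  apply Rmult_le_compat_l; [apply Rmult_le_pos; [lra | apply Rlt_le, exp_pos]|].
  apply Rmult_le_compat; [apply pow_le, Cmod_ge_0 | apply Rlt_le, exp_pos | apply pow_incr; split; [apply Cmod_ge_0 | exact Hm] |].
  apply exp_le_compat.
  assert (E1 : fst s = r * ((1 - tau) + tau * ca)) by (unfold s; simpl; ring).
  assert (E2 : snd s = - (r * (tau * sa))) by (unfold s; simpl; ring).
  assert (P1 : 0 <= fst s).
  { rewrite E1. apply Rmult_le_pos; [exact Hr|]. assert (0 <= tau * ca) by (apply Rmult_le_pos; lra). lra. }
  assert (Hca1 : ca <= 1) by nra.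
  (* Since [s = r ((1 - tau) + tau e^{-i alpha})], the real part of [e^{i alpha} s^2] is [r^2 (ca
     ((1 - tau)^2 + tau^2) + 2 tau (1 - tau))]; rewriting it as [r^2 ca] plus a nonnegative term
     gives the lower bound. *)
  assert (E3 : ca * (fst s * fst s - snd s * snd s) - 2 * sa * fst s * snd s =
    r * r * ca + r * r * (2 * tau * (1 - tau) * (1 - ca)) + 0).
  { rewrite E1, E2. replace (r * r * ca + r * r * (2 * tau * (1 - tau) * (1 - ca)) + 0) with
      (r * r * (ca * ((1 - tau) * (1 - tau) + tau * tau * (ca * ca + sa * sa)) + 2 * tau * (1 - tau) * (ca * ca + sa * sa)))
      by (rewrite Hcs; ring). ring. }
  assert (P2 : 0 <= r * r * (2 * tau * (1 - tau) * (1 - ca))).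
  { apply Rmult_le_pos; [apply Rmult_le_pos; exact Hr|]. apply Rmult_le_pos; [|lra]. apply Rmult_le_pos; lra. }
  rewrite E3.
  assert (P3 : 0 <= eta * fst s) by (apply Rmult_le_pos; lra).
  assert (P4 : sigma * Cmod s <= sigma * r) by (apply Rmult_le_compat_l; lra).
  assert (P5 : L * snd s <= L * r) by (apply Rmult_le_compat_l; lra).
  assert (P6 : 0 <= delta * (r * r * (2 * tau * (1 - tau) * (1 - ca)))) by (apply Rmult_le_pos; lra).
  lra.
Qed.

(** The rotated ray gives the Gamma term and the chord the error [eps]. [R0] precedes [x], so one
    cut-off serves every base point of the cube. *)
Lemma ray_estimate (S eps : R) : 0 < eps -> exists R0, 0 <= R0 /\ forall r, R0 <= r ->
  forall x, sumn p (fun i => Rabs (x i)) <= S ->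
  Cmod (CInt (fun t : R => ray_fun x (RtoC t)) 0 r) <= C0 * exp (sigma * S) * gamma_val n (L * sa - sigma) + eps.
Proof.
  intros He. set (K := C0 * exp (sigma * S)).
  assert (HK : 0 < K) by (apply Rmult_lt_0_compat; [exact HC0 | apply exp_pos]).
  (* The exponent is [n + 1] because the chord, of length at most [2r], adds one power of [r]. *)
  destruct (pow_exp_decay (Datatypes.S n) 1 (eps / (2 * K)) Rlt_0_1) as [R1 H1].
  { apply Rdiv_lt_0_compat; lra. }
  assert (Hdc : 0 < delta * ca) by (apply Rmult_lt_0_compat; assumption).
  (* For [r >= R2] the Gaussian exponent [delta ca r^2] exceeds [(sigma + L) r] by at least [r]. *)
  set (R2 := (sigma + L + 1) / (delta * ca)).
  exists (Rmax 0 (Rmax R1 R2)). split; [apply Rmax_l|]. intros r Hr x Hx.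
  assert (r0 : 0 <= r) by (eapply Rle_trans; [apply Rmax_l | exact Hr]).
  assert (r1 : R1 <= r) by (eapply Rle_trans; [|exact Hr]; eapply Rle_trans; [apply Rmax_l | apply Rmax_r]).
  assert (r2 : R2 <= r) by (eapply Rle_trans; [|exact Hr]; eapply Rle_trans; [apply Rmax_r | apply Rmax_r]).
  destruct (ray_fun_holo x) as [d Hd]. assert (Hc := cderiv_ccont _ _ Hd).
  assert (Hz1 : Cmod (Cpair ca (- sa)) = 1).
  { unfold Cmod, Cpair; simpl. replace (ca * (ca * 1) + - sa * (- sa * 1)) with 1 by lra. apply sqrt_1. }
  eapply Rle_trans; [apply (rotate_ray _ d r (Cpair ca (- sa)) Hd r0 Hz1)|].
  apply Rplus_le_compat.
  - apply Rle_trans with (RInt (fun t => scal K (t ^ n * exp (- ((L * sa - sigma) * t)))) 0 r).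
    + apply RInt_le; [exact r0 | | |].
      * apply ex_RInt_cont, CC_Cmod.
        apply (CC_on_ray (ray_fun x)), Hc.
      * apply (ex_RInt_scal (V := R_NormedModule)), ex_RInt_cont, continuous_gamma.
      * intros t Ht. apply (ray_fun_on_ray x t S); [lra | exact Hx].
    + rewrite (RInt_scal (V := R_CompleteNormedModule)) by (apply ex_RInt_cont, continuous_gamma).
      apply (Rmult_le_compat_l K); [lra|]. apply gamma_int_le; lra.
  - eapply Rle_trans.
    { apply Cmod_seg_int_le with (M := K * (r ^ n * exp (- r))); [exact Hc|].
      intros t Ht. eapply Rle_trans; [apply (ray_fun_on_segment x r t S r0 Ht Hx)|].
      apply Rmult_le_compat_l; [lra|]. apply Rmult_le_compat_l; [apply pow_le, r0|]. apply exp_le_compat.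
      apply Rmult_le_compat_r with (r := delta * ca) in r2; [|lra].
      unfold R2 in r2. replace ((sigma + L + 1) / (delta * ca) * (delta * ca)) with (sigma + L + 1) in r2 by (field; lra).
      apply Rmult_le_compat_r with (r := r) in r2; [|exact r0]. lra. }
    assert (Hl : Cmod (RtoC r * Cpair ca (- sa) - RtoC r) <= 2 * r).
    { eapply Rle_trans; [apply Cmod_triangle|]. rewrite Cmod_opp, Cmod_mult, Hz1, Cmod_R, Rabs_pos_eq by exact r0. lra. }
    specialize (H1 r r1). rewrite Rmult_1_l in H1.
    apply Rle_trans with (2 * r * (K * (r ^ n * exp (- r)))).
    + apply Rmult_le_compat_r; [|exact Hl]. apply Rmult_le_pos; [lra|].
      apply Rmult_le_pos; [apply pow_le, r0 | apply Rlt_le, exp_pos].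
    + replace (2 * r * (K * (r ^ n * exp (- r)))) with (2 * K * (r ^ Datatypes.S n * exp (- r))) by (simpl; ring).
      apply Rle_trans with (2 * K * (eps / (2 * K))); [apply Rmult_le_compat_l; lra|]. apply Req_le; field; lra.
Qed.

End RayEstimate.

(** * Gamma-type kernels and the final estimate *)

(** Mean value inequality on the segment from [0] to [z], which stays in the left half-plane, where
    the derivative has modulus at most 1. *)
Lemma cexp_minus_1_le (z : C) : fst z <= 0 -> Cmod (cexp z - RtoC 1) <= Cmod z.
Proof.
  intros Hz.
  assert (E0 : cexp (RtoC 0) = RtoC 1).
  { unfold cexp; simpl. rewrite exp_0, cis_0. ring. }
  assert (A := cderiv_mean_value cexp cexp (RtoC 0) z (RtoC 0) 1 cderiv_cexp).
  rewrite E0 in A. replace (RtoC 0 + z)%C with z in A by ring.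
  replace (cexp z - 1 - 0 * z)%C with (cexp z - RtoC 1)%C in A by ring.
  rewrite Rmult_1_l in A. apply A. intros t Ht.
  replace (cexp (0 + t * z) - 0)%C with (cexp (0 + t * z)) by ring.
  rewrite Cmod_cexp. simpl. rewrite <- exp_0. apply exp_le_compat.
  assert (0 <= t * - fst z) by (apply Rmult_le_pos; lra). lra.
Qed.

Definition kernel (n : nat) (eta : R) (e : C) (t : R) : C :=
  (RtoC (t ^ n * exp (- (eta * t))) * cexp (RtoC (- (t * t)) * e))%C.

Lemma CC_kernel (n : nat) (eta : R) (e : C) : CC (kernel n eta e).
Proof.
  unfold kernel. apply CC_mult; [apply CC_RtoC, continuous_gamma|].
  apply (CC_ccont cexp (fun t : R => (RtoC (- (t * t)) * e)%C)); [exact ccont_cexp|].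
  apply CC_mult; [|apply CC_const]. apply CC_RtoC. intros t.
  apply (ex_derive_continuous (K := R_AbsRing) (V := R_NormedModule)). auto_derive; exact I.
Qed.

Lemma kernel_arg_re (e : C) (t : R) : 0 <= fst e -> fst (RtoC (- (t * t)) * e)%C <= 0.
Proof.
  intros He. simpl. assert (0 <= t * t * fst e) by (apply Rmult_le_pos; [nra | exact He]). lra.
Qed.

Lemma Cmod_kernel_le (n : nat) (eta : R) (e : C) (t : R) : 0 <= fst e -> 0 <= t ->
  Cmod (kernel n eta e t) <= t ^ n * exp (- (eta * t)).
Proof.
  intros He Ht. unfold kernel. rewrite Cmod_mult, Cmod_R, Cmod_cexp.
  assert (P : 0 <= t ^ n * exp (- (eta * t))) by (apply Rmult_le_pos; [apply pow_le, Ht | apply Rlt_le, exp_pos]).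
  rewrite Rabs_pos_eq by exact P. rewrite <- (Rmult_1_r (t ^ n * _)) at 2.
  apply Rmult_le_compat_l; [exact P|]. rewrite <- exp_0. apply exp_le_compat, kernel_arg_re, He.
Qed.

Lemma CInt_RtoC (f : R -> R) a b : CInt (fun t => RtoC (f t)) a b = RtoC (RInt f a b).
Proof.
  unfold CInt, RtoC; simpl. f_equal. rewrite RInt_const. apply Rmult_0_r.
Qed.

(** By [cexp_minus_1_le] the Gaussian factor differs from 1 by at most [t^2 |e|], so the loss of
    mass is [|e|] times a Gamma integral of order [n + 2]. *)
Lemma kernel_mass (n : nat) (eta : R) (e : C) (r : R) : 0 <= fst e -> 0 <= r ->
  gamma_int n eta r - Cmod e * gamma_int (S (S n)) eta r <= Cmod (CInt (kernel n eta e) 0 r).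
Proof.
  intros He Hr. set (g := fun t => t ^ n * exp (- (eta * t))).
  assert (Hg : CC (fun t : R => RtoC (g t))) by (apply CC_RtoC, continuous_gamma).
  assert (Hk := CC_kernel n eta e).
  assert (E := CInt_minus (kernel n eta e) (fun t => RtoC (g t)) 0 r Hk Hg).
  rewrite CInt_RtoC in E. change (RInt g 0 r) with (gamma_int n eta r) in E.
  assert (B : Cmod (CInt (fun t => kernel n eta e t - RtoC (g t))%C 0 r) <= Cmod e * gamma_int (S (S n)) eta r).
  { eapply Rle_trans; [apply Cmod_CInt_le; [exact Hr | apply CC_minus; assumption]|].
    apply Rle_trans with (RInt (fun t => scal (Cmod e) (t ^ S (S n) * exp (- (eta * t)))) 0 r).
    - apply RInt_le; [exact Hr | apply ex_RInt_cont, CC_Cmod, CC_minus; assumption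
        | apply (ex_RInt_scal (V := R_NormedModule)), ex_RInt_cont, continuous_gamma |].
      intros t Ht. unfold kernel. fold (g t).
      replace (RtoC (g t) * cexp (RtoC (- (t * t)) * e) - RtoC (g t))%C with
        (RtoC (g t) * (cexp (RtoC (- (t * t)) * e) - RtoC 1))%C by ring.
      rewrite Cmod_mult, Cmod_R.
      assert (P : 0 <= g t) by (apply Rmult_le_pos; [apply pow_le; lra | apply Rlt_le, exp_pos]).
      rewrite Rabs_pos_eq by exact P.
      apply Rle_trans with (g t * (t * t * Cmod e)).
      + apply Rmult_le_compat_l; [exact P|]. eapply Rle_trans; [apply cexp_minus_1_le, kernel_arg_re, He|].
        rewrite Cmod_mult, Cmod_R, Rabs_Ropp, Rabs_pos_eq by nra. lra.
      + apply Req_le. unfold g. change (t ^ n * exp (- (eta * t)) * (t * t * Cmod e) = Cmod e * (t * (t * t ^ n) * exp (- (eta * t)))). ring.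
    - apply Req_le. apply (RInt_scal (V := R_CompleteNormedModule)), ex_RInt_cont, continuous_gamma. }
  rewrite E in B.
  assert (T := Cmod_triangle (CInt (kernel n eta e) 0 r) (- (CInt (kernel n eta e) 0 r - RtoC (gamma_int n eta r)))).
  replace (CInt (kernel n eta e) 0 r + - (CInt (kernel n eta e) 0 r - RtoC (gamma_int n eta r)))%C
    with (RtoC (gamma_int n eta r)) in T by ring.
  rewrite Cmod_opp, Cmod_R in T. generalize (Rle_abs (gamma_int n eta r)). lra.
Qed.

(** For [y <= 1/2], [(1 + 2y)(1 - y) >= 1], hence [1 / (1 - y) <= e^{2y}]. This prices the factor
    [e^{pt/T}], which lowers the rate from [eta] to [eta (1 - y)]. *)
Lemma gamma_val_shift (n : nat) (eta y : R) : 0 < eta -> 0 <= y <= / 2 ->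
  gamma_val n (eta * (1 - y)) <= gamma_val n eta * exp (2 * y * INR (S n)).
Proof.
  intros He Hy. unfold gamma_val.
  assert (P1 : 0 < eta ^ S n) by (apply pow_lt, He).
  assert (P2 : 0 < (1 - y) ^ S n) by (apply pow_lt; lra).
  assert (P3 := INR_fact_lt_0 n).
  rewrite Rpow_mult_distr, (Rmult_comm (2 * y)), <- exp_pow.
  apply Rmult_le_reg_r with (eta ^ S n * (1 - y) ^ S n); [apply Rmult_lt_0_compat; assumption|].
  replace (INR (fact n) / (eta ^ S n * (1 - y) ^ S n) * (eta ^ S n * (1 - y) ^ S n)) with (INR (fact n) * 1) by (field; lra).
  replace (INR (fact n) / eta ^ S n * exp (2 * y) ^ S n * (eta ^ S n * (1 - y) ^ S n)) with
    (INR (fact n) * (exp (2 * y) ^ S n * (1 - y) ^ S n)) by (field; lra).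
  apply Rmult_le_compat_l; [lra|]. rewrite <- Rpow_mult_distr. apply pow_R1_Rle.
  assert (A := exp_ineq1_le (2 * y)).
  apply Rle_trans with ((1 + 2 * y) * (1 - y)); [nra|]. apply Rmult_le_compat_r; lra.
Qed.

(** Each of the [n + 1] powers gains [e^{-m}]; with [n + 1 >= T] this outweighs any growth [e^{cT}]
    with [c < m]. *)
Lemma gamma_val_ratio (n : nat) (beta m : R) : 0 < beta ->
  gamma_val n beta = gamma_val n (beta * exp (- m)) * exp (- (m * INR (S n))).
Proof.
  intros Hb. unfold gamma_val. rewrite Rpow_mult_distr, exp_pow.
  replace (INR (S n) * - m) with (- (m * INR (S n))) by ring.
  assert (P1 : 0 < beta ^ S n) by (apply pow_lt, Hb). assert (P2 := exp_pos (- (m * INR (S n)))). field. lra.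
Qed.

Lemma rnorm_scaled (p : nat) (lam : nat -> R) : 0 < rnorm p lam ->
  rnorm p (fun i => lam i / rnorm p lam) = 1.
Proof.
  intros HL. set (L := rnorm p lam) in *. unfold rnorm.
  assert (E : forall q, sumn q (fun i => (lam i / L) ^ 2) = sumn q (fun i => lam i ^ 2) * / (L * L)).
  { induction q; [simpl; ring|].
    change (sumn q (fun i => (lam i / L) ^ 2) + (lam q / L) ^ 2 = (sumn q (fun i => lam i ^ 2) + lam q ^ 2) * / (L * L)).
    rewrite IHq. field. lra. }
  rewrite E. replace (sumn p (fun i => lam i ^ 2)) with (L * L).
  - rewrite Rinv_r by (apply Rgt_not_eq, Rmult_lt_0_compat; exact HL). apply sqrt_1.
  - apply sqrt_sqrt, sumn_ge_0. intros; apply pow2_ge_0.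
Qed.

Lemma inner_scaled (p : nat) (lam : nat -> R) (t : R) : 0 < rnorm p lam ->
  inner p (fun i => t * (lam i / rnorm p lam)) lam = t * rnorm p lam.
Proof.
  intros HL.
  assert (E : forall q, inner q (fun i => t * (lam i / rnorm p lam)) lam = t / rnorm p lam * sumn q (fun i => lam i ^ 2)).
  { unfold inner. induction q; [simpl; ring|].
    change (sumn q (fun i => t * (lam i / rnorm p lam) * lam i) + t * (lam q / rnorm p lam) * lam q =
      t / rnorm p lam * (sumn q (fun i => lam i ^ 2) + lam q ^ 2)). rewrite IHq. field. lra. }
  rewrite E. replace (sumn p (fun i => lam i ^ 2)) with (rnorm p lam * rnorm p lam).
  - field. lra.
  - apply sqrt_sqrt, sumn_ge_0. intros; apply pow2_ge_0.
Qed.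

Lemma coord_le_rnorm (p : nat) (lam : nat -> R) (i : nat) : (i < p)%nat -> Rabs (lam i) <= rnorm p lam.
Proof.
  intros Hi. rewrite <- sqrt_Rsqr_abs. apply sqrt_le_1_alt.
  induction p; [lia|]. change (Rsqr (lam i) <= sumn p (fun i => lam i ^ 2) + lam p ^ 2).
  assert (P := sumn_ge_0 p (fun i => lam i ^ 2) (fun i _ => pow2_ge_0 (lam i))).
  destruct (Nat.eq_dec i p) as [->|N].
  - rewrite Rsqr_pow2. lra.
  - generalize (IHp ltac:(lia)) (pow2_ge_0 (lam p)). lra.
Qed.

(** The order of choices matters: [eps] gives the threshold for [T], then come [n] from [T], [delta]
    from [n], and the cut-off [r] from all of them. None of these enters [K], which depends only on
    [p] and [eta]. *)
Lemma fourier_avg_small (p : nat) (sigma C0 : R) (F : (nat -> C) -> C) (lam : nat -> R) :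
  0 < sigma -> 0 < C0 -> entire p F -> B_almost_periodic p (restrR F) ->
  (forall z : nat -> C, Cmod (F z) <= C0 * exp (sigma * cnorm p z)) ->
  rnorm p lam > sigma ->
  exists K, 0 < K /\ forall eps, 0 < eps -> exists T1, forall T, T1 <= T ->
    Cmod (fourier_avg p (restrR F) lam T) <= K * eps.
Proof.
  intros Hs HC0 HF Hap Hgr Hlam. set (L := rnorm p lam) in *.
  assert (HL : 0 < L) by lra.
  (* Halfway between [sigma / L] and 1: above the first, so that [beta > 0]; below the second, so
     that [ca > 0]. *)
  set (sa := (sigma / L + 1) / 2). set (ca := sqrt (1 - sa * sa)).
  assert (HsL : 0 < sigma / L < 1).
  { split; [apply Rdiv_lt_0_compat; lra|]. apply Rmult_lt_reg_r with L; [exact HL|].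
    unfold Rdiv. rewrite Rmult_assoc, Rinv_l by lra. lra. }
  assert (Hsa : 0 < sa < 1) by (unfold sa; lra).
  assert (Hca : 0 < ca) by (apply sqrt_lt_R0; nra).
  assert (Hcs : ca * ca + sa * sa = 1) by (unfold ca; rewrite sqrt_sqrt by nra; ring).
  assert (HLs : sigma < L * sa).
  { unfold sa. replace (L * ((sigma / L + 1) / 2)) with ((sigma + L) / 2) by (field; lra). lra. }
  set (beta := L * sa - sigma). assert (Hb : 0 < beta) by (unfold beta; lra).
  (* [sigma p] pays for the growth [e^{sigma p T}] over the cube; the extra 1 leaves [e^{-T}]. *)
  set (m := sigma * INR p + 1). set (eta := beta * exp (- m)).
  assert (He : 0 < eta) by (apply Rmult_lt_0_compat; [exact Hb | apply exp_pos]).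
  (* Cut to zero from [p] on, as the shift lemmas require; this also bounds all coordinates of [u]
     by 1, which gives continuity of the translation for the uniform topology. *)
  set (u := fun i => if Nat.ltb i p then lam i / L else 0).
  assert (Hu : rnorm p u = 1).
  { rewrite <- (rnorm_scaled p lam HL). unfold rnorm at 1 2. f_equal. apply sumn_ext. intros i Hi.
    unfold u. rewrite (proj2 (Nat.ltb_lt i p) Hi). reflexivity. }
  set (f := restrR F) in *.
  assert (Hf : CC (f : RN -> C)).
  { apply (CC_entire p F HF (fun (x : RN) i => RtoC (x i))). intros i _. apply CC_RtoC. intros; apply continuous_coord. }
  (* Bounds [e^{2 yy (n+1)}] for [yy = p / (eta T)] and [n + 1 <= 2T]. *)
  set (K1 := exp (4 * INR p / eta)).
  assert (HK1 : 0 < K1) by apply exp_pos.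
  exists (4 + 6 * K1). split; [lra|]. intros eps Heps.
  destruct (ap_mean_shift p f lam Hf Hap eps Heps) as [T1 [HT1 Hshift]].
  (* [T >= T2] yields [C0 e^{-T} <= eps], because [e^T >= T]; [T >= T3] yields [yy <= 1/2]. *)
  set (T2 := C0 / eps). set (T3 := 2 * INR p / eta).
  exists (Rmax (Rmax 1 T1) (Rmax T2 T3)). intros T HT.
  assert (HT1' : T1 <= T) by (eapply Rle_trans; [|exact HT]; eapply Rle_trans; [apply Rmax_r | apply Rmax_l]).
  assert (HTg1 : 1 <= T) by (eapply Rle_trans; [|exact HT]; eapply Rle_trans; [apply Rmax_l | apply Rmax_l]).
  assert (HT2 : T2 <= T) by (eapply Rle_trans; [|exact HT]; eapply Rle_trans; [apply Rmax_l | apply Rmax_r]).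
  assert (HT3 : T3 <= T) by (eapply Rle_trans; [|exact HT]; eapply Rle_trans; [apply Rmax_r | apply Rmax_r]).
  assert (Tp : 0 < T) by lra.
  (* [n] is the integer part of [T]: [n + 1 >= T] secures the exponential gain, and [n + 1 <= 2T],
     from [T >= 1], the bound by [K1]. *)
  destruct (nfloor_ex T ltac:(lra)) as [n [Hn1 Hn2]].
  assert (HSn : INR (S n) = INR n + 1) by apply S_INR.
  set (W := gamma_val n eta). assert (HW : 0 < W) by (apply gamma_val_pos, He).
  set (N2 := INR (S (S n)) * INR (S n)).
  assert (HN2 : 0 < N2) by (apply Rmult_lt_0_compat; apply lt_0_INR; lia).
  (* The Gamma value of order [n + 2] is [N2 W / eta^2], so the Gaussian costs at most [W / 4].
     Truncation costs another [W / 4], which leaves mass at least [W / 2]. *)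
  set (delta := eta * eta / (4 * N2)).
  assert (Hd : 0 < delta) by (apply Rdiv_lt_0_compat; [apply Rmult_lt_0_compat; assumption | lra]).
  set (e := Cpair (delta * ca) (delta * sa)).
  assert (Hfe : 0 <= fst e) by (simpl; apply Rmult_le_pos; lra).
  assert (Hme : Cmod e = delta).
  { replace e with (RtoC delta * Cpair ca sa)%C by (unfold e, Cpair, Cmult; simpl; f_equal; ring).
    rewrite Cmod_mult, Cmod_R, Rabs_pos_eq by lra.
    unfold Cmod, Cpair; simpl. replace (ca * (ca * 1) + sa * (sa * 1)) with 1 by lra. rewrite sqrt_1. ring. }
  set (Smax := INR p * T).
  destruct (ray_estimate p F sigma C0 u HF Hs HC0 Hgr Hu L ca sa eta delta n HL Hca Hcs HLs He Hd Smax (eps * W)) as [R1 [HR1 Hray]].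
  { apply Rmult_lt_0_compat; assumption. }
  destruct (gamma_int_ge n eta He (W / 4)) as [R2 Hmass]; [lra|].
  set (r := Rmax R1 R2). assert (Hr1 : R1 <= r) by apply Rmax_l. assert (Hr2 : R2 <= r) by apply Rmax_r.
  assert (Hr : 0 <= r) by lra.
  specialize (Hray r Hr1). specialize (Hmass r Hr2).
  set (k := kernel n eta e). assert (Hk : CC k) by apply CC_kernel.
  assert (Mk : W / 2 <= Cmod (CInt k 0 r)).
  { eapply Rle_trans; [|apply (kernel_mass n eta e r Hfe Hr)]. rewrite Hme.
    assert (G := gamma_int_le (S (S n)) eta r He Hr).
    rewrite !gamma_val_S in G by exact He. fold W in G.
    replace (INR (S (S n)) * (INR (S n) * W / eta) / eta) with (N2 * W / (eta * eta)) in G by (unfold N2; field; lra).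
    assert (G2 : delta * gamma_int (S (S n)) eta r <= delta * (N2 * W / (eta * eta))) by (apply Rmult_le_compat_l; lra).
    replace (delta * (N2 * W / (eta * eta))) with (W / 4) in G2 by (unfold delta; field; lra). fold W in Hmass. lra. }
  set (y := fun t : R => (fun i => t * u i) : RN).
  set (A := cmean p T (fun x => f x * character p lam x)%C).
  change (Cmod A <= (4 + 6 * K1) * eps).
  set (H := fun w : R * RN => (f (vadd (snd w) (y (fst w))) * character p lam (vadd (snd w) (y (fst w))))%C).
  assert (Cv : forall w : R * RN, continuous (fun w : R * RN => vadd (snd w) (y (fst w)) : RN) w).
  { intros w. apply continuous_RN. intros e0.
    assert (Hui : forall i, Rabs (u i) <= 1).
    { intros i. destruct (Nat.ltb_spec i p) as [Hi|Hi].
      - rewrite <- Hu. apply coord_le_rnorm, Hi.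
      - unfold u. rewrite (proj2 (Nat.ltb_ge i p) Hi), Rabs_R0. lra. }
    assert (E2 : 0 < e0 / 2) by (generalize (cond_pos e0); lra).
    exists (mkposreal _ E2). intros v [V1 V2] i. unfold vadd, y.
    assert (B1 : Rabs (fst v - fst w) < e0 / 2) by exact V1.
    assert (B2 : Rabs (snd v i - snd w i) < e0 / 2) by exact (V2 i).
    change (Rabs (snd v i + fst v * u i - (snd w i + fst w * u i)) < e0).
    revert B1 B2. generalize (fst v : R) (snd v i : R) (fst w : R) (snd w i : R). intros a1 b1 a2 b2 B1 B2.
    replace (b1 + a1 * u i - (b2 + a2 * u i)) with ((b1 - b2) + (a1 - a2) * u i) by ring.
    eapply Rle_lt_trans; [apply Rabs_triang|]. rewrite Rabs_mult.
    assert (Rabs (a1 - a2) * Rabs (u i) <= Rabs (a1 - a2) * 1) by (apply Rmult_le_compat_l; [apply Rabs_pos | apply Hui]).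
    lra. }
  assert (CH : CC H).
  { apply CC_mult.
    - apply (CC_comp (f : RN -> C) (fun w : R * RN => vadd (snd w) (y (fst w)) : RN) Hf Cv).
    - apply (CC_comp (fun x : RN => character p lam x) (fun w : R * RN => vadd (snd w) (y (fst w)) : RN) (CC_character p lam) Cv). }
  set (G := fun t : R => cmean p T (fun x => H (t, x))).
  assert (CG : CC G) by (apply (CC_cmean_param p T H Tp CH)).
  assert (CHk : CC (fun w : R * RN => (k (fst w) * H w)%C)).
  { apply CC_mult; [|exact CH]. apply (CC_comp k fst Hk). intros; apply continuous_fst. }
  (* The integral in [t] is moved inside the mean over the cube, where [ray_estimate] applies for
     each fixed [x]. *)
  assert (HB : Cmod (CInt (fun t => k t * G t)%C 0 r) <= C0 * exp (sigma * Smax) * gamma_val n beta + eps * W).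
  { assert (EG : forall t, (k t * G t)%C = cmean p T (fun x => k t * H (t, x))%C).
    { intros t. unfold G. symmetry. apply (cmean_scal p T (k t) (fun x => H (t, x)) Tp).
      apply (CC_comp H (fun x : RN => (t, x)) CH). intros x. apply continuous_pair; [apply continuous_const | apply continuous_id]. }
    rewrite (CInt_ext _ _ 0 r EG).
    assert (Sw := CInt_cmean_swap p T 0 r (fun w : R * RN => (k (fst w) * H w)%C) Tp Hr CHk). cbn [fst] in Sw.
    rewrite Sw.
    assert (CI : CC (fun x : RN => CInt (fun t : R => k t * H (t, x))%C 0 r)).
    { apply (CC_CInt_param (fun w : RN * R => (k (snd w) * H (snd w, fst w))%C) 0 r Hr).
      apply (CC_comp (fun w : R * RN => (k (fst w) * H w)%C) (fun w : RN * R => (snd w, fst w)) CHk).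
      intros w. apply continuous_pair; [apply continuous_snd | apply continuous_fst]. }
    eapply Rle_trans; [apply (Cmod_cmean_le p T _ Tp CI)|].
    rewrite <- (cube_avg_const p T (C0 * exp (sigma * Smax) * gamma_val n beta + eps * W) Tp).
    apply (cube_avg_le p T _ _ Tp (CC_Cmod _ CI)); [intros; apply continuous_const|].
    intros x Hx _.
    assert (HSx : sumn p (fun i => Rabs (x i)) <= Smax).
    { unfold Smax. rewrite <- sumn_const. apply sumn_le. exact Hx. }
    specialize (Hray x HSx).
    (* Because [u] pairs with [lam] to [L], the character at [x + tu] is the one at [x] times
       [e^{-iLt}]. Together with the kernel this factor is the exponential in [ray_fun], which is
       holomorphic in [t]. *)
    assert (Ex : CInt (fun t : R => k t * H (t, x))%C 0 r =
      (character p lam x * CInt (fun t : R => ray_fun F u L ca sa eta delta n x (RtoC t)) 0 r)%C).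
    { destruct (ray_fun_holo p F u HF L ca sa eta delta n x) as [d Hdd].
      rewrite <- CInt_scal.
      2: { generalize (CC_on_ray _ (RtoC 1) (cderiv_ccont _ _ Hdd)). intros Q.
           replace (fun t : R => ray_fun F u L ca sa eta delta n x (RtoC t)) with
             (fun t : R => ray_fun F u L ca sa eta delta n x (RtoC t * RtoC 1)%C); [exact Q|].
           apply functional_extensionality; intro t. f_equal. ring. }
      apply CInt_ext. intros t. unfold H, k, kernel, ray_fun. cbn [fst snd].
      replace (f (vadd x (y t))) with (F (cline x u (RtoC t))).
      2: { unfold f, restrR. f_equal. apply functional_extensionality; intro i.
           unfold cline, vadd, y. rewrite RtoC_plus, RtoC_mult. reflexivity. }
      assert (Ec : character p lam (vadd x (y t)) = (character p lam x * cis (- (L * t)))%C).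
      { unfold character. rewrite inner_vadd, Ropp_plus_distr, cis_add. do 3 f_equal.
        transitivity (inner p (fun i => t * (lam i / L)) lam).
        - apply sumn_ext. intros i Hi. unfold y, u. rewrite (proj2 (Nat.ltb_lt i p) Hi). reflexivity.
        - unfold L at 1. rewrite inner_scaled by exact HL. apply Rmult_comm. }
      rewrite Ec, RtoC_mult, RtoC_pow.
      assert (Eq : cexp (RtoC t * Cpair (- eta) (- L) + RtoC t * RtoC t * Cpair (- (delta * ca)) (- (delta * sa))) =
        (RtoC (exp (- (eta * t))) * cis (- (L * t)) * cexp (RtoC (- (t * t)) * e))%C).
      { rewrite cexp_add. f_equal.
        - unfold cexp. f_equal; [do 2 f_equal | f_equal]; unfold Cpair; simpl; ring.
        - f_equal. unfold e, Cpair, Cmult; simpl. f_equal; ring. }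
      rewrite Eq. ring. }
    assert (Hx' : Cmod (CInt (fun t : R => k t * H (t, x))%C 0 r) <= C0 * exp (sigma * Smax) * gamma_val n beta + eps * W).
    { rewrite Ex, Cmod_mult, Cmod_character, Rmult_1_l. exact Hray. }
    exact Hx'. }
  set (yy := INR p / (eta * T)).
  assert (Hyy : 0 <= yy <= / 2).
  { split.
    - apply Rdiv_le_0_compat; [apply pos_INR | apply Rmult_lt_0_compat; assumption].
    - unfold yy. apply Rmult_le_reg_r with (2 * (eta * T)).
      + apply Rmult_lt_0_compat; [lra | apply Rmult_lt_0_compat; assumption].
      + replace (INR p / (eta * T) * (2 * (eta * T))) with (2 * INR p) by (field; lra).
        replace (/ 2 * (2 * (eta * T))) with (eta * T) by field.
        apply Rmult_le_compat_r with (r := eta) in HT3; [|lra].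
        unfold T3 in HT3. replace (2 * INR p / eta * eta) with (2 * INR p) in HT3 by (field; lra). lra. }
  (* The shift error [3 eps e^{pt/T}] turns the kernel bound into a Gamma integrand of rate
     [eta (1 - yy)]. *)
  assert (HD : Cmod (CInt (fun t => k t * (G t - A))%C 0 r) <= 3 * eps * (W * K1)).
  { assert (CA : CC (fun t : R => (G t - A)%C)) by (apply CC_minus; [exact CG | apply CC_const]).
    eapply Rle_trans; [apply Cmod_CInt_le; [exact Hr | apply CC_mult; assumption]|].
    apply Rle_trans with (RInt (fun t => scal (3 * eps) (t ^ n * exp (- (eta * (1 - yy) * t)))) 0 r).
    - apply RInt_le; [exact Hr | apply ex_RInt_cont, CC_Cmod, CC_mult; assumption
        | apply (ex_RInt_scal (V := R_NormedModule)), ex_RInt_cont, continuous_gamma |].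
      intros t Ht. rewrite Cmod_mult.
      assert (Q1 := Cmod_kernel_le n eta e t Hfe ltac:(lra)). fold k in Q1.
      assert (Q2 : Cmod (G t - A) <= 3 * eps * exp (INR p * t / T)).
      { apply (Hshift T t HT1' ltac:(lra) (y t)).
        - intros i Hi. change (Rabs (t * u i) <= t). rewrite Rabs_mult, (Rabs_pos_eq t) by lra.
          rewrite <- (Rmult_1_r t) at 2. apply Rmult_le_compat_l; [lra|]. rewrite <- Hu. apply coord_le_rnorm, Hi.
        - intros i Hi. unfold y, u. rewrite (proj2 (Nat.ltb_ge i p) Hi). exact (Rmult_0_r t). }
      apply Rle_trans with ((t ^ n * exp (- (eta * t))) * (3 * eps * exp (INR p * t / T))).
      + apply Rmult_le_compat; try apply Cmod_ge_0; assumption.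
      + apply Req_le. change (t ^ n * exp (- (eta * t)) * (3 * eps * exp (INR p * t / T)) =
          3 * eps * (t ^ n * exp (- (eta * (1 - yy) * t)))).
        replace (- (eta * (1 - yy) * t)) with (- (eta * t) + INR p * t / T) by (unfold yy; field; lra).
        rewrite exp_plus. ring.
    - rewrite (RInt_scal (V := R_CompleteNormedModule)) by (apply ex_RInt_cont, continuous_gamma).
      apply (Rmult_le_compat_l (3 * eps)); [lra|].
      assert (P0 : 0 < eta * (1 - yy)) by (apply Rmult_lt_0_compat; lra).
      eapply Rle_trans; [apply (gamma_int_le n _ r P0 Hr)|].
      eapply Rle_trans; [apply (gamma_val_shift n eta yy He Hyy)|]. fold W.
      apply Rmult_le_compat_l; [lra|]. apply exp_le_compat. unfold yy.
      replace (4 * INR p / eta) with (2 * (INR p / (eta * T)) * (2 * T)) by (field; lra).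
      apply Rmult_le_compat_l; [fold yy; lra|]. lra. }
  assert (EA : (A * CInt k 0 r = CInt (fun t => k t * G t) 0 r - CInt (fun t => k t * (G t - A)) 0 r)%C).
  { assert (CA : CC (fun t : R => (G t - A)%C)) by (apply CC_minus; [exact CG | apply CC_const]).
    rewrite <- CInt_minus by (apply CC_mult; assumption).
    rewrite <- CInt_scal by exact Hk. apply CInt_ext. intros t. ring. }
  assert (Fin : Cmod A * Cmod (CInt k 0 r) <= C0 * exp (sigma * Smax) * gamma_val n beta + eps * W + 3 * eps * (W * K1)).
  { rewrite <- Cmod_mult, EA. eapply Rle_trans; [apply Cmod_triangle|]. rewrite Cmod_opp. lra. }
  assert (Tiny : C0 * exp (sigma * Smax) * gamma_val n beta <= eps * W).
  { rewrite (gamma_val_ratio n beta m Hb). fold eta. fold W.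
    replace (C0 * exp (sigma * Smax) * (W * exp (- (m * INR (S n))))) with
      (C0 * (exp (sigma * Smax) * exp (- (m * INR (S n)))) * W) by ring.
    rewrite <- exp_plus. apply Rmult_le_compat_r; [lra|].
    assert (X : sigma * Smax + - (m * INR (S n)) <= - T).
    { assert (Hm : 0 < m) by (unfold m; assert (0 <= sigma * INR p) by (apply Rmult_le_pos; [lra | apply pos_INR]); lra).
      assert (m * T <= m * INR (S n)) by (apply Rmult_le_compat_l; lra).
      unfold Smax. replace (sigma * (INR p * T)) with (m * T - T) by (unfold m; ring). lra. }
    apply Rle_trans with (C0 * exp (- T)); [apply Rmult_le_compat_l; [lra | apply exp_le_compat, X]|].
    assert (Y := exp_ineq1_le T). assert (Z : exp (- T) * exp T = 1) by (rewrite <- exp_plus, Rplus_opp_l; apply exp_0).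
    apply Rmult_le_compat_r with (r := eps) in HT2; [|lra]. unfold T2 in HT2.
    replace (C0 / eps * eps) with C0 in HT2 by (field; lra).
    apply Rmult_le_reg_r with (exp T); [apply exp_pos|]. rewrite Rmult_assoc, Z, Rmult_1_r.
    apply Rle_trans with (eps * T); [lra|]. apply Rmult_le_compat_l; lra. }
  (* Altogether [|A| W / 2 <= 2 eps W + 3 eps W K1], the origin of the constant [4 + 6 K1]. *)
  assert (Q : Cmod A * (W / 2) <= Cmod A * Cmod (CInt k 0 r)) by (apply Rmult_le_compat_l; [apply Cmod_ge_0 | exact Mk]).
  apply Rmult_le_reg_r with (W / 2); [lra|]. nra.
Qed.

Theorem theorem1 (p : nat) (sigma C0 : R) (F : (nat -> C) -> C) :
  (1 <= p)%nat -> 0 < sigma -> 0 < C0 ->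
  entire p F ->
  B_almost_periodic p (restrR F) ->
  (forall z : nat -> C, Cmod (F z) <= C0 * exp (sigma * cnorm p z)) ->
  forall lam : nat -> R, rnorm p lam > sigma ->
    fourier_coef_zero p (restrR F) lam.
Proof.
  intros _ Hs HC0 HF Hap Hgr lam Hlam.
  destruct (fourier_avg_small p sigma C0 F lam Hs HC0 HF Hap Hgr Hlam) as [K [HK H]].
  assert (Hlim : forall g : R -> R, (forall T, Rabs (g T) <= Cmod (fourier_avg p (restrR F) lam T)) ->
    is_lim g p_infty 0).
  { intros g Hg. apply is_lim_spec. intros eps.
    assert (He : 0 < eps / (2 * K)) by (apply Rdiv_lt_0_compat; [apply cond_pos | lra]).
    destruct (H _ He) as [T1 HT1]. exists T1. intros T HT. rewrite Rminus_0_r.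
    eapply Rle_lt_trans; [apply Hg|]. eapply Rle_lt_trans; [apply HT1; lra|].
    replace (K * (eps / (2 * K))) with (eps / 2) by (field; lra). generalize (cond_pos eps); lra. }
  split; apply Hlim; intros T; [apply fst_le_Cmod | apply snd_le_Cmod].
Qed.
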